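(* Let $A\neq0$ and $B<0$ be real numbers, and consider the arc-length parametrized curves $X:\mathbf R\to\mathbf C$ satisfying $$A\langle X,T\rangle+B\langle X,N\rangle=k\quad\text{on }\mathbf R,$$ other than the circle of radius $\frac1{\sqrt{-B}}$ centered at the origin. Each such curve is of one of the following two types. 1) Curves such that the limiting behaviour when going along the curve in each of the two directions is wrapping around the circle of radius $\frac{1}{\sqrt{-B}}$ centered at the origin, clockwise if $A<0$ and counterclockwise if $A>0$. These curves form a one-dimensional family. 2) Curves such that the curvature $k$ never changes sign and the two ends behave as follows. One end wraps around the circle of radius $\frac1{\sqrt{-B}}$ centered at the origin in its limiting behaviour, clockwise if $A<0$ and counterclockwise if $A>0$. The other end goes out to infinity ($|X|\to\infty$), spirals infinitely many circles around the origin (a continuous polar angle of $X$ along it tends to $+\infty$ or $-\infty$) and has infinite total curvature (the integral of $k\,ds$ along this end diverges to $+\infty$ or $-\infty$). The curvature goes to $0$ along this end, and its limiting growing direction is $-B-iA$ times the location, i.e. $$\frac{|X|\,T_{\mathrm{out}}}{X}\longrightarrow\frac{-B-iA}{\sqrt{A^2+B^2}}$$ along this end, where $T_{\mathrm{out}}$ is the unit tangent pointing in the direction of travel towards infinity. There is at least one curve of type 2. Under the curve shortening flow all of these curves rotate and shrink with angular function $f(t)=\frac{A}{2B}\log(2Bt+1)$ and scaling function $g(t)=\sqrt{2Bt+1}$, i.e. $\hat X(u,t)=g(t)e^{if(t)}X(u)$, $0\le t<-\frac1{2B}$, is the curve shortening flow of $X$ (up to tangential diffeomorphisms). A singularity forms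 at time $t=-\frac1{2B}$ (the curvature becomes unbounded as $t\to-\frac1{2B}$). The curves of type 1 are bounded, so they disappear into the origin, i.e. $\sup_u|\hat X(u,t)|\to0$ as $t\to-\frac1{2B}$.
   Context: The plane is identified with $\mathbf C$, with the real inner product $\langle z,w\rangle=\mathrm{Re}(z\bar w)$. Curves are smooth, defined on all of $\mathbf R$ and parametrized by arc length ($|X'|=1$). $T=X'$ is the unit tangent, $N=iT$ the leftward pointing normal, and $k=\langle X'',N\rangle$ the signed curvature. A family $\hat X(u,t)$ of immersed curves with $\hat X(u,0)=X(u)$ is the curve shortening flow of $X$ (up to tangential diffeomorphisms) if $\langle\partial_t\hat X(u,t),N(u,t)\rangle=k(u,t)$ for all $(u,t)$, where $N(u,t)$ and $k(u,t)$ are the leftward normal and signed curvature of $u\mapsto\hat X(u,t)$. An end of $X$ ''wraps around the circle of radius $\rho$ centered at the origin'' counterclockwise (resp. clockwise) if, travelling along the curve towards that end, $|X|\to\rho$ and a continuous polar angle of $X$ tends to $+\infty$ (resp. $-\infty$). ''The curves of type 1 form a one-dimensional family'' means: modulo rotations about the origin and shifts of the arc-length parameter, they are parametrized by one real parameter, which can for example be taken to be the value $y_0\in\mathbf R$ of $y=-B\langle X,T\rangle+A\langle X,N\rangle$ at the point of the curve where $k=0$. *)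

(* Defs.v *)
From Stdlib Require Import Reals Lra.
From Coquelicot Require Import Coquelicot.
Open Scope R_scope.

(** * Plane curves *)

Definition inner (z w : C) : R := Re (Cmult z (Cconj w)).

Definition expi (a : R) : C := (cos a, sin a).

Definition curve_deriv (X : R -> C) (s : R) : C :=
  (Derive (fun u => Re (X u)) s, Derive (fun u => Im (X u)) s).

Definition smooth_curve (X : R -> C) : Prop :=
  forall (n : nat) (s : R),
    ex_derive_n (fun u => Re (X u)) n s /\ ex_derive_n (fun u => Im (X u)) n s.

Definition arc_length (X : R -> C) : Prop :=
  forall s, Cmod (curve_deriv X s) = 1.

Definition immersed (X : R -> C) : Prop :=
  smooth_curve X /\ forall s, curve_deriv X s <> 0%C.

(** Tangent, normal and curvature of an immersed curve in an arbitrary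
    parametrization: differentiation with respect to arc length is
    [/ |X'| * d/du].  The lemmas below give the formulas [T = X'] and
    [k = <X'', N>] when [|X'| = 1]. *)

Definition tangent (X : R -> C) (s : R) : C :=
  (curve_deriv X s / RtoC (Cmod (curve_deriv X s)))%C.

Definition normal (X : R -> C) (s : R) : C := (Ci * tangent X s)%C.

Definition curvature (X : R -> C) (s : R) : R :=
  inner (curve_deriv (tangent X) s) (normal X s) / Cmod (curve_deriv X s).

Lemma tangent_arc_length (X : R -> C) :
  arc_length X -> forall s, tangent X s = curve_deriv X s.
Proof.
intros H s; unfold tangent; rewrite H.
field; intros E; apply (f_equal fst) in E; simpl in E; lra.
Qed.

Lemma curvature_arc_length (X : R -> C) :
  arc_length X ->
  forall s, curvature X s
            = inner (curve_deriv (curve_deriv X) s) (normal X s).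
Proof.
intros H s; unfold curvature; rewrite H, Rdiv_1_r.
f_equal; unfold curve_deriv at 1 2.
f_equal; apply Derive_ext; intros u; now rewrite tangent_arc_length.
Qed.

(** * Self-similar curves *)

Definition traces_circle (rho : R) (X : R -> C) : Prop :=
  forall z : C, (exists s, X s = z) <-> Cmod z = rho.

Definition self_similar_curve (A B : R) (X : R -> C) : Prop :=
  smooth_curve X /\ arc_length X /\
  (forall s, A * inner (X s) (tangent X s) + B * inner (X s) (normal X s)
             = curvature X s) /\
  ~ traces_circle (1 / sqrt (- B)) X.

Definition yfun (A B : R) (X : R -> C) (s : R) : R :=
  - B * inner (X s) (tangent X s) + A * inner (X s) (normal X s).

Definition congruent (X1 X2 : R -> C) : Prop :=
  exists a s0 : R, forall s, X2 s = (expi a * X1 (s + s0)%R)%C.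

(** * Behaviour of the ends *)

(** The predicates [polar_angle], [wraps_*] and [spirals_out] concern the end
    [s -> +oo].  The other end of [X] is the end [s -> +oo] of [reverse X];
    the direction of travel towards that end, hence the tangent, is then the
    one of [reverse X]. *)

Definition reverse (X : R -> C) (s : R) : C := X (- s).

(** The angle is only required near the end, since the curve may pass through
    the origin elsewhere. *)
Definition polar_angle (X : R -> C) (theta : R -> R) : Prop :=
  exists s0 : R, forall s, s0 < s ->
    X s <> 0%C /\ continuous theta s /\
    X s = (RtoC (Cmod (X s)) * expi (theta s))%C.

Definition polar_angle_tends_to (X : R -> C) (l : Rbar) : Prop :=
  exists theta : R -> R, polar_angle X theta /\ is_lim theta p_infty l.

Definition wraps_ccw (rho : R) (X : R -> C) : Prop :=
  is_lim (fun s => Cmod (X s)) p_infty rho /\ polar_angle_tends_to X p_infty.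

Definition wraps_cw (rho : R) (X : R -> C) : Prop :=
  is_lim (fun s => Cmod (X s)) p_infty rho /\ polar_angle_tends_to X m_infty.

Definition wraps (A rho : R) (X : R -> C) : Prop :=
  (A < 0 -> wraps_cw rho X) /\ (0 < A -> wraps_ccw rho X).

Definition spirals_out (A B : R) (X : R -> C) : Prop :=
  is_lim (fun s => Cmod (X s)) p_infty p_infty /\
  (polar_angle_tends_to X p_infty \/ polar_angle_tends_to X m_infty) /\
  (is_lim (fun s => RInt (curvature X) 0 s) p_infty p_infty \/
   is_lim (fun s => RInt (curvature X) 0 s) p_infty m_infty) /\
  is_lim (curvature X) p_infty 0 /\
  filterlim (fun s => (RtoC (Cmod (X s)) * tangent X s / X s)%C)
    (Rbar_locally p_infty)
    (locally ((- RtoC B - Ci * RtoC A) / RtoC (sqrt (A ^ 2 + B ^ 2)))%C).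

Definition type1 (A B : R) (X : R -> C) : Prop :=
  wraps A (1 / sqrt (- B)) X /\ wraps A (1 / sqrt (- B)) (reverse X).

Definition type2 (A B : R) (X : R -> C) : Prop :=
  ((forall s, 0 <= curvature X s) \/ (forall s, curvature X s <= 0)) /\
  ((wraps A (1 / sqrt (- B)) X /\ spirals_out A B (reverse X)) \/
   (wraps A (1 / sqrt (- B)) (reverse X) /\ spirals_out A B X)).

(** * Curve shortening flow *)

(** The time derivative is taken within [0, tmax), so it is one-sided at 0. *)
Definition time_derivative (tmax : R) (Xh : R -> R -> C) (u t : R) (v : C)
    : Prop :=
  @filterdiff R_AbsRing R_NormedModule C_R_NormedModule (Xh u)
    (within (fun t' => 0 <= t' < tmax) (locally t))
    (fun h => @scal R_AbsRing C_R_NormedModule h v).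

Definition curve_shortening_flow (X : R -> C) (tmax : R) (Xh : R -> R -> C)
    : Prop :=
  (forall u, Xh u 0 = X u) /\
  forall t, 0 <= t < tmax ->
    immersed (fun u => Xh u t) /\
    forall u, exists v : C,
      time_derivative tmax Xh u t v /\
      inner v (normal (fun w => Xh w t) u) = curvature (fun w => Xh w t) u.

Definition rot_fun (A B t : R) : R := A / (2 * B) * ln (2 * B * t + 1).

Definition scale_fun (B t : R) : R := sqrt (2 * B * t + 1).

Definition rotating_shrinking (A B : R) (X : R -> C) (u t : R) : C :=
  (RtoC (scale_fun B t) * expi (rot_fun A B t) * X u)%C.

Definition curvature_blows_up (tmax : R) (Xh : R -> R -> C) : Prop :=
  forall M : R,
    at_left tmax (fun t => exists u, M < Rabs (curvature (fun w => Xh w t) u)).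

Definition bounded_curve (X : R -> C) : Prop :=
  exists M : R, forall s, Cmod (X s) <= M.

Definition disappears_into_origin (tmax : R) (Xh : R -> R -> C) : Prop :=
  exists S : R -> R,
    (forall t, 0 <= t < tmax ->
       is_lub (fun r => exists u, r = Cmod (Xh u t)) (S t)) /\
    filterlim S (at_left tmax) (locally 0).

(* Main.v *)
Require Import Defs.
From Stdlib Require Import Reals Lra Lia Classical FunctionalExtensionality.
From Coquelicot Require Import Coquelicot.
Open Scope R_scope.

(** Along a solution, the pair [x = A <X,T> + B <X,N> = k] and
    [y = - B <X,T> + A <X,N>] solves the planar system [x' = A + x y],
    [y' = b - x^2] with [b = - B], and determines the curve up to rotation
    because [(A - i B) X = (x + i y) T].  The line [x = 0] is crossed in one
    direction only.  Where [x > 0], [u = ln x] solves the damped oscillator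
    [u'' = - (A / x) u' + b - exp (2 u)], so for [A > 0] the energy decreases
    and orbits converge forward to the equilibrium, which is the circle.  By the
    symmetries [(x, y)(s) -> (- x, - y)(- s)] and [(A, x) -> (- A, - x)], an
    orbit meeting [x = 0] has both ends wrapping around the circle (type 1),
    while an orbit with [x] of constant sign has one such end; at the other end
    the energy is unbounded, and this forces [|y| -> oo] with [|x y|] bounded
    away from [0], which is the spiral of type 2.  Such an orbit exists by
    shooting. *)

(** * Real functions near infinity *)

(** The planar system is quadratic, so it is not evident that its solutions exist for all times,
    which the shooting needs. Global existence is borrowed from the curves: with the tangent angle
    as only unknown, [|T| = 1] holds by construction and [|X|] grows at most linearly, so the
    Lipschitz constant of the prescribed curvature also grows at most linearly in [s], and a single
    contraction works on the whole line. The system has two equilibria, [x = sqrt b] and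
    [x = - sqrt b]: the circle run through in either direction. Only the one where [x] has the sign
    of [A] attracts other orbits forward. Hence the sense of wrapping depends on [A] alone, and
    hypotheses of the form [x s1 ^ 2 <> b] are needed to tell an escaping orbit from the other
    equilibrium. Since an orbit meets [x = 0] at most once, its ordinate there labels the curves of
    type 1. Equal labels give the same planar orbit up to a shift, hence the same tangent up to a
    rotation, hence the same curve up to that rotation. *)

Lemma mean_value (f df : R -> R) (s t : R) :
  s <= t -> (forall r, s <= r <= t -> is_derive f r (df r)) ->
  exists c, s <= c <= t /\ f t - f s = df c * (t - s).
Proof.
intros Hst H.
destruct (MVT_gen f s t df) as [c [Hc E]].
- rewrite Rmin_left, Rmax_right by lra. intros r Hr; apply H; lra.
- rewrite Rmin_left, Rmax_right by lra. intros r Hr.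
  apply derivable_continuous_pt. exists (df r). apply is_derive_Reals, H; lra.
- rewrite Rmin_left, Rmax_right in Hc by lra. now exists c.
Qed.

Lemma growth_ge (f df : R -> R) (m s t : R) :
  s <= t -> (forall r, s <= r <= t -> is_derive f r (df r)) ->
  (forall r, s <= r <= t -> m <= df r) -> f s + m * (t - s) <= f t.
Proof.
intros Hst H Hm. destruct (mean_value f df s t Hst H) as [c [Hc E]].
specialize (Hm c Hc). nra.
Qed.

Lemma growth_le (f df : R -> R) (m s t : R) :
  s <= t -> (forall r, s <= r <= t -> is_derive f r (df r)) ->
  (forall r, s <= r <= t -> df r <= m) -> f t <= f s + m * (t - s).
Proof.
intros Hst H Hm. destruct (mean_value f df s t Hst H) as [c [Hc E]].
specialize (Hm c Hc). nra.
Qed.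

Lemma is_derive_continuity_pt (f : R -> R) (s l : R) :
  is_derive f s l -> continuity_pt f s.
Proof.
intros H. apply derivable_continuous_pt. exists l. now apply is_derive_Reals.
Qed.

Lemma is_derive_pos_local (f : R -> R) (s l : R) :
  is_derive f s l -> 0 < l ->
  exists d, 0 < d /\ forall h, 0 < h < d -> f s < f (s + h) /\ f (s - h) < f s.
Proof.
intros H Hl. apply is_derive_Reals in H.
destruct (H (l / 2)) as [d Hd]; [lra|].
exists d; split; [apply cond_pos|]. intros h Hh; split.
- assert (h <> 0) by lra.
  specialize (Hd h H0). rewrite Rabs_pos_eq in Hd by lra.
  specialize (Hd (proj2 Hh)). apply Rabs_def2 in Hd.
  assert (l / 2 < (f (s + h) - f s) / h) by lra.
  assert ((f (s + h) - f s) / h * h = f (s + h) - f s) by (field; lra). nra.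
- assert (- h <> 0) by lra.
  specialize (Hd (- h) H0). rewrite Rabs_Ropp, Rabs_pos_eq in Hd by lra.
  specialize (Hd (proj2 Hh)). apply Rabs_def2 in Hd.
  replace (s + - h) with (s - h) in Hd by ring.
  assert (l / 2 < (f (s - h) - f s) / - h) by lra.
  assert ((f (s - h) - f s) / - h * h = f s - f (s - h)) by (field; lra). nra.
Qed.

Lemma continuity_pt_lt_local (f : R -> R) (s c : R) :
  continuity_pt f s -> f s < c ->
  exists d, 0 < d /\ forall r, Rabs (r - s) < d -> f r < c.
Proof.
intros H Hc. destruct (H (c - f s)) as [d [Hd H']]; [lra|].
exists d; split; [easy|]. intros r Hr.
destruct (Req_dec r s) as [->|Hn]; [easy|].
assert (R_dist (f r) (f s) < c - f s).
{ apply H'. split; [split; [exact I | now apply not_eq_sym] | exact Hr]. }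
unfold R_dist in H0. apply Rabs_def2 in H0. lra.
Qed.

(** [r] is the supremum of the times up to which [f] stays at most [c]. It marks the exit from
    [f <= c] rather than the first contact: [f] may touch [c] earlier. *)
Lemma first_hit (f : R -> R) (s t c : R) :
  s <= t -> (forall r, continuity_pt f r) -> f s <= c -> c <= f t ->
  exists r, s <= r <= t /\ f r = c /\ forall q, s <= q <= r -> f q <= c.
Proof.
intros Hst Hf Hs Ht.
set (S := fun r => s <= r <= t /\ forall q, s <= q <= r -> f q <= c).
destruct (completeness S) as [r [Hub Hlub]].
- exists t. intros r [Hr _]; lra.
- exists s. split; [lra|]. intros q Hq. replace q with s by lra. easy.
- assert (Hsr : s <= r).
  { apply Hub. split; [lra|]. intros q Hq. replace q with s by lra. easy. }
  assert (Hrt : r <= t) by (apply Hlub; intros q [Hq _]; lra).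
  assert (Hlt : forall q, s <= q < r -> f q <= c).
  { intros q Hq. destruct (Rle_or_lt (f q) c) as [h|h]; [easy|exfalso].
    assert (r <= q); [|lra]. apply Hlub. intros u [Hu Hu'].
    destruct (Rle_or_lt u q) as [h'|h']; [easy|].
    assert (f q <= c) by (apply Hu'; lra). lra. }
  assert (Hle : f r <= c).
  { destruct (Rle_or_lt (f r) c) as [h|h]; [easy|exfalso].
    destruct (Req_dec s r) as [<-|Hn]; [lra|].
    destruct (continuity_pt_lt_local (fun x => - f x) r (- c)) as [d [Hd Hd']].
    - apply continuity_pt_opp, Hf.
    - lra.
    - set (q := Rmax s (r - d / 2)).
      assert (s <= q < r /\ r - d / 2 <= q) as [Hq Hq'].
      { unfold q, Rmax; destruct Rle_dec; lra. }
      specialize (Hlt q Hq). specialize (Hd' q).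
      rewrite Rabs_left in Hd' by lra. lra. }
  exists r. split; [lra|].
  assert (Hall : forall q, s <= q <= r -> f q <= c).
  { intros q Hq. destruct (Req_dec q r) as [->|Hn]; [easy|apply Hlt; lra]. }
  split; [|easy].
  destruct (Rle_lt_or_eq_dec _ _ Hle) as [h|h]; [exfalso|easy].
  assert (r < t). { destruct (Req_dec r t) as [->|]; lra. }
  destruct (continuity_pt_lt_local f r c (Hf r) h) as [d [Hd Hd']].
  set (q := Rmin t (r + d / 2)).
  assert (r < q <= t /\ q <= r + d / 2) as [Hq Hq'].
  { unfold q, Rmin; destruct Rle_dec; lra. }
  assert (q <= r); [|lra]. apply Hub. split; [lra|].
  intros u Hu. destruct (Rle_or_lt u r) as [h'|h']; [apply Hall; lra|].
  left; apply Hd'. rewrite Rabs_pos_eq; lra.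
Qed.

(** If [f] came back to 0 after being positive, the positive derivative there would make [f]
    negative just before. When [f s = 0], the same derivative condition makes [f] positive right
    after [s]. Serves below to show that orbits cannot leave certain regions of the phase plane. *)
Lemma barrier (f df : R -> R) (s : R) :
  (forall r, is_derive f r (df r)) -> 0 <= f s ->
  (forall r, s <= r -> f r = 0 -> 0 < df r) -> forall t, s < t -> 0 < f t.
Proof.
intros Hf Hs H0 t Ht.
destruct (Rle_or_lt (f t) 0) as [h|h]; [exfalso|easy].
assert (exists s', s < s' < t /\ 0 < f s') as [s' [Hs' Hp]].
{ destruct (Rle_lt_or_eq_dec _ _ Hs) as [h0|h0].
  - destruct (continuity_pt_lt_local (fun x => - f x) s 0) as [d [Hd Hd']].
    + eapply continuity_pt_opp, is_derive_continuity_pt, Hf.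
    + lra.
    + exists (Rmin ((s + t) / 2) (s + d / 2)).
      assert (s < Rmin ((s + t) / 2) (s + d / 2) < t) by
        (unfold Rmin; destruct Rle_dec; lra).
      split; [easy|].
      assert (H1 := Rmin_r ((s + t) / 2) (s + d / 2)).
      specialize (Hd' (Rmin ((s + t) / 2) (s + d / 2))).
      rewrite Rabs_pos_eq in Hd' by lra. lra.
  - destruct (is_derive_pos_local f s (df s) (Hf s)) as [d [Hd Hd']].
    + apply H0; lra.
    + set (h' := Rmin ((t - s) / 2) (d / 2)).
      assert (0 < h' < t - s /\ h' < d) as [? ?] by
        (unfold h', Rmin; destruct Rle_dec; lra).
      exists (s + h'). split; [lra|]. rewrite h0. apply Hd'; lra. }
destruct (first_hit (fun x => - f x) s' t 0) as [r [Hr [Hr0 Hq]]]; try lra.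
- intros r. eapply continuity_pt_opp, is_derive_continuity_pt, Hf.
- assert (s' < r). { destruct (Req_dec s' r) as [E|]; [rewrite E in Hp|]; lra. }
  destruct (is_derive_pos_local f r (df r) (Hf r)) as [d [Hd Hd']].
  + apply H0; lra.
  + set (h' := Rmin (r - s') (d / 2)).
    assert (0 < h' <= r - s' /\ h' < d) as [? ?] by
      (unfold h', Rmin; destruct Rle_dec; lra).
    assert (- f (r - h') <= 0) by (apply Hq; lra).
    assert (f (r - h') < f r) by (apply Hd'; lra). lra.
Qed.

Lemma growth_unbounded (f df : R -> R) (m s : R) :
  0 < m -> (forall r, s <= r -> is_derive f r (df r)) ->
  (forall r, s <= r -> m <= df r) -> forall M, exists t, s <= t /\ M < f t.
Proof.
intros Hm Hf Hd M.
exists (s + (Rabs (M - f s) + 1) / m).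
assert (0 <= Rabs (M - f s)) by apply Rabs_pos.
assert (H1 := Rle_abs (M - f s)).
assert (0 < (Rabs (M - f s) + 1) / m) by (apply Rdiv_lt_0_compat; lra).
split; [lra|].
assert (H2 := growth_ge f df m s (s + (Rabs (M - f s) + 1) / m)).
assert (f s + m * (s + (Rabs (M - f s) + 1) / m - s)
        <= f (s + (Rabs (M - f s) + 1) / m)).
{ apply H2; [lra| |]; intros r Hr; [apply Hf|apply Hd]; lra. }
replace (m * (s + (Rabs (M - f s) + 1) / m - s)) with (Rabs (M - f s) + 1)
  in H3 by (field; lra). lra.
Qed.

(** * Limits at [+oo] *)

Lemma is_lim_p_R (f : R -> R) (l : R) :
  (forall e, 0 < e -> exists S, forall s, S <= s -> Rabs (f s - l) < e) <->
  is_lim f p_infty l.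
Proof.
split.
- intros H. apply is_lim_spec. intros e. destruct (H e (cond_pos e)) as [S HS].
  exists S. intros s Hs; apply HS; lra.
- intros H e He. apply is_lim_spec in H. destruct (H (mkposreal e He)) as [S HS].
  exists (S + 1). intros s Hs; apply HS; lra.
Qed.

Lemma is_lim_p_p (f : R -> R) :
  (forall M, exists S, forall s, S <= s -> M < f s) <->
  is_lim f p_infty p_infty.
Proof.
split.
- intros H. apply is_lim_spec. intros M. destruct (H M) as [S HS].
  exists S. intros s Hs; apply HS; lra.
- intros H M. apply is_lim_spec in H. destruct (H M) as [S HS].
  exists (S + 1). intros s Hs; apply HS; lra.
Qed.

Lemma nondecreasing_bounded_lim (f : R -> R) (s0 M : R) :
  (forall s t, s0 <= s <= t -> f s <= f t) -> (forall s, s0 <= s -> f s <= M) ->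
  exists l : R, is_lim f p_infty l /\ forall s, s0 <= s -> f s <= l.
Proof.
intros Hi HM.
destruct (completeness (fun v => exists s, s0 <= s /\ v = f s)) as [l [Hub Hlub]].
- exists M. intros v [s [Hs ->]]; auto.
- exists (f s0), s0. split; [lra|easy].
- exists l. split; [|intros s Hs; apply Hub; now exists s].
  apply is_lim_p_R. intros e He.
  destruct (classic (exists s, s0 <= s /\ l - e < f s)) as [[S [HS HS']]|Hn].
  + exists S. intros s Hs. apply Rabs_def1.
    * assert (f s <= l) by (apply Hub; exists s; split; [lra|easy]). lra.
    * assert (f S <= f s) by (apply Hi; lra). lra.
  + exfalso. assert (l <= l - e); [|lra]. apply Hlub. intros v [s [Hs ->]].
    destruct (Rle_or_lt (f s) (l - e)) as [h|h]; [easy|].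
    exfalso; apply Hn; now exists s.
Qed.

(** Over a window of length [d = e / (2 K)] the derivative varies by at most [e / 2], while its mean
    over the window is below [e / 2] as soon as [f] is within [e d / 4] of its limit. *)
Lemma barbalat (f df : R -> R) (L s0 l : R) :
  (forall r, s0 <= r -> is_derive f r (df r)) ->
  (forall r t, s0 <= r <= t -> Rabs (df t - df r) <= L * (t - r)) ->
  is_lim f p_infty l -> is_lim df p_infty 0.
Proof.
intros Hf HL Hl. apply is_lim_p_R. intros e He.
set (K := Rabs L + 1). assert (HK : 0 < K) by (unfold K; assert (H := Rabs_pos L); lra).
set (d := e / (2 * K)). assert (Hd : 0 < d) by (apply Rdiv_lt_0_compat; lra).
destruct (proj2 (is_lim_p_R f l) Hl (e * d / 4)) as [S HS].
{ apply Rdiv_lt_0_compat; nra. }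
exists (Rmax S s0). intros s Hs.
assert (S <= s /\ s0 <= s) as [h1 h2] by
  (split; eapply Rle_trans; [apply Rmax_l|apply Hs|apply Rmax_r|apply Hs]).
destruct (mean_value f df s (s + d)) as [c [Hc E]]; [lra| |].
{ intros r Hr; apply Hf; lra. }
assert (Rabs (df c - df s) <= K * d).
{ eapply Rle_trans; [apply HL; lra|].
  assert (L <= K) by (unfold K; assert (H := Rle_abs L); lra). nra. }
assert (K * d = e / 2) by (unfold d; field; lra).
assert (Rabs (f (s + d) - l) < e * d / 4) by (apply HS; lra).
assert (Rabs (f s - l) < e * d / 4) by (apply HS; lra).
apply Rabs_def2 in H1. apply Rabs_def2 in H2. apply Rabs_le_between in H.
assert (df c * d = f (s + d) - f s) by (rewrite E; ring).
apply Rabs_def1; nra.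
Qed.

(** Meant for the spiralling end: there [y] grows at most linearly, so the curvature and the angular
    speed are only bounded below by a multiple of [1 / s], and the divergence obtained is
    logarithmic. *)
Lemma log_divergence (f df : R -> R) (c d s0 : R) :
  0 < c -> 0 < s0 + d ->
  (forall s, s0 <= s -> is_derive f s (df s)) ->
  (forall s, s0 <= s -> c / (s + d) <= df s) -> is_lim f p_infty p_infty.
Proof.
intros Hc Hd Hf Hdf. apply is_lim_p_p. intros M.
set (M' := (M - f s0 + c * ln (s0 + d)) / c).
exists (Rmax s0 (exp (M' + 1) - d)). intros s Hs.
assert (s0 <= s) by (eapply Rle_trans; [apply Rmax_l|apply Hs]).
assert (exp (M' + 1) - d <= s) by (eapply Rle_trans; [apply Rmax_r|apply Hs]).
assert (M' + 1 <= ln (s + d)).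
{ rewrite <- (ln_exp (M' + 1)). apply ln_le; [apply exp_pos|lra]. }
assert (G := growth_ge (fun s => f s - c * ln (s + d))
   (fun s => df s - c / (s + d)) 0 s0 s H).
simpl in G.
assert (f s0 - c * ln (s0 + d) + 0 * (s - s0) <= f s - c * ln (s + d)).
{ apply G.
  - intros r Hr. assert (Hr' := Hf r (proj1 Hr)).
    apply (is_derive_minus f (fun s => c * ln (s + d))); [exact Hr'|].
    auto_derive; [lra|]. field; lra.
  - intros r Hr. specialize (Hdf r (proj1 Hr)). lra. }
assert (c * M' = M - f s0 + c * ln (s0 + d)) by (unfold M'; field; lra).
nra.
Qed.

(** * The planar system *)

(* [auto_derive] leaves derivatives of eta-expanded functions. *)
Ltac rewrite_derive H :=
  match type of H with
  | is_derive ?f ?s ?l =>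
      replace (Derive (fun u => f u) s) with l
        by (symmetry; exact (is_derive_unique _ _ _ H))
  end.

Definition phase_flow (a b : R) (x y : R -> R) : Prop :=
  forall s, is_derive x s (a + x s * y s) /\ is_derive y s (b - x s ^ 2).

Lemma phase_flow_flip (a b : R) (x y : R -> R) :
  phase_flow a b x y -> phase_flow (- a) b (fun s => - x s) y.
Proof.
intros H s. destruct (H s) as [Hx Hy]. split.
- replace (- a + - x s * y s) with (opp (a + x s * y s))
    by (unfold opp; simpl; ring).
  now apply (is_derive_opp x).
- now replace (b - (- x s) ^ 2) with (b - x s ^ 2) by ring.
Qed.

Lemma is_derive_comp_opp (f : R -> R) (s l : R) :
  is_derive f (- s) l -> is_derive (fun r => f (- r)) s (- l).
Proof.
intros H. replace (- l) with (scal (- 1) l) by (unfold scal; simpl; unfold mult; simpl; ring).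
apply (is_derive_comp f (fun r => - r)); [exact H|].
auto_derive; [easy|ring].
Qed.

Lemma is_derive_comp_shift (f : R -> R) (c s l : R) :
  is_derive f (s + c) l -> is_derive (fun r => f (r + c)) s l.
Proof.
intros H. replace l with (scal 1 l) by (unfold scal; simpl; unfold mult; simpl; ring).
apply (is_derive_comp f (fun r => r + c)); [exact H|].
auto_derive; [easy|ring].
Qed.

Lemma phase_flow_reverse (a b : R) (x y : R -> R) :
  phase_flow a b x y -> phase_flow a b (fun s => - x (- s)) (fun s => - y (- s)).
Proof.
intros H s. destruct (H (- s)) as [Hx Hy]. split.
- replace (a + - x (- s) * - y (- s)) with (opp (- (a + x (- s) * y (- s))))
    by (unfold opp; simpl; ring).
  apply (is_derive_opp (fun r => x (- r))). now apply is_derive_comp_opp.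
- replace (b - (- x (- s)) ^ 2) with (opp (- (b - x (- s) ^ 2)))
    by (unfold opp; simpl; ring).
  apply (is_derive_opp (fun r => y (- r))). now apply is_derive_comp_opp.
Qed.

Lemma phase_flow_shift (a b c : R) (x y : R -> R) :
  phase_flow a b x y -> phase_flow a b (fun s => x (s + c)) (fun s => y (s + c)).
Proof.
intros H s. destruct (H (s + c)) as [Hx Hy].
split; now apply is_derive_comp_shift.
Qed.

(** * Continuous dependence and uniqueness for the planar system *)

Lemma is_derive_RInt_continuous (f : R -> R) (c s : R) :
  (forall r, continuous f r) -> is_derive (fun r => RInt f c r) s (f s).
Proof.
intros H. apply (is_derive_RInt f _ c); [|apply H].
apply filter_forall. intros r.
apply (@RInt_correct R_CompleteNormedModule).
apply (@ex_RInt_continuous R_CompleteNormedModule). intros; apply H.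
Qed.

Lemma is_derive_continuous (f : R -> R) (s l : R) :
  is_derive f s l -> continuous f s.
Proof.
intros H. apply (@ex_derive_continuous R_AbsRing R_NormedModule). now exists l.
Qed.

Lemma continuous_Rabs_comp (f : R -> R) (s : R) :
  continuous f s -> continuous (fun r => Rabs (f r)) s.
Proof.
intros H. apply (@continuous_comp R_UniformSpace R_UniformSpace R_UniformSpace);
  [exact H|apply continuous_Rabs].
Qed.

Definition gronwall_rate (x y : R -> R) (s : R) : R :=
  RInt (fun r => 2 * Rabs (y r) + Rabs (x r)) 0 s.

Lemma gronwall_rate_derive (a b : R) (x y : R -> R) (s : R) :
  phase_flow a b x y ->
  is_derive (gronwall_rate x y) s (2 * Rabs (y s) + Rabs (x s)).
Proof.
intros H. apply (is_derive_RInt_continuous (fun r => 2 * Rabs (y r) + Rabs (x r))).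
intros r. destruct (H r) as [Hx Hy].
apply (@continuous_plus R_UniformSpace R_AbsRing R_NormedModule).
- apply (@continuous_scal_r R_UniformSpace R_AbsRing R_NormedModule).
  eapply continuous_Rabs_comp, is_derive_continuous, Hy.
- eapply continuous_Rabs_comp, is_derive_continuous, Hx.
Qed.

(* The rate only involves the first solution, so this also gives continuous
   dependence on the initial point, uniformly over all second solutions. *)
Lemma phase_flow_dependence (a b : R) (x1 y1 x2 y2 : R -> R) (s : R) :
  phase_flow a b x1 y1 -> phase_flow a b x2 y2 -> 0 <= s ->
  (x1 s - x2 s) ^ 2 + (y1 s - y2 s) ^ 2 <=
  ((x1 0 - x2 0) ^ 2 + (y1 0 - y2 0) ^ 2) * exp (gronwall_rate x1 y1 s).
Proof.
intros H1 H2 Hs.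
set (W := fun r => (x1 r - x2 r) ^ 2 + (y1 r - y2 r) ^ 2).
set (G := gronwall_rate x1 y1).
set (m := fun r => 2 * Rabs (y1 r) + Rabs (x1 r)).
(* For the differences [u = x1 - x2] and [v = y1 - y2] one has [u' = u y1 + v x2] and
   [v' = - u (x1 + x2)]. In [u u' + v v'] the terms [u v x2] cancel, which leaves only the first
   solution. *)
set (dW := fun r => 2 * (x1 r - x2 r) ^ 2 * y1 r
                    - 2 * (x1 r - x2 r) * (y1 r - y2 r) * x1 r).
assert (HG0 : G 0 = 0) by (unfold G, gronwall_rate; now rewrite RInt_point).
assert (HW : forall r, is_derive W r (dW r)).
{ intros r. destruct (H1 r) as [Hx1 Hy1]. destruct (H2 r) as [Hx2 Hy2].
  unfold W, dW. auto_derive.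
  - repeat split; eexists; eassumption.
  - rewrite_derive Hx1. rewrite_derive Hx2. rewrite_derive Hy1. rewrite_derive Hy2. ring. }
assert (H := growth_le (fun r => W r * exp (- G r))
  (fun r => (dW r - m r * W r) * exp (- G r)) 0 0 s Hs).
simpl in H. rewrite HG0, Ropp_0, exp_0 in H.
assert (W s * exp (- G s) <= W 0 * 1 + 0 * (s - 0)).
{ apply H.
  - intros r _. assert (HG := gronwall_rate_derive a b x1 y1 r H1).
    fold G in HG. fold (m r) in HG.
    assert (HWr := HW r). auto_derive.
    + split; [eexists; exact HWr|]. split; [eexists; exact HG|easy].
    + rewrite_derive HWr. rewrite_derive HG. ring.
  - intros r _. assert (He := exp_pos (- G r)).
    assert (dW r <= m r * W r); [|nra].
    unfold dW, m, W. set (u := x1 r - x2 r). set (v := y1 r - y2 r).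
    assert (h1 := Rle_abs (y1 r)). assert (h2 := Rle_abs (x1 r)).
    assert (h3 := Rle_abs (- x1 r)). rewrite Rabs_Ropp in h3.
    assert (h4 := Rabs_pos (y1 r)). assert (h5 := Rabs_pos (x1 r)).
    assert (2 * u ^ 2 * y1 r <= 2 * Rabs (y1 r) * (u ^ 2 + v ^ 2)).
    { assert (q1 := pow2_ge_0 u). assert (q2 := pow2_ge_0 v).
      assert (0 <= (Rabs (y1 r) - y1 r) * u ^ 2) by (apply Rmult_le_pos; lra).
      assert (0 <= Rabs (y1 r) * v ^ 2) by (apply Rmult_le_pos; lra). lra. }
    assert (- 2 * u * v * x1 r <= Rabs (x1 r) * (u ^ 2 + v ^ 2)).
    { assert (q1 := pow2_ge_0 (u + v)). assert (q2 := pow2_ge_0 (u - v)).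
      assert (0 <= (Rabs (x1 r) + x1 r) * (u + v) ^ 2) by
        (apply Rmult_le_pos; lra).
      assert (0 <= (Rabs (x1 r) - x1 r) * (u - v) ^ 2) by
        (apply Rmult_le_pos; lra). lra. }
    lra. }
fold (W s). fold (W 0). fold G.
replace (W s) with (W s * exp (- G s) * exp (G s)).
- assert (He := exp_pos (G s)). nra.
- rewrite Rmult_assoc, <- exp_plus. replace (- G s + G s) with 0 by ring.
  rewrite exp_0; ring.
Qed.

(** Forward uniqueness from time 0 is [phase_flow_dependence] with initial distance 0; a shift moves
    [s0] to 0, and reversal covers the times before [s0]. *)
Lemma phase_flow_unique (a b s0 : R) (x1 y1 x2 y2 : R -> R) :
  phase_flow a b x1 y1 -> phase_flow a b x2 y2 ->
  x1 s0 = x2 s0 -> y1 s0 = y2 s0 -> forall s, x1 s = x2 s /\ y1 s = y2 s.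
Proof.
assert (U : forall x1 y1 x2 y2 s, phase_flow a b x1 y1 -> phase_flow a b x2 y2 ->
  x1 0 = x2 0 -> y1 0 = y2 0 -> 0 <= s -> x1 s = x2 s /\ y1 s = y2 s).
{ clear. intros x1 y1 x2 y2 s H1 H2 Ex Ey Hs.
  assert (H := phase_flow_dependence a b x1 y1 x2 y2 s H1 H2 Hs).
  rewrite Ex, Ey, !Rminus_diag, !pow_i, Rplus_0_r, Rmult_0_l in H by lia.
  assert (q1 := pow2_ge_0 (x1 s - x2 s)). assert (q2 := pow2_ge_0 (y1 s - y2 s)).
  split; apply Rminus_diag_uniq, Rsqr_0_uniq; unfold Rsqr; lra. }
intros H1 H2 Ex Ey s.
destruct (Rle_or_lt s0 s) as [h|h].
- destruct (U (fun r => x1 (r + s0)) (fun r => y1 (r + s0))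
    (fun r => x2 (r + s0)) (fun r => y2 (r + s0)) (s - s0)).
  + now apply phase_flow_shift.
  + now apply phase_flow_shift.
  + now rewrite Rplus_0_l.
  + now rewrite Rplus_0_l.
  + lra.
  + now replace (s - s0 + s0) with s in * by ring.
- destruct (U (fun r => - x1 (- r + s0)) (fun r => - y1 (- r + s0))
    (fun r => - x2 (- r + s0)) (fun r => - y2 (- r + s0)) (s0 - s)).
  + apply (phase_flow_reverse a b (fun r => x1 (r + s0)) (fun r => y1 (r + s0))).
    now apply phase_flow_shift.
  + apply (phase_flow_reverse a b (fun r => x2 (r + s0)) (fun r => y2 (r + s0))).
    now apply phase_flow_shift.
  + now rewrite Ropp_0, Rplus_0_l, Ex.
  + now rewrite Ropp_0, Rplus_0_l, Ey.
  + lra.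
  + replace (- (s0 - s) + s0) with s in * by ring. split; lra.
Qed.

Lemma phase_flow_pos_after (a b s0 : R) (x y : R -> R) :
  0 < a -> phase_flow a b x y -> 0 <= x s0 -> forall s, s0 < s -> 0 < x s.
Proof.
intros Ha H H0 s Hs.
apply (barrier x (fun r => a + x r * y r) s0); try easy.
- intros r; apply H.
- intros r _ Hr. rewrite Hr. lra.
Qed.

(** * Energy *)

(* [damping] is [x' / x = u'] for [u = ln x], and [energy] is
   [u'^2 / 2 + exp (2 u) / 2 - b u]. *)
Definition damping (a : R) (x y : R -> R) (s : R) : R := y s + a / x s.

Definition energy (a b : R) (x y : R -> R) (s : R) : R :=
  damping a x y s ^ 2 / 2 + x s ^ 2 / 2 - b * ln (x s).

Lemma x_derive (a b : R) (x y : R -> R) (s : R) :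
  phase_flow a b x y -> 0 < x s ->
  is_derive x s (x s * damping a x y s).
Proof.
intros flow Hx. replace (x s * damping a x y s) with (a + x s * y s)
  by (unfold damping; field; lra). apply flow.
Qed.

Lemma damping_derive (a b : R) (x y : R -> R) (s : R) :
  phase_flow a b x y -> 0 < x s ->
  is_derive (damping a x y) s (- a * damping a x y s / x s + b - x s ^ 2).
Proof.
intros flow Hx. destruct (flow s) as [_ Hy].
assert (H := x_derive a b x y s flow Hx).
unfold damping at 1. auto_derive.
- split; [eexists; exact Hy|]. split; [eexists; exact H|]. split; [lra|easy].
- rewrite_derive Hy. rewrite_derive H. field; lra.
Qed.

Lemma energy_derive (a b : R) (x y : R -> R) (s : R) :
  phase_flow a b x y -> 0 < x s ->
  is_derive (energy a b x y) s (- (a * damping a x y s ^ 2 / x s)).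
Proof.
intros flow Hx. assert (Hp := damping_derive a b x y s flow Hx).
assert (H := x_derive a b x y s flow Hx).
unfold energy. auto_derive.
- split; [eexists; exact Hp|]. split; [eexists; exact H|].
  split; [eexists; exact H|]. split; [lra|easy].
- rewrite_derive Hp. rewrite_derive H. field; lra.
Qed.

Lemma ln_lt_sub_1 (u : R) : 0 < u -> u <> 1 -> ln u < u - 1.
Proof.
intros Hu H1. rewrite <- (ln_exp (u - 1)). apply ln_increasing; [easy|].
assert (1 + (u - 1) < exp (u - 1)) by (apply exp_ineq1; lra). lra.
Qed.

Lemma ln_le_sub_1 (u : R) : 0 < u -> ln u <= u - 1.
Proof.
intros Hu. destruct (Req_dec u 1) as [->|H]; [rewrite ln_1; lra|].
left; now apply ln_lt_sub_1.
Qed.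

(** The potential [x^2 / 2 - b ln x] is smallest at [x = sqrt b]: this is [ln t <= t - 1] at
    [t = x^2 / b], multiplied by [b / 2]. *)
Lemma energy_min (a b : R) (x y : R -> R) (s : R) :
  0 < b -> 0 < x s -> b / 2 - b * ln (sqrt b) <= energy a b x y s.
Proof.
intros Hb Hx. unfold energy.
assert (Hc : 0 < sqrt b) by now apply sqrt_lt_R0.
assert (Hcc : sqrt b * sqrt b = b) by (apply sqrt_sqrt; lra).
assert (H := ln_le_sub_1 (x s ^ 2 / b)).
rewrite ln_div in H by nra.
replace (x s ^ 2) with (x s * x s) in * by ring. rewrite ln_mult in H by easy.
assert (Eb : ln b = 2 * ln (sqrt b)).
{ rewrite <- Hcc at 1. rewrite ln_mult by easy. ring. }
rewrite Eb in H.
assert (0 < x s * x s / b) by (apply Rdiv_lt_0_compat; nra).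
specialize (H H0). assert (x s * x s / b * b = x s * x s) by (field; lra).
assert (0 <= damping a x y s ^ 2) by nra. nra.
Qed.

Lemma energy_min_strict (a b : R) (x y : R -> R) (s : R) :
  0 < b -> 0 < x s -> x s ^ 2 <> b ->
  b / 2 - b * ln (sqrt b) < energy a b x y s.
Proof.
intros Hb Hx Hn. unfold energy.
assert (Hc : 0 < sqrt b) by now apply sqrt_lt_R0.
assert (Hcc : sqrt b * sqrt b = b) by (apply sqrt_sqrt; lra).
assert (H := ln_lt_sub_1 (x s ^ 2 / b)).
rewrite ln_div in H by nra.
assert (x s ^ 2 / b * b = x s ^ 2) by (field; lra).
replace (x s ^ 2) with (x s * x s) in * by ring. rewrite ln_mult in H by easy.
assert (Eb : ln b = 2 * ln (sqrt b)).
{ rewrite <- Hcc at 1. rewrite ln_mult by easy. ring. }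
rewrite Eb in H.
assert (0 < x s * x s / b) by (apply Rdiv_lt_0_compat; nra).
assert (x s * x s / b <> 1) by (intros E; rewrite E in H0; lra).
specialize (H H1 H2).
assert (0 <= damping a x y s ^ 2) by nra. nra.
Qed.

(** * Convergence to the equilibrium *)

Definition bounded_after (s0 : R) (f : R -> R) : Prop :=
  exists L, forall s, s0 <= s -> Rabs (f s) <= L.

Lemma bounded_after_const (s0 c : R) : bounded_after s0 (fun _ => c).
Proof. exists (Rabs c). intros; apply Rle_refl. Qed.

Lemma bounded_after_plus (s0 : R) (f g : R -> R) :
  bounded_after s0 f -> bounded_after s0 g -> bounded_after s0 (fun s => f s + g s).
Proof.
intros [L HL] [M HM]. exists (L + M). intros s Hs.
eapply Rle_trans; [apply Rabs_triang|]. specialize (HL s Hs). specialize (HM s Hs). lra.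
Qed.

Lemma bounded_after_mult (s0 : R) (f g : R -> R) :
  bounded_after s0 f -> bounded_after s0 g -> bounded_after s0 (fun s => f s * g s).
Proof.
intros [L HL] [M HM]. exists (L * M). intros s Hs. rewrite Rabs_mult.
apply Rmult_le_compat; auto using Rabs_pos.
Qed.

Lemma bounded_after_opp (s0 : R) (f : R -> R) :
  bounded_after s0 f -> bounded_after s0 (fun s => - f s).
Proof. intros [L HL]. exists L. intros s Hs. rewrite Rabs_Ropp. auto. Qed.

(** Bounds for the second derivatives fed to [barbalat_bounded] follow from their syntax: they are
    polynomials in [x], [/ x] and [damping], each bounded by [energy_bounds]. *)
Ltac bounded :=
  unfold Rdiv, Rminus; simpl pow;
  repeat first [ assumption | apply bounded_after_const
    | apply bounded_after_plus | apply bounded_after_mult | apply bounded_after_opp ].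

Lemma is_lim_zero_mult (s0 : R) (f g : R -> R) :
  is_lim f p_infty 0 -> bounded_after s0 g -> is_lim (fun s => f s * g s) p_infty 0.
Proof.
intros Hf [L HL]. apply is_lim_p_R. intros e He.
assert (HL0 : 0 < Rabs L + 1) by (assert (h := Rabs_pos L); lra).
destruct (proj2 (is_lim_p_R f 0) Hf (e / (Rabs L + 1))) as [S HS].
{ apply Rdiv_lt_0_compat; lra. }
exists (Rmax S s0). intros s Hs.
assert (h1 : S <= s) by (eapply Rle_trans; [apply Rmax_l|apply Hs]).
assert (h2 : s0 <= s) by (eapply Rle_trans; [apply Rmax_r|apply Hs]).
specialize (HS s h1). specialize (HL s h2). rewrite Rminus_0_r in *.
rewrite Rabs_mult. assert (h3 := Rle_abs L). assert (h4 := Rabs_pos (f s)).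
assert (h5 := Rabs_pos (g s)).
apply Rle_lt_trans with (Rabs (f s) * (Rabs L + 1)).
- apply Rmult_le_compat_l; lra.
- apply Rlt_le_trans with (e / (Rabs L + 1) * (Rabs L + 1)).
  + apply Rmult_lt_compat_r; lra.
  + right; field; lra.
Qed.

Lemma barbalat_bounded (f df ddf : R -> R) (s0 l : R) :
  (forall s, s0 <= s -> is_derive f s (df s)) ->
  (forall s, s0 <= s -> is_derive df s (ddf s)) ->
  bounded_after s0 ddf -> is_lim f p_infty l -> is_lim df p_infty 0.
Proof.
intros Hf Hdf [L HL] Hl. apply (barbalat f df L s0 l Hf); [|exact Hl].
intros r t Hrt. destruct (mean_value df ddf r t) as [c [Hc E]]; [lra| |].
- intros u Hu; apply Hdf; lra.
- rewrite E, Rabs_mult, (Rabs_pos_eq (t - r)) by lra.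
  apply Rmult_le_compat_r; [lra|]. apply HL; lra.
Qed.

(** Sublevel sets of the energy are compact in the half plane [x > 0]: [x^2 / 2] beats [b ln x] for
    large [x], [- b ln x] keeps [x] away from 0, and what remains bounds the square of [damping]. *)
Lemma energy_bounds (a b M s0 : R) (x y : R -> R) :
  0 < b -> (forall s, s0 <= s -> 0 < x s) ->
  (forall s, s0 <= s -> energy a b x y s <= M) ->
  bounded_after s0 x /\ bounded_after s0 (fun s => / x s) /\
  bounded_after s0 (damping a x y).
Proof.
intros Hb Hx HM.
assert (HK : forall s, s0 <= s -> x s <= 2 * b + 2 * Rabs M + 1).
{ intros s Hs. specialize (Hx s Hs). specialize (HM s Hs). unfold energy in HM.
  assert (H := ln_le_sub_1 (x s) Hx). assert (H1 := pow2_ge_0 (damping a x y s)).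
  assert (H2 := Rle_abs M). assert (H3 := Rabs_pos M).
  destruct (Rle_or_lt (x s) (2 * b + 2 * Rabs M + 1)) as [h|h]; [easy|exfalso].
  assert (b * ln (x s) <= b * (x s - 1)) by (apply Rmult_le_compat_l; lra).
  nra. }
split; [|split].
- exists (2 * b + 2 * Rabs M + 1). intros s Hs.
  rewrite Rabs_pos_eq; [auto|left; auto].
- exists (exp (M / b)). intros s Hs. assert (Hxs := Hx s Hs).
  rewrite Rabs_pos_eq by (left; now apply Rinv_0_lt_compat).
  rewrite <- (exp_ln (/ x s)) by now apply Rinv_0_lt_compat.
  rewrite ln_Rinv by easy.
  assert (- ln (x s) <= M / b).
  { apply Rmult_le_reg_l with b; [easy|]. replace (b * (M / b)) with M by (field; lra).
    specialize (HM s Hs). unfold energy in HM.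
    assert (H1 := pow2_ge_0 (damping a x y s)). assert (H2 := pow2_ge_0 (x s)). lra. }
  destruct H as [H|H]; [left; now apply exp_increasing|right; now rewrite H].
- set (K := 2 * b + 2 * Rabs M + 1) in *.
  exists (2 * Rabs M + 2 * b * K + 1). intros s Hs.
  assert (Hxs := Hx s Hs). specialize (HM s Hs). unfold energy in HM.
  specialize (HK s Hs). assert (H := ln_le_sub_1 (x s) Hxs).
  assert (H2 := Rle_abs M). assert (H3 := pow2_ge_0 (x s)).
  assert (b * ln (x s) <= b * K) by (apply Rmult_le_compat_l; lra).
  assert (Rabs (damping a x y s) ^ 2 <= 2 * Rabs M + 2 * b * K).
  { rewrite pow2_abs. lra. }
  assert (H4 := Rabs_pos (damping a x y s)). nra.
Qed.

(** The sign of [a] is left free: [a > 0] gives the wrapping ends, and [a < 0] serves to exclude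
    bounded energy for escaping orbits. In both cases the energy is monotone and bounded, hence
    converges. Barbalat's lemma applied to the energy gives [damping -> 0]; applied to [damping], it
    gives [b - x^2 -> 0]. *)
Lemma energy_convergence (a b M s0 : R) (x y : R -> R) :
  a <> 0 -> 0 < b -> phase_flow a b x y -> (forall s, s0 <= s -> 0 < x s) ->
  (forall s, s0 <= s -> energy a b x y s <= M) ->
  is_lim x p_infty (sqrt b) /\ is_lim (damping a x y) p_infty 0.
Proof.
intros Ha Hb Hf Hx HM. set (p := damping a x y).
destruct (energy_bounds a b M s0 x y Hb Hx HM) as [Bx [Bi Bp]]. fold p in Bp.
assert (Hdx : forall s, s0 <= s -> is_derive x s (x s * p s)).
{ intros s Hs. apply (x_derive a b x y); auto. }
assert (Hdp : forall s, s0 <= s -> is_derive p s (- a * p s / x s + b - x s ^ 2)).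
{ intros s Hs. apply (damping_derive a b x y); auto. }
assert (HE : forall s, s0 <= s ->
  is_derive (energy a b x y) s (- (a * p s ^ 2 / x s))).
{ intros s Hs. apply energy_derive; auto. }
assert (exists l : R, is_lim (energy a b x y) p_infty l) as [l Hl].
{ assert (Hq : forall s, s0 <= s -> 0 <= p s ^ 2 / x s).
  { intros s Hs. apply Rmult_le_pos; [apply pow2_ge_0|].
    left; now apply Rinv_0_lt_compat, Hx. }
  destruct (Rlt_or_le 0 a) as [h|h].
  - destruct (nondecreasing_bounded_lim (fun s => - energy a b x y s) s0
      (- (b / 2 - b * ln (sqrt b)))) as [l [Hl _]].
    + intros s t Hst.
      assert (G := growth_le (energy a b x y) (fun s => - (a * p s ^ 2 / x s)) 0 s t).
      assert (energy a b x y t <= energy a b x y s + 0 * (t - s)); [|lra].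
      apply G; [lra| |]; intros r Hr; [apply HE; lra|].
      assert (0 <= p r ^ 2 / x r) by (apply Hq; lra). unfold Rdiv in *. nra.
    + intros s Hs. assert (H := energy_min a b x y s Hb (Hx s Hs)). lra.
    + exists (- l). apply is_lim_ext with (fun s => - - energy a b x y s).
      * intros; ring.
      * now apply is_lim_opp with (l := Finite l).
  - destruct (nondecreasing_bounded_lim (energy a b x y) s0 M) as [l [Hl _]].
    + intros s t Hst.
      assert (G := growth_ge (energy a b x y) (fun s => - (a * p s ^ 2 / x s)) 0 s t).
      assert (energy a b x y s + 0 * (t - s) <= energy a b x y t); [|lra].
      apply G; [lra| |]; intros r Hr; [apply HE; lra|].
      assert (0 <= p r ^ 2 / x r) by (apply Hq; lra). unfold Rdiv in *. nra.
    + easy.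
    + now exists l. }
set (q := fun s => - (a * p s ^ 2 / x s)) in *.
set (dq := fun s => - a * (2 * p s * (- a * p s / x s + b - x s ^ 2) - p s ^ 3) / x s).
assert (Hq0 : is_lim q p_infty 0).
{ apply (barbalat_bounded (energy a b x y) q dq s0 l); [easy| | |easy].
  - intros s Hs. assert (h1 := Hdx s Hs). assert (h2 := Hdp s Hs).
    assert (h3 := Hx s Hs). unfold q, dq. auto_derive.
    + split; [eexists; exact h2|]. split; [eexists; exact h1|]. split; [lra|easy].
    + rewrite_derive h1. rewrite_derive h2. field; lra.
  - unfold dq. bounded. }
set (dp := fun s => - a * p s / x s + b - x s ^ 2).
assert (Hp0 : is_lim p p_infty 0).
{ assert (Hp2 : is_lim (fun s => q s * (- / a * x s)) p_infty 0)
    by (apply (is_lim_zero_mult s0); [easy|bounded]).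
  apply is_lim_p_R. intros e He.
  destruct (proj2 (is_lim_p_R _ _) Hp2 (e ^ 2)) as [S HS]; [nra|].
  exists (Rmax S s0). intros s Hs.
  assert (h1 : S <= s) by (eapply Rle_trans; [apply Rmax_l|apply Hs]).
  assert (h2 : s0 <= s) by (eapply Rle_trans; [apply Rmax_r|apply Hs]).
  specialize (HS s h1). specialize (Hx s h2).
  replace (q s * (- / a * x s)) with (p s ^ 2) in HS by (unfold q; field; lra).
  rewrite Rminus_0_r in *. rewrite Rabs_pos_eq in HS by apply pow2_ge_0.
  rewrite <- pow2_abs in HS. assert (h4 := Rabs_pos (p s)). nra. }
assert (Hdp0 : is_lim dp p_infty 0).
{ apply (barbalat_bounded p dp
    (fun s => - a * (dp s - p s ^ 2) / x s - 2 * x s ^ 2 * p s) s0 0); [easy| | |easy].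
  - intros s Hs. assert (h1 := Hdx s Hs). assert (h2 := Hdp s Hs).
    assert (h3 := Hx s Hs). unfold dp. auto_derive.
    + split; [eexists; exact h2|]. split; [eexists; exact h1|]. split; [lra|].
      split; [eexists; exact h1|easy].
    + rewrite_derive h1. rewrite_derive h2. field; lra.
  - unfold dp. bounded. }
split; [|easy].
assert (Hx2 : is_lim (fun s => x s ^ 2) p_infty b).
{ apply is_lim_ext with (fun s => b + (p s * (- a * / x s) + - dp s)).
  { intros s. unfold dp, Rdiv. ring. }
  assert (h1 : is_lim (fun s => p s * (- a * / x s)) p_infty 0)
    by (apply (is_lim_zero_mult s0); [easy|bounded]).
  assert (h2 : is_lim (fun s => - dp s) p_infty (Finite (- 0)))
    by now apply is_lim_opp with (l := Finite 0).
  assert (h3 := is_lim_plus' _ _ _ _ _ h1 h2).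
  assert (h4 := is_lim_plus' _ _ _ _ _ (is_lim_const b p_infty) h3).
  simpl in h4. now replace (b + (0 + - 0)) with b in h4 by ring. }
apply is_lim_ext_loc with (fun s => sqrt (x s ^ 2)).
- exists s0. intros s Hs. rewrite <- Rsqr_pow2. apply sqrt_Rsqr. left; apply Hx; lra.
- apply (is_lim_comp_continuous (fun s => x s ^ 2) sqrt); [easy|apply continuous_sqrt].
Qed.

Lemma phase_flow_forward (a b s0 : R) (x y : R -> R) :
  0 < a -> 0 < b -> phase_flow a b x y -> (forall s, s0 <= s -> 0 < x s) ->
  is_lim x p_infty (sqrt b) /\ is_lim y p_infty (- a / sqrt b).
Proof.
intros Ha Hb Hf Hx.
destruct (energy_convergence a b (energy a b x y s0) s0 x y) as [H1 H2]; try easy.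
- lra.
- intros s Hs.
  assert (G := growth_le (energy a b x y)
    (fun s => - (a * damping a x y s ^ 2 / x s)) 0 s0 s Hs).
  assert (energy a b x y s <= energy a b x y s0 + 0 * (s - s0)); [|lra].
  apply G; intros r Hr; [apply energy_derive; [easy|apply Hx; lra]|].
  assert (0 <= damping a x y r ^ 2 / x r).
  { apply Rmult_le_pos; [apply pow2_ge_0|]. left; apply Rinv_0_lt_compat, Hx; lra. }
  unfold Rdiv in *. nra.
- split; [easy|].
  assert (Hc : 0 < sqrt b) by now apply sqrt_lt_R0.
  apply is_lim_ext with (fun s => damping a x y s + - a * / x s).
  { intros s. unfold damping, Rdiv. ring. }
  replace (Finite (- a / sqrt b)) with (Finite (0 + - a * / sqrt b))
    by (f_equal; unfold Rdiv; ring).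
  apply is_lim_plus'; [easy|].
  apply (is_lim_scal_l (fun s => / x s) (- a) p_infty (Finite (/ sqrt b))).
  apply (is_lim_inv x p_infty (sqrt b)); [easy|].
  intros E. injection E. lra.
Qed.

(** * Escaping orbits *)

(* A bounded energy would force convergence to the equilibrium, where the
   energy is minimal, although the energy is nondecreasing when [a < 0]. *)
Lemma energy_unbounded (a b s1 : R) (x y : R -> R) :
  a < 0 -> 0 < b -> phase_flow a b x y -> (forall s, 0 < x s) -> x s1 ^ 2 <> b ->
  forall M, exists S, forall s, S <= s -> M < energy a b x y s.
Proof.
intros Ha Hb Hf Hx H1 M. set (E := energy a b x y).
assert (Hmon : forall s t, s <= t -> E s <= E t).
{ intros s t Hst.
  assert (G := growth_ge E (fun s => - (a * damping a x y s ^ 2 / x s)) 0 s t Hst).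
  assert (E s + 0 * (t - s) <= E t); [|lra].
  apply G; intros r Hr; [apply energy_derive; auto|].
  assert (0 <= damping a x y r ^ 2 / x r).
  { apply Rmult_le_pos; [apply pow2_ge_0|]. left; apply Rinv_0_lt_compat, Hx. }
  unfold Rdiv in *. nra. }
destruct (classic (exists S, M < E S)) as [[S HS]|Hn].
{ exists S. intros s Hs. specialize (Hmon S s Hs). lra. }
exfalso.
assert (HM : forall s, s1 <= s -> E s <= M).
{ intros s _. destruct (Rle_or_lt (E s) M) as [h|h]; [easy|]. now destruct Hn; exists s. }
destruct (energy_convergence a b M s1 x y) as [Hlx Hlp]; try easy; [lra|].
assert (Hc : 0 < sqrt b) by now apply sqrt_lt_R0.
assert (HlE : is_lim E p_infty (b / 2 - b * ln (sqrt b))).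
{ assert (h1 : is_lim (fun s => ln (x s)) p_infty (ln (sqrt b))).
  { apply (is_lim_comp_continuous x ln); [easy|]. now apply continuous_ln. }
  assert (h2 : is_lim (fun s => x s * x s) p_infty (sqrt b * sqrt b))
    by (apply (is_lim_mult x x p_infty (sqrt b) (sqrt b)); easy).
  rewrite sqrt_sqrt in h2 by lra.
  assert (h3 : is_lim (fun s => damping a x y s * damping a x y s) p_infty (0 * 0))
    by (apply (is_lim_mult (damping a x y) (damping a x y) p_infty 0 0); easy).
  apply is_lim_ext with (fun s => (/ 2 * (damping a x y s * damping a x y s)
    + / 2 * (x s * x s)) + - b * ln (x s)).
  { intros s. unfold E, energy. field. }
  replace (b / 2 - b * ln (sqrt b)) with
    (/ 2 * (0 * 0) + / 2 * b + - b * ln (sqrt b)) by field.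
  repeat apply is_lim_plus'.
  - now apply (is_lim_scal_l (fun s => damping a x y s * damping a x y s) (/ 2) p_infty (Finite (0 * 0))).
  - now apply (is_lim_scal_l (fun s => x s * x s) (/ 2) p_infty (Finite b)).
  - now apply (is_lim_scal_l (fun s => ln (x s)) (- b) p_infty (Finite (ln (sqrt b)))). }
assert (h := energy_min_strict a b x y s1 Hb (Hx s1) H1). fold E in h.
destruct (proj2 (is_lim_p_R _ _) HlE (E s1 - (b / 2 - b * ln (sqrt b)))) as [S HS]; [lra|].
assert (h1 := HS (Rmax S s1) (Rmax_l _ _)).
assert (h2 := Hmon s1 (Rmax S s1) (Rmax_r _ _)).
apply Rabs_def2 in h1. lra.
Qed.

(* At large energy an orbit that never leaves [0 < w] cannot wind around the
   equilibrium: where [y <= 0] one has [w' <= - al], so passing [w = sqrt b]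
   there with large energy, that is with [y] very negative, would lead to [w = 0]. *)
Lemma escape_eventually_below (al b s1 : R) (w y : R -> R) :
  0 < al -> 0 < b -> phase_flow (- al) b w y -> (forall s, 0 < w s) ->
  w s1 ^ 2 <> b ->
  exists S, forall s, S <= s -> 0 < y s /\ w s < sqrt b.
Proof.
intros Hal Hb Hf Hw H1.
set (E := energy (- al) b w y). set (c := sqrt b).
assert (Hc : 0 < c) by now apply sqrt_lt_R0.
assert (Hcc : c * c = b) by (apply sqrt_sqrt; lra).
assert (HE : forall M, exists S, forall s, S <= s -> M < E s).
{ apply (energy_unbounded (- al) b s1 w y); auto; lra. }
assert (Hdw : forall r, is_derive w r (- al + w r * y r)) by (intros r; apply Hf).
assert (Hdy : forall r, is_derive y r (b - w r ^ 2)) by (intros r; apply Hf).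
(* Falling from [c] to 0 at speed [al] takes time [c / al], during which [y] rises by at most
   [b c / al = Y1]. Starting below [- Y1], [y] thus stays nonpositive until [w] reaches 0. *)
set (Y1 := b * c / al).
assert (HY1 : 0 < Y1) by (apply Rdiv_lt_0_compat; nra).
assert (HY1' : Y1 * al = b * c) by (unfold Y1; field; lra).
assert (Hcross : forall s, w s = c -> - Y1 <= y s).
{ intros s Hs. destruct (Rle_or_lt (- Y1) (y s)) as [h|h]; [easy|exfalso].
  assert (Ht : 0 < c / al) by now apply Rdiv_lt_0_compat.
  assert (Ht' : c / al * al = c) by (field; lra).
  assert (Hy : forall r, s <= r <= s + c / al -> y r <= 0).
  { intros r Hr. assert (G := growth_le y (fun r => b - w r ^ 2) b s r (proj1 Hr)).
    assert (y r <= y s + b * (r - s)).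
    { apply G; intros q _; [easy|]. assert (h1 := pow2_ge_0 (w q)). lra. }
    assert (b * (r - s) <= b * (c / al)) by (apply Rmult_le_compat_l; lra).
    assert (b * (c / al) = Y1) by (unfold Y1; field; lra). lra. }
  assert (G := growth_le w (fun r => - al + w r * y r) (- al) s (s + c / al)).
  assert (w (s + c / al) <= w s + - al * (s + c / al - s)).
  { apply G; [lra|easy|]. intros r Hr. specialize (Hy r Hr). specialize (Hw r). nra. }
  specialize (Hw (s + c / al)). nra. }
assert (HEc : forall s, w s = c -> E s = (y s - al / c) ^ 2 / 2 + b / 2 - b * ln c).
{ intros s Hs. unfold E, energy, damping. rewrite Hs.
  replace (c ^ 2) with b by (rewrite <- Hcc; ring). unfold Rdiv. ring. }
assert (Hac : 0 < al / c) by now apply Rdiv_lt_0_compat.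
(* On the line [w = c] the energy depends only on [|y - al / c|], and this threshold is its value at
   [y = - Y1]. Beyond it, [Hcross] leaves only the reflected branch [y > Y1 + 2 al / c], where
   [w' > al]: the line is crossed upwards only. *)
destruct (HE ((Y1 + al / c) ^ 2 / 2 + b / 2 - b * ln c)) as [S1 HS1].
assert (Hcross1 : forall s, S1 <= s -> w s = c -> al / c + al / c < y s).
{ intros s Hs Hsc. specialize (HS1 s Hs). rewrite HEc in HS1 by easy.
  assert (h := Hcross s Hsc).
  assert ((Y1 + al / c) ^ 2 < (y s - al / c) ^ 2) by lra.
  destruct (Rle_or_lt (y s) (al / c + Y1 + al / c)) as [h'|h']; [nra|lra]. }
(* From a point with [w >= c] and [y <= 0], [y] does not increase while [w >= c], and [w] falls at
   speed at least [al]. The orbit would come down to [w = c] with [y <= 0], against [Hcross1], or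
   never cross it and yet reach 0. *)
assert (Hlow : forall s, S1 <= s -> y s <= 0 -> w s < c).
{ intros s Hs Hys. destruct (Rlt_or_le (w s) c) as [h|h]; [easy|exfalso].
  destruct (classic (exists t, s <= t /\ w t <= c)) as [[t [Hst Ht]]|Hn].
  - destruct (first_hit (fun r => - w r) s t (- c)) as [r [Hr [Er Hq]]]; try lra.
    + intros r. eapply continuity_pt_opp, is_derive_continuity_pt, Hdw.
    + assert (y r <= y s + 0 * (r - s)).
      { apply (growth_le y (fun r => b - w r ^ 2)); [lra|easy|].
        intros q Hq'. assert (- w q <= - c) by (apply Hq; lra). nra. }
      assert (al / c + al / c < y r) by (apply Hcross1; lra). lra.
  - assert (Hgt : forall t, s <= t -> c < w t).
    { intros t Ht. destruct (Rlt_or_le c (w t)) as [h'|h']; [easy|].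
      now destruct Hn; exists t. }
    destruct (growth_unbounded (fun r => - w r) (fun r => - (- al + w r * y r)) al s)
      with (M := 0) as [t [Ht Ht']]; try lra.
    + intros r _. now apply (is_derive_opp w).
    + intros r Hr.
      assert (y r <= y s + 0 * (r - s)).
      { apply (growth_le y (fun r => b - w r ^ 2)); [lra|easy|].
        intros q Hq'. assert (c < w q) by (apply Hgt; lra). nra. }
      specialize (Hw r). nra.
    + specialize (Hw t). lra. }
assert (exists S2, S1 <= S2 /\ 0 < y S2) as [S2 [HS2 Hy2]].
{ destruct (classic (exists S2, S1 <= S2 /\ 0 < y S2)) as [h|Hn]; [easy|exfalso].
  destruct (growth_unbounded (fun r => - w r) (fun r => - (- al + w r * y r)) al S1)
    with (M := 0) as [t [Ht Ht']]; try lra.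
  - intros r _. now apply (is_derive_opp w).
  - intros r Hr. assert (y r <= 0).
    { destruct (Rle_or_lt (y r) 0) as [h|h]; [easy|]. destruct Hn; now exists r. }
    specialize (Hw r). nra.
  - specialize (Hw t). lra. }
assert (Hypos : forall s, S2 <= s -> 0 < y s).
{ intros s Hs. destruct (Req_dec s S2) as [->|]; [easy|].
  apply (barrier y (fun r => b - w r ^ 2) S2); [easy|lra| |lra].
  intros r Hr Hr0. assert (w r < c) by (apply Hlow; lra). specialize (Hw r). nra. }
exists S2. intros s Hs. split; [auto|]. fold c.
destruct (Rlt_or_le (w s) c) as [h|h]; [easy|exfalso].
assert (Hup : forall t, s < t -> 0 < w t - c).
{ apply (barrier (fun r => w r - c) (fun r => - al + w r * y r)).
  - intros r. replace (- al + w r * y r) with (minus (- al + w r * y r) 0)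
      by (unfold minus, plus, opp; simpl; ring).
    apply (is_derive_minus w (fun _ => c)); [easy|]. apply (is_derive_const (V := R_NormedModule)).
  - lra.
  - intros r Hr Hr0. assert (Erc : w r = c) by lra. rewrite Erc.
    assert (al / c + al / c < y r) by (apply Hcross1; lra).
    assert (al / c * c = al) by (field; lra). nra. }
assert (Hyb : forall t, s <= t -> y t <= y s).
{ intros t Ht. assert (y t <= y s + 0 * (t - s)); [|lra].
  apply (growth_le y (fun r => b - w r ^ 2)); [lra|easy|].
  intros r Hr. destruct (Req_dec r s) as [->|]; [nra|].
  assert (0 < w r - c) by (apply Hup; lra). nra. }
(* This bounds the energy on [w > c], [0 < y <= y s], [w^2 < b + 1]. Once the energy is larger,
   [w^2 >= b + 1], so [y' <= - 1] and [y] cannot stay positive. *)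
destruct (HE ((y s + al / c) ^ 2 / 2 + (b + 1) / 2 - b * ln c)) as [S3 HS3].
set (T := Rmax S3 (s + 1)).
assert (HT : S3 <= T /\ s + 1 <= T) by (split; [apply Rmax_l|apply Rmax_r]).
destruct (growth_unbounded (fun r => - y r) (fun r => - (b - w r ^ 2)) 1 T)
  with (M := 0) as [t [Ht Ht']]; try lra.
- intros r _. now apply (is_derive_opp y).
- intros r Hr. destruct (Rle_or_lt (b + 1) (w r ^ 2)) as [h1|h1]; [lra|exfalso].
  assert (h2 : 0 < w r - c) by (apply Hup; lra).
  assert (h3 : y r <= y s) by (apply Hyb; lra).
  assert (h4 : 0 < y r) by (apply Hypos; lra).
  assert (h5 : ln c <= ln (w r)) by (apply ln_le; lra).
  assert (h6 : E r <= (y s + al / c) ^ 2 / 2 + (b + 1) / 2 - b * ln c).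
  { unfold E, energy, damping.
    assert (0 < - - al / w r <= al / c).
    { rewrite Ropp_involutive. split; [apply Rdiv_lt_0_compat; lra|].
      apply Rmult_le_compat_l; [lra|]. apply Rinv_le_contravar; lra. }
    replace (- al / w r) with (- (- - al / w r)) by (unfold Rdiv; ring).
    assert ((y r + - (- - al / w r)) ^ 2 <= (y s + al / c) ^ 2).
    { rewrite <- !Rsqr_pow2. apply Rsqr_le_abs_1. rewrite (Rabs_pos_eq (y s + al / c)) by lra.
      apply Rabs_le; lra. }
    assert (b * ln c <= b * ln (w r)) by (apply Rmult_le_compat_l; lra). lra. }
  specialize (HS3 r). lra.
- assert (0 < y t) by (apply Hypos; lra). lra.
Qed.

(** In the region where the orbit ends up, [y] increases, and it cannot stay bounded because the
    energy does not. The nullcline [w y = al] is repelling: an orbit that leaves it by a factor 2 is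
    driven out of [w < sqrt b] or down to [w = 0]. Hence [w y] is trapped between [al / 2] and
    [2 al]. *)
Lemma phase_flow_escape (al b s1 : R) (w y : R -> R) :
  0 < al -> 0 < b -> phase_flow (- al) b w y -> (forall s, 0 < w s) ->
  w s1 ^ 2 <> b ->
  is_lim y p_infty p_infty /\ is_lim w p_infty 0 /\
  exists S, forall s, S <= s -> al / 2 <= w s * y s.
Proof.
intros Hal Hb Hf Hw H1.
destruct (escape_eventually_below al b s1 w y Hal Hb Hf Hw H1) as [S HS].
assert (HE : forall M, exists S, forall s, S <= s -> M < energy (- al) b w y s).
{ apply (energy_unbounded (- al) b s1 w y); auto; lra. }
set (c := sqrt b) in *.
assert (Hc : 0 < c) by now apply sqrt_lt_R0.
assert (Hcc : c * c = b) by (apply sqrt_sqrt; lra).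
assert (Hdw : forall r, is_derive w r (- al + w r * y r)) by (intros r; apply Hf).
assert (Hdy : forall r, is_derive y r (b - w r ^ 2)) by (intros r; apply Hf).
assert (Hmon : forall s t, S <= s <= t -> y s <= y t).
{ intros s t Hst. assert (y s + 0 * (t - s) <= y t); [|lra].
  apply (growth_ge y (fun r => b - w r ^ 2)); [lra|easy|].
  intros r Hr. destruct (HS r) as [_ h]; [lra|]. specialize (Hw r). nra. }
assert (Hy : forall M, exists T, S <= T /\ forall s, T <= s -> M < y s).
{ intros M.
  destruct (classic (exists T, S <= T /\ M < y T)) as [[T [HT HT']]|Hn].
  { exists T. split; [easy|]. intros s Hs. specialize (Hmon T s). lra. }
  exfalso.
  assert (HM : forall s, S <= s -> y s <= M).
  { intros s Hs. destruct (Rle_or_lt (y s) M) as [h|h]; [easy|].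
    destruct Hn; now exists s. }
  (* If [y <= M] and [c / 2 < w < c], then [|y - al / w| <= K] and the energy is below the threshold
     that follows. Beyond it [w <= c / 2], so [y' >= 3 b / 4] and [y] is unbounded after all. *)
  set (K := M + 2 * (al / c)).
  destruct (HE (K ^ 2 / 2 + b / 2 - b * ln (c / 2))) as [S3 HS3].
  set (T := Rmax S3 S).
  assert (HT : S3 <= T /\ S <= T) by (split; [apply Rmax_l|apply Rmax_r]).
  destruct (growth_unbounded y (fun r => b - w r ^ 2) (3 * b / 4) T)
    with (M := M) as [t [Ht Ht']]; try lra.
  - intros; easy.
  - intros r Hr. destruct (Rle_or_lt (w r) (c / 2)) as [h|h].
    { specialize (Hw r). nra. }
    exfalso. destruct (HS r) as [h1 h2]; [lra|]. assert (h3 := HM r ltac:(lra)).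
    assert (h5 : ln (c / 2) <= ln (w r)) by (apply ln_le; lra).
    assert (h6 : energy (- al) b w y r <= K ^ 2 / 2 + b / 2 - b * ln (c / 2)).
    { unfold energy, damping.
      assert (0 < - - al / w r <= 2 * (al / c)).
      { rewrite Ropp_involutive. split; [apply Rdiv_lt_0_compat; lra|].
        replace (2 * (al / c)) with (al / (c / 2)) by (field; lra).
        apply Rmult_le_compat_l; [lra|]. apply Rinv_le_contravar; lra. }
      replace (- al / w r) with (- (- - al / w r)) by (unfold Rdiv; ring).
      assert ((y r + - (- - al / w r)) ^ 2 <= K ^ 2).
      { rewrite <- !Rsqr_pow2. apply Rsqr_le_abs_1. unfold K.
        assert (0 < al / c) by now apply Rdiv_lt_0_compat.
        rewrite (Rabs_pos_eq (M + 2 * (al / c))) by lra. apply Rabs_le; lra. }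
      assert (w r ^ 2 <= b) by (specialize (Hw r); nra).
      assert (b * ln (c / 2) <= b * ln (w r)) by (apply Rmult_le_compat_l; lra). lra. }
    specialize (HS3 r). lra.
  - assert (y t <= M) by (apply HM; lra). lra. }
(* Above [2 al] the product keeps increasing, so [w' >= al] for ever and [w] would exceed [c]. *)
assert (Hup : forall s, S <= s -> w s * y s <= 2 * al).
{ intros s Hs. destruct (Rle_or_lt (w s * y s) (2 * al)) as [h|h]; [easy|exfalso].
  assert (Hbar : forall t, s < t -> 0 < w t * y t - 2 * al).
  { apply (barrier (fun r => w r * y r - 2 * al)
      (fun r => (- al + w r * y r) * y r + w r * (b - w r ^ 2))).
    - intros r. assert (h1 := Hdw r). assert (h2 := Hdy r). auto_derive.
      + repeat split; eexists; eassumption.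
      + rewrite_derive h1. rewrite_derive h2. ring.
    - lra.
    - intros r Hr Hr0. replace (w r * y r) with (2 * al) by lra.
      destruct (HS r) as [h1 h2]; [lra|]. specialize (Hw r).
      assert (0 < w r * (b - w r ^ 2)) by (apply Rmult_lt_0_compat; nra).
      assert (0 < (- al + 2 * al) * y r) by (apply Rmult_lt_0_compat; lra). lra. }
  destruct (growth_unbounded w (fun r => - al + w r * y r) al s)
    with (M := c) as [t [Ht Ht']]; try lra.
  - intros; easy.
  - intros r Hr. destruct (Req_dec r s) as [->|]; [lra|].
    assert (0 < w r * y r - 2 * al) by (apply Hbar; lra). lra.
  - destruct (HS t) as [_ h1]; lra. }
split; [|split].
- apply is_lim_p_p. intros M. destruct (Hy M) as [T [_ HT]]. now exists T.
- apply is_lim_p_R. intros e He. destruct (Hy (2 * al / e)) as [T [HT HT']].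
  exists T. intros s Hs. specialize (Hw s). rewrite Rminus_0_r, Rabs_pos_eq by lra.
  specialize (HT' s Hs). assert (h := Hup s ltac:(lra)).
  assert (2 * al / e * e = 2 * al) by (field; lra).
  assert (0 < 2 * al / e) by (apply Rdiv_lt_0_compat; lra).
  destruct (Rlt_or_le (w s) e) as [h'|h']; [easy|nra].
(* On [w y = al / 2] the derivative of the product is [- al y / 2 + w (b - w^2)], at most
   [- al y / 2 + c b]; it is negative once [y > 2 c b / al]. From then on a product below [al / 2]
   stays there, and [w] falls to 0. *)
- destruct (Hy (2 * c * b / al)) as [T [HT HT']]. exists T. intros s Hs.
  destruct (Rle_or_lt (al / 2) (w s * y s)) as [h|h]; [easy|exfalso].
  assert (Hbar : forall t, s < t -> 0 < al / 2 - w t * y t).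
  { apply (barrier (fun r => al / 2 - w r * y r)
      (fun r => - ((- al + w r * y r) * y r + w r * (b - w r ^ 2)))).
    - intros r. assert (h1 := Hdw r). assert (h2 := Hdy r). auto_derive.
      + repeat split; eexists; eassumption.
      + rewrite_derive h1. rewrite_derive h2. ring.
    - lra.
    - intros r Hr Hr0. replace (w r * y r) with (al / 2) by lra.
      destruct (HS r) as [h1 h2]; [lra|]. specialize (Hw r).
      assert (w r * (b - w r ^ 2) <= c * b).
      { assert (h3 := pow2_ge_0 (w r)).
        apply Rmult_le_compat; [lra|nra|lra|lra]. }
      specialize (HT' r ltac:(lra)).
      assert (2 * c * b / al * al = 2 * c * b) by (field; lra). nra. }
  destruct (growth_unbounded (fun r => - w r) (fun r => - (- al + w r * y r)) (al / 2) s)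
    with (M := 0) as [t [Ht Ht']]; try lra.
  + intros r _. now apply (is_derive_opp w).
  + intros r Hr. destruct (Req_dec r s) as [->|]; [lra|].
    assert (0 < al / 2 - w r * y r) by (apply Hbar; lra). lra.
  + specialize (Hw t). lra.
Qed.

(** * The tangent angle by Picard iteration *)

Definition picard_x (c1 : R) (th : R -> R) (s : R) : R :=
  c1 + RInt (fun r => cos (th r)) 0 s.

Definition picard_y (c2 : R) (th : R -> R) (s : R) : R :=
  c2 + RInt (fun r => sin (th r)) 0 s.

(** [A <X,T> + B <X,N>] for the curve that starts at [c1 + i c2] with [T = expi th]. The
    self-similarity equation thus becomes the fixed-point equation of [picard_step] for the angle
    alone. *)
Definition picard_k (A B c1 c2 : R) (th : R -> R) (s : R) : R :=
  A * (picard_x c1 th s * cos (th s) + picard_y c2 th s * sin (th s))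
  + B * (picard_y c2 th s * cos (th s) - picard_x c1 th s * sin (th s)).

Definition picard_step (A B c1 c2 : R) (th : R -> R) (s : R) : R :=
  RInt (picard_k A B c1 c2 th) 0 s.

Lemma continuous_cos_comp (th : R -> R) (s : R) :
  continuous th s -> continuous (fun r => cos (th r)) s.
Proof.
intros H. apply (@continuous_comp R_UniformSpace R_UniformSpace R_UniformSpace);
  [exact H|apply continuous_cos].
Qed.

Lemma continuous_sin_comp (th : R -> R) (s : R) :
  continuous th s -> continuous (fun r => sin (th r)) s.
Proof.
intros H. apply (@continuous_comp R_UniformSpace R_UniformSpace R_UniformSpace);
  [exact H|apply continuous_sin].
Qed.

Lemma picard_x_derive (c1 : R) (th : R -> R) (s : R) :
  (forall r, continuous th r) -> is_derive (picard_x c1 th) s (cos (th s)).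
Proof.
intros H.
assert (h := is_derive_RInt_continuous (fun r => cos (th r)) 0 s
  (fun r => continuous_cos_comp th r (H r))).
rewrite <- (Rplus_0_l (cos (th s))).
apply (is_derive_plus (fun _ => c1) (fun r => RInt (fun r => cos (th r)) 0 r));
  [apply (is_derive_const (V := R_NormedModule))|exact h].
Qed.

Lemma picard_y_derive (c2 : R) (th : R -> R) (s : R) :
  (forall r, continuous th r) -> is_derive (picard_y c2 th) s (sin (th s)).
Proof.
intros H.
assert (h := is_derive_RInt_continuous (fun r => sin (th r)) 0 s
  (fun r => continuous_sin_comp th r (H r))).
rewrite <- (Rplus_0_l (sin (th s))).
apply (is_derive_plus (fun _ => c2) (fun r => RInt (fun r => sin (th r)) 0 r));
  [apply (is_derive_const (V := R_NormedModule))|exact h].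
Qed.

Lemma picard_k_continuous (A B c1 c2 : R) (th : R -> R) (s : R) :
  (forall r, continuous th r) -> continuous (picard_k A B c1 c2 th) s.
Proof.
intros H.
assert (h1 := is_derive_continuous _ _ _ (picard_x_derive c1 th s H)).
assert (h2 := is_derive_continuous _ _ _ (picard_y_derive c2 th s H)).
assert (h3 := continuous_cos_comp th s (H s)).
assert (h4 := continuous_sin_comp th s (H s)).
assert (M : forall f g : R -> R, continuous f s -> continuous g s ->
  continuous (fun r => f r * g r) s).
{ intros f g hf hg. now apply (@continuous_mult R_UniformSpace R_AbsRing). }
unfold picard_k.
apply (@continuous_plus R_UniformSpace R_AbsRing R_NormedModule).
- apply M; [apply continuous_const|].
  apply (@continuous_plus R_UniformSpace R_AbsRing R_NormedModule); now apply M.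
- apply M; [apply continuous_const|].
  apply (@continuous_minus R_UniformSpace R_AbsRing R_NormedModule); now apply M.
Qed.

Lemma picard_step_derive (A B c1 c2 : R) (th : R -> R) (s : R) :
  (forall r, continuous th r) ->
  is_derive (picard_step A B c1 c2 th) s (picard_k A B c1 c2 th s).
Proof.
intros H. apply is_derive_RInt_continuous. intros r; now apply picard_k_continuous.
Qed.

(* Since [d/ds (|s| + s^2) = +- (1 + 2 |s|)] dominates the linear growth of the
   Lipschitz constant of the curvature, [picard_step] contracts the sup-norm
   weighted by [1 / weight] on the whole line. *)
Definition weight (lam s : R) : R := exp (lam * (Rabs s + s ^ 2)).

Lemma weight_ge_1 (lam s : R) : 0 < lam -> 1 <= weight lam s.
Proof.
intros Hl. unfold weight. rewrite <- exp_0.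
assert (0 <= lam * (Rabs s + s ^ 2)).
{ apply Rmult_le_pos; [lra|]. assert (h1 := Rabs_pos s). assert (h2 := pow2_ge_0 s). lra. }
destruct H as [H|H]; [left; now apply exp_increasing|rewrite <- H; lra].
Qed.

(** For [r >= 0], [weight lam r / lam] is a primitive of [(1 + 2 r) weight lam r], so each
    integration gains a factor [1 / lam]. [P] is the upper bound for [s >= 0], [Q] adds the lower
    one, and a reflection handles [s < 0]. *)
Lemma weighted_integral_bound (lam K : R) (D dD : R -> R) (s : R) :
  0 < lam -> 0 <= K -> D 0 = 0 -> (forall r, is_derive D r (dD r)) ->
  (forall r, Rabs (dD r) <= K * ((1 + 2 * Rabs r) * weight lam r)) ->
  Rabs (D s) <= K / lam * weight lam s.
Proof.
intros Hl HK.
assert (HKl : 0 <= K / lam) by (apply Rmult_le_pos; [easy|left; now apply Rinv_0_lt_compat]).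
assert (P : forall (D dD : R -> R) s, 0 <= s -> D 0 = 0 ->
  (forall r, is_derive D r (dD r)) ->
  (forall r, dD r <= K * ((1 + 2 * Rabs r) * weight lam r)) ->
  D s <= K / lam * weight lam s).
{ clear D dD s. intros D dD s Hs D0 HD Hb.
  assert (G := growth_ge (fun r => K / lam * exp (lam * (r + r ^ 2)) - D r)
    (fun r => K * ((1 + 2 * r) * exp (lam * (r + r ^ 2))) - dD r) 0 0 s Hs).
  assert (K / lam * exp (lam * (0 + 0 ^ 2)) - D 0 + 0 * (s - 0)
    <= K / lam * exp (lam * (s + s ^ 2)) - D s).
  { apply G.
    - intros r _. assert (h := HD r). auto_derive; [repeat split; now exists (dD r)|].
      rewrite_derive h. simpl pow. field; lra.
    - intros r Hr. specialize (Hb r). unfold weight in Hb.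
      rewrite (Rabs_pos_eq r) in Hb by lra. lra. }
  rewrite D0 in H. replace (lam * (0 + 0 ^ 2)) with 0 in H by ring.
  rewrite exp_0 in H. unfold weight. rewrite (Rabs_pos_eq s) by easy. lra. }
assert (Q : forall (D dD : R -> R) s, 0 <= s -> D 0 = 0 ->
  (forall r, is_derive D r (dD r)) ->
  (forall r, Rabs (dD r) <= K * ((1 + 2 * Rabs r) * weight lam r)) ->
  Rabs (D s) <= K / lam * weight lam s).
{ clear D dD s. intros D dD s Hs D0 HD Hb. apply Rabs_le. split.
  - assert (- D s <= K / lam * weight lam s); [|lra].
    apply (P (fun r => - D r) (fun r => - dD r)); [easy|lra| |].
    + intros r. now apply (is_derive_opp D).
    + intros r. eapply Rle_trans; [apply Rle_abs|]. now rewrite Rabs_Ropp.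
  - apply (P D dD); try easy. intros r. eapply Rle_trans; [apply Rle_abs|easy]. }
intros D0 HD Hb. destruct (Rle_or_lt 0 s) as [h|h]; [now apply (Q D dD)|].
assert (H : Rabs (D (- - s)) <= K / lam * weight lam (- s)).
{ apply (Q (fun r => D (- r)) (fun r => - dD (- r))); [lra|now rewrite Ropp_0| |].
  - intros r. now apply is_derive_comp_opp.
  - intros r. specialize (Hb (- r)). unfold weight in *.
    rewrite !Rabs_Ropp in *. now replace ((- r) ^ 2) with (r ^ 2) in Hb by ring. }
rewrite Ropp_involutive in H. unfold weight in *. rewrite Rabs_Ropp in H.
now replace ((- s) ^ 2) with (s ^ 2) in H by ring.
Qed.

Lemma lipschitz_bound (D dD : R -> R) (C s : R) :
  (forall r, is_derive D r (dD r)) -> (forall r, Rabs (dD r) <= C) ->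
  Rabs (D s - D 0) <= C * Rabs s.
Proof.
intros HD HC. destruct (Rle_or_lt 0 s) as [h|h].
- destruct (mean_value D dD 0 s) as [c [_ E]]; [easy|intros; apply HD|].
  rewrite E, Rabs_mult, Rminus_0_r. apply Rmult_le_compat_r; [apply Rabs_pos|easy].
- destruct (mean_value D dD s 0) as [c [_ E]]; [lra|intros; apply HD|].
  rewrite Rabs_minus_sym, E, Rabs_mult, Rminus_0_l, Rabs_Ropp.
  apply Rmult_le_compat_r; [apply Rabs_pos|easy].
Qed.

Lemma cos_lipschitz (u v : R) : Rabs (cos u - cos v) <= Rabs (u - v).
Proof.
assert (H := lipschitz_bound (fun r => cos (r + v)) (fun r => - sin (r + v)) 1 (u - v)).
simpl in H. rewrite Rplus_0_l, Rmult_1_l in H.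
replace (u - v + v) with u in H by ring. apply H.
- intros r. auto_derive; [easy|ring].
- intros r. rewrite Rabs_Ropp. apply Rabs_le, SIN_bound.
Qed.

Lemma sin_lipschitz (u v : R) : Rabs (sin u - sin v) <= Rabs (u - v).
Proof.
assert (H := lipschitz_bound (fun r => sin (r + v)) (fun r => cos (r + v)) 1 (u - v)).
simpl in H. rewrite Rplus_0_l, Rmult_1_l in H.
replace (u - v + v) with u in H by ring. apply H.
- intros r. auto_derive; [easy|ring].
- intros r. apply Rabs_le, COS_bound.
Qed.

Lemma picard_x_0 (c1 : R) (th : R -> R) : picard_x c1 th 0 = c1.
Proof. unfold picard_x. rewrite RInt_point. apply Rplus_0_r. Qed.

Lemma picard_y_0 (c2 : R) (th : R -> R) : picard_y c2 th 0 = c2.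
Proof. unfold picard_y. rewrite RInt_point. apply Rplus_0_r. Qed.

Lemma picard_x_bound (c1 : R) (th : R -> R) (s : R) :
  (forall r, continuous th r) -> Rabs (picard_x c1 th s) <= Rabs c1 + Rabs s.
Proof.
intros H.
assert (h := lipschitz_bound (picard_x c1 th) (fun r => cos (th r)) 1 s
  (fun r => picard_x_derive c1 th r H) (fun r => Rabs_le _ _ (COS_bound (th r)))).
rewrite picard_x_0 in h. assert (h' := Rabs_triang c1 (picard_x c1 th s - c1)).
replace (c1 + (picard_x c1 th s - c1)) with (picard_x c1 th s) in h' by ring. lra.
Qed.

Lemma picard_y_bound (c2 : R) (th : R -> R) (s : R) :
  (forall r, continuous th r) -> Rabs (picard_y c2 th s) <= Rabs c2 + Rabs s.
Proof.
intros H.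
assert (h := lipschitz_bound (picard_y c2 th) (fun r => sin (th r)) 1 s
  (fun r => picard_y_derive c2 th r H) (fun r => Rabs_le _ _ (SIN_bound (th r)))).
rewrite picard_y_0 in h. assert (h' := Rabs_triang c2 (picard_y c2 th s - c2)).
replace (c2 + (picard_y c2 th s - c2)) with (picard_y c2 th s) in h' by ring. lra.
Qed.

Lemma Rabs_mult_diff (u v u' v' d e K : R) :
  Rabs (u - u') <= d -> Rabs v <= 1 -> Rabs u' <= K -> Rabs (v - v') <= e ->
  Rabs (u * v - u' * v') <= d + K * e.
Proof.
intros H1 H2 H3 H4. replace (u * v - u' * v') with ((u - u') * v + u' * (v - v')) by ring.
eapply Rle_trans; [apply Rabs_triang|]. rewrite !Rabs_mult.
assert (Rabs (u - u') * Rabs v <= d * 1) by (apply Rmult_le_compat; auto using Rabs_pos).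
assert (Rabs u' * Rabs (v - v') <= K * e) by (apply Rmult_le_compat; auto using Rabs_pos).
lra.
Qed.

(** Lipschitz constant of [picard_k] in the weighted norm, up to the factor [1 + 2 |s|]. *)
Definition picard_const (A B c1 c2 : R) : R :=
  2 * (Rabs A + Rabs B) * (1 + Rabs c1 + Rabs c2).

Lemma picard_const_pos (A B c1 c2 : R) : 0 <= picard_const A B c1 c2.
Proof.
assert (h1 := Rabs_pos A). assert (h2 := Rabs_pos B).
assert (h3 := Rabs_pos c1). assert (h4 := Rabs_pos c2).
unfold picard_const. apply Rmult_le_pos; lra.
Qed.

(** The factor [1 + 2 |s|] absorbs the linear growth of the position. Differences of positions carry
    a factor [1 / lam], which [1 <= lam] allows to drop, so positions and trigonometric factors
    share the bound [E]. *)
Lemma picard_k_diff (A B c1 c2 lam e : R) (th et : R -> R) (s : R) :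
  1 <= lam -> 0 <= e ->
  (forall r, continuous th r) -> (forall r, continuous et r) ->
  (forall r, Rabs (th r - et r) <= e * weight lam r) ->
  Rabs (picard_k A B c1 c2 th s - picard_k A B c1 c2 et s)
  <= picard_const A B c1 c2 * e * ((1 + 2 * Rabs s) * weight lam s).
Proof.
intros Hl He Hth Het Hd.
assert (Hw : forall r, e * weight lam r <= e * ((1 + 2 * Rabs r) * weight lam r)).
{ intros r. apply Rmult_le_compat_l; [easy|].
  assert (h := weight_ge_1 lam r ltac:(lra)). assert (h' := Rabs_pos r). nra. }
assert (Hel : e / lam <= e).
{ apply Rmult_le_reg_r with lam; [lra|]. replace (e / lam * lam) with e by (field; lra). nra. }
set (E := e * weight lam s).
assert (Hw1 := weight_ge_1 lam s ltac:(lra)).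
assert (Hel' : e / lam * weight lam s <= E) by (apply Rmult_le_compat_r; lra).
assert (Hx : Rabs (picard_x c1 th s - picard_x c1 et s) <= E).
{ eapply Rle_trans; [|exact Hel'].
  apply (weighted_integral_bound lam e
    (fun r => picard_x c1 th r - picard_x c1 et r)
    (fun r => cos (th r) - cos (et r))); [lra|easy| | |].
  - rewrite !picard_x_0. ring.
  - intros r. apply (is_derive_minus (picard_x c1 th) (picard_x c1 et));
      now apply picard_x_derive.
  - intros r. eapply Rle_trans; [apply cos_lipschitz|].
    eapply Rle_trans; [apply Hd|apply Hw]. }
assert (Hy : Rabs (picard_y c2 th s - picard_y c2 et s) <= E).
{ eapply Rle_trans; [|exact Hel'].
  apply (weighted_integral_bound lam e
    (fun r => picard_y c2 th r - picard_y c2 et r)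
    (fun r => sin (th r) - sin (et r))); [lra|easy| | |].
  - rewrite !picard_y_0. ring.
  - intros r. apply (is_derive_minus (picard_y c2 th) (picard_y c2 et));
      now apply picard_y_derive.
  - intros r. eapply Rle_trans; [apply sin_lipschitz|].
    eapply Rle_trans; [apply Hd|apply Hw]. }
assert (Hcos : Rabs (cos (th s) - cos (et s)) <= E)
  by (eapply Rle_trans; [apply cos_lipschitz|apply Hd]).
assert (Hsin : Rabs (sin (th s) - sin (et s)) <= E)
  by (eapply Rle_trans; [apply sin_lipschitz|apply Hd]).
assert (Hc1 : Rabs (cos (th s)) <= 1) by apply Rabs_le, COS_bound.
assert (Hs1 : Rabs (sin (th s)) <= 1) by apply Rabs_le, SIN_bound.
assert (Bx := picard_x_bound c1 et s Het). assert (By := picard_y_bound c2 et s Het).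
assert (T1 := Rabs_mult_diff _ _ _ _ _ _ _ Hx Hc1 Bx Hcos).
assert (T2 := Rabs_mult_diff _ _ _ _ _ _ _ Hy Hs1 By Hsin).
assert (T3 := Rabs_mult_diff _ _ _ _ _ _ _ Hy Hc1 By Hcos).
assert (T4 := Rabs_mult_diff _ _ _ _ _ _ _ Hx Hs1 Bx Hsin).
set (d1 := picard_x c1 th s * cos (th s) - picard_x c1 et s * cos (et s)) in *.
set (d2 := picard_y c2 th s * sin (th s) - picard_y c2 et s * sin (et s)) in *.
set (d3 := picard_y c2 th s * cos (th s) - picard_y c2 et s * cos (et s)) in *.
set (d4 := picard_x c1 th s * sin (th s) - picard_x c1 et s * sin (et s)) in *.
replace (picard_k A B c1 c2 th s - picard_k A B c1 c2 et s)
  with (A * (d1 + d2) + B * (d3 - d4)) by (unfold d1, d2, d3, d4, picard_k; ring).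
assert (p1 := Rabs_pos c1). assert (p2 := Rabs_pos c2). assert (p3 := Rabs_pos s).
assert (p4 := Rabs_pos A). assert (p5 := Rabs_pos B).
assert (HE : 0 <= E) by (apply Rmult_le_pos; lra).
set (F := (1 + Rabs c1 + Rabs c2) * ((1 + 2 * Rabs s) * E)).
assert (HF : 2 * E + (Rabs c1 + Rabs s) * E + (Rabs c2 + Rabs s) * E <= 2 * F).
{ unfold F. assert (0 <= Rabs c1 * E) by now apply Rmult_le_pos.
  assert (0 <= Rabs c2 * E) by now apply Rmult_le_pos.
  assert (0 <= Rabs s * E) by now apply Rmult_le_pos.
  assert (0 <= Rabs s * (Rabs c1 * E)) by now apply Rmult_le_pos.
  assert (0 <= Rabs s * (Rabs c2 * E)) by now apply Rmult_le_pos. nra. }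
eapply Rle_trans; [apply Rabs_triang|]. rewrite !Rabs_mult.
assert (Rabs (d1 + d2) <= 2 * F).
{ eapply Rle_trans; [apply Rabs_triang|]. lra. }
assert (Rabs (d3 - d4) <= 2 * F).
{ unfold Rminus. eapply Rle_trans; [apply Rabs_triang|]. rewrite Rabs_Ropp. lra. }
replace (picard_const A B c1 c2 * e * ((1 + 2 * Rabs s) * weight lam s))
  with (Rabs A * (2 * F) + Rabs B * (2 * F)) by (unfold picard_const, F, E; ring).
apply Rplus_le_compat; apply Rmult_le_compat_l; easy.
Qed.

Lemma picard_step_0 (A B c1 c2 : R) (th : R -> R) : picard_step A B c1 c2 th 0 = 0.
Proof. unfold picard_step. now rewrite RInt_point. Qed.

(** More than twice the Lipschitz constant, so that [K / lam <= 1 / 2]; the [+ 1] keeps it at least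
    1 even when the constant vanishes. *)
Definition picard_lam (A B c1 c2 : R) : R := 2 * picard_const A B c1 c2 + 1.

Lemma picard_step_contraction (A B c1 c2 e : R) (th et : R -> R) (s : R) :
  0 <= e -> (forall r, continuous th r) -> (forall r, continuous et r) ->
  (forall r, Rabs (th r - et r) <= e * weight (picard_lam A B c1 c2) r) ->
  Rabs (picard_step A B c1 c2 th s - picard_step A B c1 c2 et s)
  <= e / 2 * weight (picard_lam A B c1 c2) s.
Proof.
intros He Hth Het Hd. set (lam := picard_lam A B c1 c2) in *.
set (K := picard_const A B c1 c2).
assert (HK : 0 <= K) by apply picard_const_pos.
assert (Hlam : lam = 2 * K + 1) by reflexivity.
apply Rle_trans with (K * e / lam * weight lam s).
- apply (weighted_integral_bound lam (K * e)
    (fun r => picard_step A B c1 c2 th r - picard_step A B c1 c2 et r)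
    (fun r => picard_k A B c1 c2 th r - picard_k A B c1 c2 et r)); [lra|nra| | |].
  + rewrite !picard_step_0. ring.
  + intros r. apply (is_derive_minus (picard_step A B c1 c2 th) (picard_step A B c1 c2 et));
      now apply picard_step_derive.
  + intros r. apply picard_k_diff; auto; lra.
- apply Rmult_le_compat_r; [left; apply exp_pos|].
  apply Rmult_le_reg_r with lam; [lra|].
  replace (K * e / lam * lam) with (K * e) by (field; lra). rewrite Hlam. nra.
Qed.

Fixpoint picard_iter (A B c1 c2 : R) (n : nat) : R -> R :=
  match n with
  | O => fun _ => 0
  | S n => picard_step A B c1 c2 (picard_iter A B c1 c2 n)
  end.

Lemma picard_iter_continuous (A B c1 c2 : R) (n : nat) (s : R) :
  continuous (picard_iter A B c1 c2 n) s.
Proof.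
revert s. induction n as [|n IH]; intros s; simpl.
- apply continuous_const.
- eapply is_derive_continuous, picard_step_derive, IH.
Qed.

Lemma picard_iter_succ (A B c1 c2 : R) (n : nat) (s : R) :
  Rabs (picard_iter A B c1 c2 (S n) s - picard_iter A B c1 c2 n s)
  <= (1 / 2) ^ n * weight (picard_lam A B c1 c2) s.
Proof.
revert s. induction n as [|n IH]; intros s.
- set (lam := picard_lam A B c1 c2). set (K := picard_const A B c1 c2).
  assert (HK : 0 <= K) by apply picard_const_pos.
  assert (Hlam : lam = 2 * K + 1) by reflexivity.
  simpl. rewrite Rminus_0_r, Rmult_1_l.
  assert (Hw := weight_ge_1 lam s ltac:(lra)).
  apply Rle_trans with (K / lam * weight lam s).
  + apply (weighted_integral_bound lam K (picard_step A B c1 c2 (fun _ => 0))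
      (picard_k A B c1 c2 (fun _ => 0))); [lra|easy|apply picard_step_0| |].
    * intros r. apply picard_step_derive. intros; apply continuous_const.
    * intros r. unfold picard_k. rewrite cos_0, sin_0.
      assert (Bx := picard_x_bound c1 (fun _ => 0) r (fun _ => continuous_const _ _)).
      assert (By := picard_y_bound c2 (fun _ => 0) r (fun _ => continuous_const _ _)).
      set (X := picard_x c1 (fun _ => 0) r) in *. set (Y := picard_y c2 (fun _ => 0) r) in *.
      replace (A * (X * 1 + Y * 0) + B * (Y * 1 - X * 0)) with (A * X + B * Y) by ring.
      eapply Rle_trans; [apply Rabs_triang|]. rewrite !Rabs_mult.
      assert (p1 := Rabs_pos c1). assert (p2 := Rabs_pos c2). assert (p3 := Rabs_pos r).
      assert (p4 := Rabs_pos A). assert (p5 := Rabs_pos B).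
      set (F := (1 + Rabs c1 + Rabs c2) * (1 + 2 * Rabs r)).
      assert (Rabs X <= 2 * F) by (unfold F; nra).
      assert (Rabs Y <= 2 * F) by (unfold F; nra).
      apply Rle_trans with (Rabs A * (2 * F) + Rabs B * (2 * F)).
      { apply Rplus_le_compat; apply Rmult_le_compat_l; easy. }
      replace (Rabs A * (2 * F) + Rabs B * (2 * F)) with (K * (1 + 2 * Rabs r))
        by (unfold K, F, picard_const; ring).
      assert (Hw' := weight_ge_1 lam r ltac:(lra)).
      rewrite <- Rmult_assoc.
      rewrite <- (Rmult_1_r (K * (1 + 2 * Rabs r))) at 1.
      apply Rmult_le_compat_l; [|easy]. apply Rmult_le_pos; lra.
  + assert (K / lam <= 1); [|nra]. apply Rmult_le_reg_r with lam; [lra|].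
    replace (K / lam * lam) with K by (field; lra). lra.
- replace ((1 / 2) ^ S n) with ((1 / 2) ^ n / 2) by (simpl; field).
  apply (picard_step_contraction A B c1 c2 ((1 / 2) ^ n)
    (picard_iter A B c1 c2 (S n)) (picard_iter A B c1 c2 n)).
  + apply pow_le; lra.
  + apply picard_iter_continuous.
  + apply picard_iter_continuous.
  + exact IH.
Qed.

(** The bound is the exact partial sum of the geometric series, in which form the induction on [m]
    closes. *)
Lemma picard_iter_cauchy (A B c1 c2 : R) (n m : nat) (s : R) :
  Rabs (picard_iter A B c1 c2 (n + m) s - picard_iter A B c1 c2 n s)
  <= (2 * (1 / 2) ^ n - 2 * (1 / 2) ^ (n + m)) * weight (picard_lam A B c1 c2) s.
Proof.
induction m as [|m IH].
- rewrite Nat.add_0_r, !Rminus_diag, Rabs_R0. lra.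
- rewrite Nat.add_succ_r.
  assert (H := picard_iter_succ A B c1 c2 (n + m) s).
  replace (picard_iter A B c1 c2 (S (n + m)) s - picard_iter A B c1 c2 n s)
    with ((picard_iter A B c1 c2 (S (n + m)) s - picard_iter A B c1 c2 (n + m) s)
      + (picard_iter A B c1 c2 (n + m) s - picard_iter A B c1 c2 n s)) by ring.
  eapply Rle_trans; [apply Rabs_triang|].
  replace ((1 / 2) ^ S (n + m)) with ((1 / 2) ^ (n + m) / 2) by (simpl; field). lra.
Qed.

Lemma half_pow_small (K e : R) : 0 < e -> exists n, K * (1 / 2) ^ n < e.
Proof.
intros He.
destruct (pow_lt_1_zero (1 / 2)) with (y := e / (Rabs K + 1)) as [n Hn].
- rewrite Rabs_pos_eq; lra.
- apply Rdiv_lt_0_compat; [easy|]. assert (h := Rabs_pos K). lra.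
- exists n. specialize (Hn n (le_n n)). assert (h := Rabs_pos K). assert (h' := Rle_abs K).
  assert (Hp : 0 <= (1 / 2) ^ n) by (apply pow_le; lra). rewrite Rabs_pos_eq in Hn by easy.
  apply Rle_lt_trans with ((Rabs K + 1) * (1 / 2) ^ n); [nra|].
  apply Rlt_le_trans with ((Rabs K + 1) * (e / (Rabs K + 1))).
  + apply Rmult_lt_compat_l; lra.
  + right; field; lra.
Qed.

Definition picard_limit (A B c1 c2 s : R) : R :=
  real (Lim_seq (fun n => picard_iter A B c1 c2 n s)).

Lemma picard_limit_bound (A B c1 c2 s : R) :
  forall n, Rabs (picard_limit A B c1 c2 s - picard_iter A B c1 c2 n s)
    <= 2 * (1 / 2) ^ n * weight (picard_lam A B c1 c2) s.
Proof.
set (u := fun n => picard_iter A B c1 c2 n s). set (W := weight (picard_lam A B c1 c2) s).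
assert (HW : 0 < W) by apply exp_pos.
assert (Hd : forall n m, Rabs (u (n + m)%nat - u n) <= 2 * (1 / 2) ^ n * W).
{ intros n m. eapply Rle_trans; [apply picard_iter_cauchy|]. fold W.
  apply Rmult_le_compat_r; [lra|].
  assert (0 <= (1 / 2) ^ (n + m)) by (apply pow_le; lra). lra. }
destruct (proj2 (ex_lim_seq_cauchy_corr u)) as [l Hl].
{ intros e. destruct (half_pow_small (4 * W) e (cond_pos e)) as [N HN].
  exists N. intros n m Hn Hm.
  assert (h1 := Hd N (n - N)%nat). assert (h2 := Hd N (m - N)%nat).
  replace (N + (n - N))%nat with n in h1 by lia.
  replace (N + (m - N))%nat with m in h2 by lia.
  apply Rabs_le_between in h1. apply Rabs_le_between in h2. apply Rabs_def1; lra. }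
unfold picard_limit. fold u. rewrite (is_lim_seq_unique u l Hl). simpl real. intros n.
fold (u n). fold W.
apply (is_lim_seq_le (fun m => Rabs (u (m + n)%nat - u n)) (fun _ => 2 * (1 / 2) ^ n * W)
  (Finite (Rabs (l - u n))) (Finite (2 * (1 / 2) ^ n * W))).
- intros m. rewrite Nat.add_comm. apply Hd.
- apply (is_lim_seq_abs (fun m => u (m + n)%nat - u n) (Finite (l - u n))).
  apply is_lim_seq_minus'; [|apply is_lim_seq_const].
  now apply is_lim_seq_incr_n.
- apply is_lim_seq_const.
Qed.

Lemma weight_locally_bounded (lam s r : R) :
  0 < lam -> Rabs (r - s) <= 1 -> weight lam r <= weight lam (Rabs s + 1).
Proof.
intros Hl H. unfold weight.
assert (h : Rabs r <= Rabs s + 1).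
{ assert (h := Rabs_triang (r - s) s). replace (r - s + s) with r in h by ring. lra. }
assert (h1 := Rabs_pos s). assert (h2 := Rabs_pos r).
rewrite (Rabs_pos_eq (Rabs s + 1)) by lra.
assert (r ^ 2 <= (Rabs s + 1) ^ 2) by (rewrite <- pow2_abs; nra).
assert (lam * (Rabs r + r ^ 2) <= lam * (Rabs s + 1 + (Rabs s + 1) ^ 2))
  by (apply Rmult_le_compat_l; lra).
destruct H1 as [H1|H1]; [left; now apply exp_increasing|right; now rewrite H1].
Qed.

(** The iterates converge uniformly on bounded intervals, where the weight is bounded, so the limit
    is continuous. Continuity has to come first: the contraction estimate that makes the limit a
    fixed point is about continuous angles. *)
Lemma tangent_angle_exists (A B c1 c2 : R) :
  exists th : R -> R, th 0 = 0 /\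
    forall s, is_derive th s (picard_k A B c1 c2 th s).
Proof.
set (lam := picard_lam A B c1 c2).
assert (Hlam : 0 < lam).
{ assert (h := picard_const_pos A B c1 c2). unfold lam, picard_lam. lra. }
set (th := picard_limit A B c1 c2).
assert (Hth := picard_limit_bound A B c1 c2). fold th lam in Hth.
assert (Hc : forall s, continuous th s).
{ intros s. apply continuity_pt_filterlim. intros e He.
  destruct (half_pow_small (2 * weight lam (Rabs s + 1)) (e / 3)) as [n Hn]; [lra|].
  assert (Hcn := picard_iter_continuous A B c1 c2 n s).
  apply continuity_pt_filterlim in Hcn.
  destruct (Hcn (e / 3)) as [d [Hd Hd']]; [lra|].
  exists (Rmin d 1). split; [apply Rmin_pos; lra|].
  intros r [Hr Hr']. simpl in *. unfold R_dist in *.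
  assert (h1 : Rabs (r - s) < d) by (eapply Rlt_le_trans; [apply Hr'|apply Rmin_l]).
  assert (h2 : Rabs (r - s) <= 1) by
    (left; eapply Rlt_le_trans; [apply Hr'|apply Rmin_r]).
  specialize (Hd' r (conj Hr h1)).
  assert (B1 := Hth r n). assert (B2 := Hth s n).
  assert (W1 := weight_locally_bounded lam s r Hlam h2).
  assert (W2 := weight_locally_bounded lam s s Hlam).
  rewrite Rminus_diag, Rabs_R0 in W2. specialize (W2 Rle_0_1).
  assert (Hp : 0 <= (1 / 2) ^ n) by (apply pow_le; lra).
  assert (C1 : 2 * (1 / 2) ^ n * weight lam r <= 2 * (1 / 2) ^ n * weight lam (Rabs s + 1))
    by (apply Rmult_le_compat_l; lra).
  assert (C2 : 2 * (1 / 2) ^ n * weight lam s <= 2 * (1 / 2) ^ n * weight lam (Rabs s + 1))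
    by (apply Rmult_le_compat_l; lra).
  apply Rabs_le_between in B1. apply Rabs_le_between in B2. apply Rabs_def2 in Hd'.
  apply Rabs_def1; lra. }
assert (Hfix : forall s, picard_step A B c1 c2 th s = th s).
{ intros s. apply Rminus_diag_uniq, Rabs_eq_0, Rle_antisym; [|apply Rabs_pos].
  apply le_epsilon. intros e He.
  destruct (half_pow_small (2 * weight lam s) e He) as [n Hn].
  assert (Hp : 0 <= (1 / 2) ^ n) by (apply pow_le; lra).
  assert (h1 := picard_step_contraction A B c1 c2 (2 * (1 / 2) ^ n) th
    (picard_iter A B c1 c2 n) s ltac:(lra) Hc (picard_iter_continuous A B c1 c2 n)
    (fun r => Hth r n)).
  assert (h2 := Hth s (S n)). simpl picard_iter in h2. fold lam in h1.
  replace ((1 / 2) ^ S n) with ((1 / 2) ^ n / 2) in h2 by (simpl; field).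
  apply Rabs_le_between in h1. apply Rabs_le_between in h2. apply Rabs_le; lra. }
exists th. split.
- rewrite <- Hfix. apply picard_step_0.
- intros s. apply is_derive_ext with (picard_step A B c1 c2 th); [exact Hfix|].
  now apply picard_step_derive.
Qed.

(** * Frames *)

Lemma inner_eq (z w : C) : inner z w = Re z * Re w + Im z * Im w.
Proof. unfold inner, Re, Im; simpl. ring. Qed.

Lemma inner_normal_eq (z w : C) : inner z (Ci * w)%C = Im z * Re w - Re z * Im w.
Proof. unfold inner, Re, Im; simpl. ring. Qed.

Lemma C_eq (z w : C) : Re z = Re w -> Im z = Im w -> z = w.
Proof. destruct z, w; simpl; congruence. Qed.

Lemma Cmod_sqr (z : C) : Cmod z ^ 2 = Re z ^ 2 + Im z ^ 2.
Proof.
unfold Cmod. rewrite <- Rsqr_pow2, Rsqr_sqrt; [easy|].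
apply Rplus_le_le_0_compat; apply pow2_ge_0.
Qed.

Lemma Cmod_unit (z : C) : Re z ^ 2 + Im z ^ 2 = 1 <-> Cmod z = 1.
Proof.
rewrite <- Cmod_sqr. assert (h := Cmod_ge_0 z). split; intros H; nra.
Qed.

(** The Frenet equations [X' = T], [T' = i k T], [|T| = 1]. Only first derivatives appear, so that a
    curve built from an integral equation qualifies at once; its smoothness is recovered later from
    the equation. *)
Definition frame (X T : R -> C) (k : R -> R) : Prop :=
  forall s,
    is_derive (fun u => Re (X u)) s (Re (T s)) /\
    is_derive (fun u => Im (X u)) s (Im (T s)) /\
    is_derive (fun u => Re (T u)) s (- k s * Im (T s)) /\
    is_derive (fun u => Im (T u)) s (k s * Re (T s)) /\
    Re (T s) ^ 2 + Im (T s) ^ 2 = 1.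

Lemma frame_of_curve (X : R -> C) :
  smooth_curve X -> arc_length X -> frame X (tangent X) (curvature X).
Proof.
intros Hs Ha s.
assert (HT := tangent_arc_length X Ha).
set (a := fun u => Re (X u)). set (b := fun u => Im (X u)).
assert (Hu : forall r, Derive a r ^ 2 + Derive b r ^ 2 = 1).
{ intros r. apply (Cmod_unit (curve_deriv X r)), Ha. }
assert (Hc : is_derive (Derive a) s (Derive (Derive a) s)).
{ apply Derive_correct. apply (Hs 2%nat s). }
assert (Hd : is_derive (Derive b) s (Derive (Derive b) s)).
{ apply Derive_correct. apply (Hs 2%nat s). }
assert (Hk : curvature X s = Derive (Derive b) s * Derive a s - Derive (Derive a) s * Derive b s).
{ rewrite curvature_arc_length by easy. unfold normal. rewrite inner_normal_eq, HT.
  reflexivity. }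
(* [T] is orthogonal to [T'] because [|T| = 1], so [T'] reduces to its normal component [k N]. *)
assert (H0 : Derive a s * Derive (Derive a) s + Derive b s * Derive (Derive b) s = 0).
{ assert (h : is_derive (fun r => Derive a r ^ 2 + Derive b r ^ 2) s
    (2 * (Derive a s * Derive (Derive a) s + Derive b s * Derive (Derive b) s))).
  { set (c := Derive a) in *. set (d := Derive b) in *.
    auto_derive; [repeat split; eexists; eassumption|].
    rewrite_derive Hc. rewrite_derive Hd. ring. }
  apply is_derive_ext with (g := fun _ => 1) in h; [|exact Hu].
  apply is_derive_unique in h. rewrite Derive_const in h. lra. }
specialize (Hu s).
split; [|split; [|split; [|split]]].
- rewrite HT. apply Derive_correct. apply (Hs 1%nat s).
- rewrite HT. apply Derive_correct. apply (Hs 1%nat s).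
- apply is_derive_ext with (Derive a).
  { intros r. now rewrite HT. }
  rewrite HT, Hk. simpl Im. fold b.
  replace (- (Derive (Derive b) s * Derive a s - Derive (Derive a) s * Derive b s) * Derive b s)
    with (Derive (Derive a) s); [exact Hc|].
  set (c := Derive a s) in *. set (d := Derive b s) in *.
  set (c' := Derive (Derive a) s) in *. set (d' := Derive (Derive b) s) in *.
  replace c' with (c' * (c ^ 2 + d ^ 2)) at 1 by (rewrite Hu; ring).
  replace (c' * (c ^ 2 + d ^ 2)) with ((c * c' + d * d') * c - d * d' * c + c' * d ^ 2) by ring.
  rewrite H0. ring.
- apply is_derive_ext with (Derive b).
  { intros r. now rewrite HT. }
  rewrite HT, Hk. simpl Re. fold a.
  replace ((Derive (Derive b) s * Derive a s - Derive (Derive a) s * Derive b s) * Derive a s)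
    with (Derive (Derive b) s); [exact Hd|].
  set (c := Derive a s) in *. set (d := Derive b s) in *.
  set (c' := Derive (Derive a) s) in *. set (d' := Derive (Derive b) s) in *.
  replace d' with (d' * (c ^ 2 + d ^ 2)) at 1 by (rewrite Hu; ring).
  replace (d' * (c ^ 2 + d ^ 2)) with ((c * c' + d * d') * d - c * c' * d + d' * c ^ 2) by ring.
  rewrite H0. ring.
- rewrite HT. exact Hu.
Qed.

Lemma frame_curve_deriv (X T : R -> C) (k : R -> R) (s : R) :
  frame X T k -> curve_deriv X s = T s.
Proof.
intros H. destruct (H s) as [Ha [Hb _]]. apply C_eq; now apply is_derive_unique.
Qed.

Lemma frame_arc_length (X T : R -> C) (k : R -> R) : frame X T k -> arc_length X.
Proof.
intros H s. rewrite (frame_curve_deriv X T k s H). apply Cmod_unit, H.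
Qed.

Lemma frame_tangent (X T : R -> C) (k : R -> R) (s : R) :
  frame X T k -> tangent X s = T s.
Proof.
intros H. rewrite tangent_arc_length by now apply (frame_arc_length X T k).
now apply (frame_curve_deriv X T k).
Qed.

Lemma frame_curvature (X T : R -> C) (k : R -> R) (s : R) :
  frame X T k -> curvature X s = k s.
Proof.
intros H. rewrite curvature_arc_length by now apply (frame_arc_length X T k).
unfold normal. rewrite inner_normal_eq, (frame_tangent X T k s H).
destruct (H s) as [_ [_ [Hc [Hd Hu]]]].
assert (E1 : Re (curve_deriv (curve_deriv X) s) = - k s * Im (T s)).
{ apply is_derive_unique, (is_derive_ext (fun u => Re (T u))); [|exact Hc].
  intros r; now rewrite (frame_curve_deriv X T k r H). }
assert (E2 : Im (curve_deriv (curve_deriv X) s) = k s * Re (T s)).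
{ apply is_derive_unique, (is_derive_ext (fun u => Im (T u))); [|exact Hd].
  intros r; now rewrite (frame_curve_deriv X T k r H). }
rewrite E1, E2.
replace (k s) with (k s * (Re (T s) ^ 2 + Im (T s) ^ 2)) at 3 by (rewrite Hu; ring).
ring.
Qed.

Definition phase_x (A B : R) (X T : R -> C) (s : R) : R :=
  A * inner (X s) (T s) + B * inner (X s) (Ci * T s)%C.

Definition phase_y (A B : R) (X T : R -> C) (s : R) : R :=
  - B * inner (X s) (T s) + A * inner (X s) (Ci * T s)%C.

Definition solves (A B : R) (X T : R -> C) : Prop := frame X T (phase_x A B X T).

Lemma self_similar_solves (A B : R) (X : R -> C) :
  self_similar_curve A B X -> solves A B X (tangent X).
Proof.
intros [Hs [Ha [He _]]] s. assert (H := frame_of_curve X Hs Ha s).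
rewrite <- (He s) in H. exact H.
Qed.

Lemma solves_curvature (A B : R) (X T : R -> C) (s : R) :
  solves A B X T -> curvature X s = phase_x A B X T s.
Proof. apply frame_curvature. Qed.

Lemma solves_yfun (A B : R) (X T : R -> C) (s : R) :
  solves A B X T -> yfun A B X s = phase_y A B X T s.
Proof.
intros H. unfold yfun, phase_y, normal. now rewrite (frame_tangent _ _ _ s H).
Qed.

(** * Smoothness *)

(* Polynomial expressions in the components of [X] and [T]; along a curve
   whose curvature is such an expression they are stable under derivation. *)
Inductive frame_expr : Type :=
| FCst (c : R)
| FXre | FXim | FTre | FTim
| FAdd (e f : frame_expr)
| FMul (e f : frame_expr).

Fixpoint feval (X T : R -> C) (e : frame_expr) (s : R) : R :=
  match e with
  | FCst c => c
  | FXre => Re (X s)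
  | FXim => Im (X s)
  | FTre => Re (T s)
  | FTim => Im (T s)
  | FAdd e f => feval X T e s + feval X T f s
  | FMul e f => feval X T e s * feval X T f s
  end.

Fixpoint fderiv (k e : frame_expr) : frame_expr :=
  match e with
  | FCst _ => FCst 0
  | FXre => FTre
  | FXim => FTim
  | FTre => FMul (FMul (FCst (-1)) k) FTim
  | FTim => FMul k FTre
  | FAdd e f => FAdd (fderiv k e) (fderiv k f)
  | FMul e f => FAdd (FMul (fderiv k e) f) (FMul e (fderiv k f))
  end.

Definition phase_x_expr (A B : R) : frame_expr :=
  FAdd
    (FMul (FCst A) (FAdd (FMul FXre FTre) (FMul FXim FTim)))
    (FMul (FCst B)
       (FAdd (FMul FXim FTre) (FMul (FCst (-1)) (FMul FXre FTim)))).

Lemma feval_derive (A B : R) (X T : R -> C) (e : frame_expr) (s : R) :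
  solves A B X T ->
  is_derive (feval X T e) s (feval X T (fderiv (phase_x_expr A B) e) s).
Proof.
intros H. destruct (H s) as [Ha [Hb [Hc [Hd _]]]].
assert (Hk : phase_x A B X T s = feval X T (phase_x_expr A B) s).
{ unfold phase_x. rewrite inner_eq, inner_normal_eq. simpl. ring. }
rewrite Hk in Hc, Hd.
induction e as [c| | | | |e IHe f IHf|e IHe f IHf].
- apply (is_derive_const (V := R_NormedModule)).
- exact Ha.
- exact Hb.
- replace (feval X T (fderiv (phase_x_expr A B) FTre) s) with
    (- feval X T (phase_x_expr A B) s * Im (T s)) by (cbn [fderiv feval]; ring).
  exact Hc.
- exact Hd.
- now apply (is_derive_plus (feval X T e) (feval X T f)).
- apply (is_derive_mult (feval X T e) (feval X T f)); [easy|easy|].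
  intros; apply Rmult_comm.
Qed.

Lemma feval_Derive_n (A B : R) (X T : R -> C) (n : nat) (e : frame_expr) (s : R) :
  solves A B X T ->
  Derive_n (feval X T e) n s =
  feval X T (Nat.iter n (fderiv (phase_x_expr A B)) e) s.
Proof.
intros H. revert s. induction n as [|n IH]; intros s; [easy|].
simpl. rewrite (Derive_ext _ _ _ IH). now apply is_derive_unique, feval_derive.
Qed.

Lemma feval_smooth (A B : R) (X T : R -> C) (e : frame_expr) (n : nat) (s : R) :
  solves A B X T -> ex_derive_n (feval X T e) n s.
Proof.
intros H. destruct n as [|n]; [easy|]. simpl.
apply ex_derive_ext with (feval X T (Nat.iter n (fderiv (phase_x_expr A B)) e)).
- intros r. symmetry. now apply feval_Derive_n.
- eexists. now apply feval_derive.
Qed.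

Lemma solves_smooth (A B : R) (X T : R -> C) : solves A B X T -> smooth_curve X.
Proof.
intros H n s.
split; [apply (feval_smooth A B X T FXre)|apply (feval_smooth A B X T FXim)]; easy.
Qed.

Lemma solves_self_similar (A B : R) (X T : R -> C) :
  solves A B X T -> ~ traces_circle (1 / sqrt (- B)) X -> self_similar_curve A B X.
Proof.
intros H Hn. split; [|split; [|split; [|easy]]].
- now apply (solves_smooth A B X T).
- now apply (frame_arc_length X T (phase_x A B X T)).
- intros s. rewrite (solves_curvature A B X T s H). unfold normal, phase_x.
  now rewrite (frame_tangent _ _ _ s H).
Qed.

Lemma is_derive_product (f g : R -> R) (s df dg : R) :
  is_derive f s df -> is_derive g s dg ->
  is_derive (fun u => f u * g u) s (df * g s + f s * dg).
Proof.
intros Hf Hg. apply (is_derive_mult f g); [easy|easy|]. intros; apply Rmult_comm.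
Qed.

(** With [tau = <X,T>] and [nu = <X,N>] the Frenet equations read [tau' = 1 + k nu] and
    [nu' = - k tau]. Here [k] is itself the combination [A tau + B nu], which closes the system. *)
Lemma solves_phase_flow (A B : R) (X T : R -> C) :
  solves A B X T -> phase_flow A (- B) (phase_x A B X T) (phase_y A B X T).
Proof.
intros H s. assert (Hs := H s). set (k := phase_x A B X T s) in Hs.
destruct Hs as [Ha [Hb [Hc [Hd Hu]]]].
assert (Ht : is_derive (fun u => inner (X u) (T u)) s
  (1 + k * inner (X s) (Ci * T s)%C)).
{ apply is_derive_ext with (fun u => Re (X u) * Re (T u) + Im (X u) * Im (T u)).
  { intros; now rewrite inner_eq. }
  replace (1 + k * inner (X s) (Ci * T s)%C) with
    (Re (T s) * Re (T s) + Re (X s) * (- k * Im (T s))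
     + (Im (T s) * Im (T s) + Im (X s) * (k * Re (T s))))
    by (rewrite inner_normal_eq, <- Hu; ring).
  apply (is_derive_plus (fun u => Re (X u) * Re (T u)) (fun u => Im (X u) * Im (T u)));
    now apply is_derive_product. }
assert (Hn : is_derive (fun u => inner (X u) (Ci * T u)%C) s
  (- k * inner (X s) (T s))).
{ apply is_derive_ext with (fun u => Im (X u) * Re (T u) - Re (X u) * Im (T u)).
  { intros; now rewrite inner_normal_eq. }
  replace (- k * inner (X s) (T s)) with
    (Im (T s) * Re (T s) + Im (X s) * (- k * Im (T s))
     - (Re (T s) * Im (T s) + Re (X s) * (k * Re (T s))))
    by (rewrite inner_eq; ring).
  apply (is_derive_minus (fun u => Im (X u) * Re (T u)) (fun u => Re (X u) * Im (T u)));
    now apply is_derive_product. }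
assert (L : forall p q : R, is_derive (fun u => p * inner (X u) (T u)
    + q * inner (X u) (Ci * T u)%C) s
  (p * (1 + k * inner (X s) (Ci * T s)%C) + q * (- k * inner (X s) (T s)))).
{ intros p q.
  apply (is_derive_plus (fun u => p * inner (X u) (T u))
    (fun u => q * inner (X u) (Ci * T u)%C)).
  - now apply (is_derive_scal (fun u => inner (X u) (T u))).
  - now apply (is_derive_scal (fun u => inner (X u) (Ci * T u)%C)). }
assert (Ek : k = A * inner (X s) (T s) + B * inner (X s) (Ci * T s)%C) by reflexivity.
fold k. split.
- replace (A + k * phase_y A B X T s) with
    (A * (1 + k * inner (X s) (Ci * T s)%C) + B * (- k * inner (X s) (T s)))
    by (unfold phase_y; ring).
  apply L.
- replace (- B - k ^ 2) with
    (- B * (1 + k * inner (X s) (Ci * T s)%C) + A * (- k * inner (X s) (T s)))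
    by (rewrite Ek at 3; rewrite Ek; ring).
  apply L.
Qed.

Lemma phase_x_reverse (A B : R) (X T : R -> C) (s : R) :
  phase_x A B (reverse X) (fun s => Copp (T (- s))) s = - phase_x A B X T (- s).
Proof. unfold phase_x, reverse. rewrite !inner_eq. unfold Re, Im; simpl. ring. Qed.

Lemma solves_reverse (A B : R) (X T : R -> C) :
  solves A B X T -> solves A B (reverse X) (fun s => Copp (T (- s))).
Proof.
intros H s. destruct (H (- s)) as [Ha [Hb [Hc [Hd Hu]]]].
rewrite phase_x_reverse. set (k := phase_x A B X T (- s)) in *.
unfold reverse. split; [|split; [|split; [|split]]].
- apply (is_derive_comp_opp (fun u => Re (X u)) s _ Ha).
- apply (is_derive_comp_opp (fun u => Im (X u)) s _ Hb).
- replace (- - k * Im (Copp (T (- s)))) with (opp (- (- k * Im (T (- s)))))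
    by (unfold opp, Re, Im; simpl; ring).
  apply (is_derive_opp (fun u => Re (T (- u)))).
  apply (is_derive_comp_opp (fun u => Re (T u)) s _ Hc).
- replace (- k * Re (Copp (T (- s)))) with (opp (- (k * Re (T (- s)))))
    by (unfold opp, Re, Im; simpl; ring).
  apply (is_derive_opp (fun u => Im (T (- u)))).
  apply (is_derive_comp_opp (fun u => Im (T u)) s _ Hd).
- rewrite <- Hu. unfold Re, Im; simpl. ring.
Qed.

Lemma solves_exists (A B x0 y0 : R) :
  A ^ 2 + B ^ 2 <> 0 ->
  exists X T, solves A B X T /\ phase_x A B X T 0 = x0 /\ phase_y A B X T 0 = y0.
Proof.
intros Hn.
(* [c1 + i c2 = (x0 + i y0) / (A - i B)], the position with these phase coordinates when [T = 1] at
   time 0. *)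
set (c1 := (A * x0 - B * y0) / (A ^ 2 + B ^ 2)).
set (c2 := (B * x0 + A * y0) / (A ^ 2 + B ^ 2)).
destruct (tangent_angle_exists A B c1 c2) as [th [Hth0 Hth]].
assert (Hc : forall r, continuous th r).
{ intros r. eapply is_derive_continuous, Hth. }
exists (fun s => (picard_x c1 th s, picard_y c2 th s)), (fun s => expi (th s)).
split; [|split].
- intros s.
  assert (Ek : phase_x A B (fun s => (picard_x c1 th s, picard_y c2 th s))
    (fun s => expi (th s)) s = picard_k A B c1 c2 th s).
  { unfold phase_x, picard_k. rewrite inner_eq, inner_normal_eq. simpl. ring. }
  rewrite Ek. simpl. split; [|split; [|split; [|split]]].
  + now apply picard_x_derive.
  + now apply picard_y_derive.
  + replace (- picard_k A B c1 c2 th s * sin (th s))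
      with (scal (picard_k A B c1 c2 th s) (- sin (th s)))
      by (unfold scal; simpl; unfold mult; simpl; ring).
    apply (is_derive_comp cos th); [apply is_derive_cos|apply Hth].
  + apply (is_derive_comp sin th); [apply is_derive_sin|apply Hth].
  + assert (h := sin2_cos2 (th s)). unfold Rsqr in h. lra.
- unfold phase_x. rewrite inner_eq, inner_normal_eq. simpl.
  rewrite picard_x_0, picard_y_0, Hth0, cos_0, sin_0. unfold c1, c2. field.
  simpl in Hn. lra.
- unfold phase_y. rewrite inner_eq, inner_normal_eq. simpl.
  rewrite picard_x_0, picard_y_0, Hth0, cos_0, sin_0. unfold c1, c2. field.
  simpl in Hn. lra.
Qed.

(** * An escaping orbit by shooting *)

(** Global solutions of the quadratic system are read off from the curves, which are defined on the
    whole line. *)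
Lemma phase_flow_exists (a b x0 y0 : R) :
  a <> 0 -> exists x y, phase_flow a b x y /\ x 0 = x0 /\ y 0 = y0.
Proof.
intros Ha. destruct (solves_exists a (- b) x0 y0) as [X [T [H [Hx Hy]]]].
{ assert (0 < a ^ 2) by (apply pow2_gt_0; easy). assert (h := pow2_ge_0 (- b)). lra. }
exists (phase_x a (- b) X T), (phase_y a (- b) X T). split; [|easy].
apply solves_phase_flow in H. now rewrite Ropp_involutive in H.
Qed.

(** The Gronwall estimate is about squared distances, hence the half exponent in [d]. The rate is
    nondecreasing, so its value at [s] serves the whole interval. Equal ordinates suffice, since the
    shooting starts on a line [y = Y]. *)
Lemma phase_flow_stability (a b s e : R) (x1 y1 : R -> R) :
  phase_flow a b x1 y1 -> 0 < e ->
  exists d, 0 < d /\ forall x2 y2, phase_flow a b x2 y2 ->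
    Rabs (x1 0 - x2 0) < d -> y1 0 = y2 0 ->
    forall r, 0 <= r <= s -> Rabs (x1 r - x2 r) < e.
Proof.
intros H1 He. set (G := gronwall_rate x1 y1).
exists (e * exp (- (G s / 2))).
split; [apply Rmult_lt_0_compat; [easy|apply exp_pos]|].
intros x2 y2 H2 Hd Hy r Hr.
assert (h := phase_flow_dependence a b x1 y1 x2 y2 r H1 H2 (proj1 Hr)).
rewrite Hy, Rminus_diag, pow_i, Rplus_0_r in h by lia. fold G in h.
assert (HG : G r <= G s).
{ assert (G r + 0 * (s - r) <= G s); [|lra].
  apply (growth_ge G (fun r => 2 * Rabs (y1 r) + Rabs (x1 r))); [lra| |].
  - intros q _. now apply (gronwall_rate_derive a b).
  - intros q _. assert (h1 := Rabs_pos (y1 q)). assert (h2 := Rabs_pos (x1 q)). lra. }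
assert (HGe : exp (G r) <= exp (G s)).
{ destruct HG as [HG|HG]; [left; now apply exp_increasing|right; now rewrite HG]. }
assert (E2 : exp (G s) * exp (- (G s / 2)) ^ 2 = 1).
{ simpl. rewrite Rmult_1_r, <- !exp_plus. rewrite <- exp_0. f_equal. field. }
assert (Rabs (x1 0 - x2 0) ^ 2 < (e * exp (- (G s / 2))) ^ 2).
{ assert (p := Rabs_pos (x1 0 - x2 0)). nra. }
rewrite pow2_abs in H.
assert (p1 := exp_pos (G r)). assert (p2 := exp_pos (G s)).
assert ((x1 0 - x2 0) ^ 2 * exp (G r) <= (x1 0 - x2 0) ^ 2 * exp (G s))
  by (apply Rmult_le_compat_l; [apply pow2_ge_0|easy]).
assert ((x1 0 - x2 0) ^ 2 * exp (G s) < (e * exp (- (G s / 2))) ^ 2 * exp (G s))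
  by (apply Rmult_lt_compat_r; easy).
replace ((e * exp (- (G s / 2))) ^ 2 * exp (G s))
  with (e ^ 2 * (exp (G s) * exp (- (G s / 2)) ^ 2)) in H3 by ring.
rewrite E2 in H3. assert (p3 := pow2_ge_0 (y1 r - y2 r)).
assert (H4 : Rabs (x1 r - x2 r) ^ 2 < e ^ 2) by (rewrite pow2_abs; lra).
assert (p4 := Rabs_pos (x1 r - x2 r)). nra.
Qed.

(* Shooting from the segment [0 <= w <= sqrt b / 2] of a line [y = Y], where [Y]
   is so large that [w' > 0] at its right end while [w' < 0] at its left end.
   Starting points leaving through [w < 0] and those leaving through
   [w > sqrt b / 2] form disjoint relatively open sets. *)
Lemma phase_flow_shooting (al b : R) :
  0 < al -> 0 < b ->
  exists w y, phase_flow (- al) b w y /\ (forall s, 0 < w s) /\ w 0 ^ 2 <> b.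
Proof.
intros Hal Hb. set (c := sqrt b / 2).
assert (Hc : 0 < c) by (assert (h := sqrt_lt_R0 b Hb); unfold c; lra).
assert (Hcc : 4 * (c * c) = b).
{ unfold c. assert (h := sqrt_sqrt b). lra. }
(* With this [Y], [w = c] and [y >= Y] give [w' >= c > 0]. *)
set (Y := al / c + 1).
assert (HY : al + c <= c * Y) by (right; unfold Y; field; lra).
assert (HY0 : 0 < Y) by nra.
assert (Hneg : forall w y r, phase_flow (- al) b w y -> w r <= 0 ->
  forall t, r < t -> w t < 0).
{ intros w y r H Hr t Ht.
  assert (0 < - w t); [|lra].
  apply (phase_flow_pos_after al b r (fun s => - w s) y); [easy| |lra|easy].
  rewrite <- (Ropp_involutive al). now apply phase_flow_flip. }
set (P := fun x0 w y => phase_flow (- al) b w y /\ w 0 = x0 /\ y 0 = Y).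
(* Abscissae whose orbit becomes negative while staying strictly below [c] up to that time. On the
   compact interval [[0, s]] both strict inequalities survive a small perturbation, so this
   condition is open. *)
set (U := fun x0 => exists w y, P x0 w y /\
  exists s, 0 <= s /\ w s < 0 /\ forall r, 0 <= r <= s -> w r < c).
assert (Uopen : forall x0, U x0 -> exists d, 0 < d /\
  forall x1, Rabs (x0 - x1) < d -> U x1).
{ intros x0 [w [y [[Hf [Hw0 Hy0]] [s [Hs [Hws Hwc]]]]]].
  destruct (continuity_ab_maj w 0 s Hs) as [m [Hm Hm']].
  { intros r _. exact (is_derive_continuity_pt _ _ _ (proj1 (Hf r))). }
  specialize (Hwc m Hm').
  destruct (phase_flow_stability (- al) b s (Rmin (- w s) (c - w m)) w y Hf)
    as [d [Hd Hd']].
  { apply Rmin_pos; lra. }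
  exists d. split; [easy|]. intros x1 Hx1.
  destruct (phase_flow_exists (- al) b x1 Y) as [w1 [y1 [Hf1 [Hw1 Hy1]]]]; [lra|].
  exists w1, y1. split; [easy|]. exists s.
  assert (D : forall r, 0 <= r <= s -> Rabs (w r - w1 r) < Rmin (- w s) (c - w m)).
  { apply Hd'  with (y2 := y1); [easy|congruence|congruence]. }
  split; [easy|]. split.
  - specialize (D s (conj Hs (Rle_refl s))).
    assert (h := Rmin_l (- w s) (c - w m)). apply Rabs_def2 in D. lra.
  - intros r Hr. specialize (D r Hr). specialize (Hm r Hr).
    assert (h := Rmin_r (- w s) (c - w m)). apply Rabs_def2 in D. lra. }
assert (U0 : U 0).
{ destruct (phase_flow_exists (- al) b 0 Y) as [w [y [Hf [Hw Hy]]]]; [lra|].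
  exists w, y. split; [easy|].
  exists 1. split; [lra|]. split.
  - apply (Hneg w y 0); [easy|lra|lra].
  - intros r Hr. destruct (Req_dec r 0) as [->|h]; [lra|].
    assert (w r < 0) by (apply (Hneg w y 0); [easy|lra|lra]). lra. }
destruct (completeness (fun x0 => 0 <= x0 <= c /\ U x0)) as [x0 [Hub Hlub]].
{ exists c. intros x [Hx _]; lra. }
{ exists 0. split; [lra|easy]. }
assert (Hx0 : 0 <= x0 <= c).
{ split; [apply Hub; split; [lra|easy]|apply Hlub; intros x [Hx _]; lra]. }
destruct (phase_flow_exists (- al) b x0 Y) as [w [y [Hf [Hw Hy]]]]; [lra|].
assert (Hdw : forall r, is_derive w r (- al + w r * y r)) by (intros r; apply Hf).
(* An open condition cannot hold at the supremum, unless [x0 = c]; but [U] asks for [w 0 < c]. *)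
assert (HnU : ~ U x0).
{ intros HU. destruct (Uopen x0 HU) as [d [Hd Hd']].
  destruct HU as [w' [y' [[_ [Hw' _]] [s [Hs [_ Hlt]]]]]].
  assert (x0 < c) by (rewrite <- Hw'; apply Hlt; lra).
  set (x1 := Rmin c (x0 + d / 2)).
  assert (x0 < x1 <= c /\ x1 <= x0 + d / 2) as [? ?] by
    (unfold x1, Rmin; destruct Rle_dec; lra).
  assert (x1 <= x0); [|lra]. apply Hub. split; [lra|]. apply Hd'.
  apply Rabs_def1; lra. }
(* If [w] became negative, it would have reached [c] before, as [x0] is not in [U]. Up to that exit
   time [q] the ordinate increases, so [y q >= Y] and [w] exceeds [c] at some [u > q]. An element of
   [U] close to the supremum [x0] then also exceeds [c] at time [u], whereas its orbit is below [c]
   until it turns negative and is negative from then on. *)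
assert (Hwge : forall s, 0 <= s -> 0 <= w s).
{ intros s Hs. destruct (Rle_or_lt 0 (w s)) as [h|h]; [easy|exfalso].
  assert (exists r, 0 <= r <= s /\ c <= w r) as [r [Hr Hrc]].
  { apply NNPP. intros Hn. apply HnU. exists w, y. split; [easy|].
    exists s. split; [easy|]. split; [easy|].
    intros r Hr. destruct (Rlt_or_le (w r) c) as [h'|h']; [easy|].
    destruct Hn; now exists r. }
  destruct (first_hit w 0 r c) as [q [Hq [Eq Hlt]]]; try lra.
  { intros u. eapply is_derive_continuity_pt, Hdw. }
  assert (Hpos : forall u, 0 <= u <= q -> 0 < w u).
  { intros u Hu. destruct (Rlt_or_le 0 (w u)) as [h'|h']; [easy|exfalso].
    destruct (Req_dec u q) as [->|Hn]; [lra|].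
    assert (w q < 0) by (apply (Hneg w y u); [easy|easy|lra]). lra. }
  assert (Hyq : Y <= y q).
  { assert (y 0 + 0 * (q - 0) <= y q); [|lra].
    apply (growth_ge y (fun u => b - w u ^ 2)); [lra|intros u _; apply Hf|].
    intros u Hu. specialize (Hpos u Hu). specialize (Hlt u Hu). nra. }
  destruct (is_derive_pos_local w q (- al + w q * y q) (Hdw q)) as [d [Hd Hd']].
  { rewrite Eq. nra. }
  set (u := q + d / 2).
  assert (Hu : c < w u) by (rewrite <- Eq; apply Hd'; lra).
  destruct (phase_flow_stability (- al) b u (w u - c) w y Hf) as [d' [Hd1 Hd2]]; [lra|].
  destruct (classic (exists x1, x0 - d' < x1 /\ 0 <= x1 <= c /\ U x1))
    as [[x1 [Hx1 [Hx1' HU1]]]|Hn].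
  - assert (x1 <= x0) by now apply Hub.
    destruct HU1 as [w1 [y1 [[Hf1 [Hw1 Hy1]] [t [Ht [Hwt Hlt1]]]]]].
    assert (h1 : Rabs (w u - w1 u) < w u - c).
    { apply (Hd2 w1 y1); [easy|rewrite Hw, Hw1; apply Rabs_def1; lra|congruence|].
      unfold u; lra. }
    apply Rabs_def2 in h1. destruct (Rle_or_lt u t) as [h2|h2].
    + assert (w1 u < c) by (apply Hlt1; unfold u in *; lra). lra.
    + assert (w1 u < 0) by (apply (Hneg w1 y1 t); [easy|lra|easy]). lra.
  - assert (x0 <= x0 - d'); [|lra]. apply Hlub. intros x1 [Hx1 HU1].
    destruct (Rle_or_lt x1 (x0 - d')) as [h'|h']; [easy|].
    destruct Hn; now exists x1. }
assert (Hpos : forall s, 0 <= s -> 0 < w s).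
{ intros s Hs. destruct (Rle_lt_or_eq_dec _ _ (Hwge s Hs)) as [h|h]; [easy|exfalso].
  assert (w (s + 1) < 0) by (apply (Hneg w y s); [easy|lra|lra]).
  assert (0 <= w (s + 1)) by (apply Hwge; lra). lra. }
exists w, y. split; [easy|]. split.
- intros s. destruct (Rle_or_lt 0 s) as [h|h]; [auto|].
  destruct (Rlt_or_le 0 (w s)) as [h'|h']; [easy|exfalso].
  assert (w 0 < 0) by now apply (Hneg w y s).
  specialize (Hpos 0 (Rle_refl 0)). lra.
- assert (h := Hpos 0 (Rle_refl 0)). nra.
Qed.

(** * Polar angle *)

Lemma unit_angle (c d : R) : c ^ 2 + d ^ 2 = 1 -> exists th, cos th = c /\ sin th = d.
Proof.
intros H.
assert (Hc : -1 <= c <= 1) by nra.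
assert (Hs : sin (acos c) = sqrt (d ^ 2)).
{ rewrite sin_acos by easy. f_equal. unfold Rsqr. lra. }
assert (Hd : sqrt (d ^ 2) = Rabs d) by (rewrite <- Rsqr_pow2; apply sqrt_Rsqr_abs).
destruct (Rle_or_lt 0 d) as [h|h].
- exists (acos c). rewrite cos_acos, Hs, Hd, Rabs_pos_eq by easy. easy.
- exists (- acos c). rewrite cos_neg, sin_neg, cos_acos, Hs, Hd, Rabs_left by easy.
  split; ring.
Qed.

Lemma polar_form (z : C) : exists th, z = (RtoC (Cmod z) * expi th)%C.
Proof.
destruct (Req_dec (Cmod z) 0) as [h|h].
- exists 0. apply Cmod_eq_0 in h. subst z. rewrite Cmod_0. ring.
- destruct (unit_angle (Re z / Cmod z) (Im z / Cmod z)) as [th [H1 H2]].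
  + replace ((Re z / Cmod z) ^ 2 + (Im z / Cmod z) ^ 2) with
      ((Re z ^ 2 + Im z ^ 2) / Cmod z ^ 2) by (field; easy).
    rewrite <- Cmod_sqr. field; easy.
  + exists th. apply C_eq; unfold expi; rewrite H1, H2; simpl; field; easy.
Qed.

(* The complex form of [phase_x = A tau + B nu], [phase_y = - B tau + A nu]
   and [X = (tau + i nu) T]. *)
Lemma phase_position (A B : R) (X T : R -> C) (s : R) :
  solves A B X T ->
  ((RtoC A - Ci * RtoC B) * X s)%C = ((phase_x A B X T s, phase_y A B X T s) * T s)%C.
Proof.
intros H. destruct (H s) as [_ [_ [_ [_ Hu]]]].
unfold phase_x, phase_y. rewrite inner_eq, inner_normal_eq.
apply C_eq; unfold Re, Im in *; simpl in *.
- transitivity ((A * fst (X s) + B * snd (X s)) * 1); [ring|rewrite <- Hu; ring].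
- transitivity ((A * snd (X s) - B * fst (X s)) * 1); [ring|rewrite <- Hu; ring].
Qed.

Lemma sqr_sum_pos (A B : R) : A <> 0 -> 0 < A ^ 2 + B ^ 2.
Proof. intros H. assert (h := pow2_gt_0 A H). assert (h' := pow2_ge_0 B). lra. Qed.

Lemma phase_norm (A B : R) (X T : R -> C) (s : R) :
  solves A B X T ->
  (A ^ 2 + B ^ 2) * Cmod (X s) ^ 2 = phase_x A B X T s ^ 2 + phase_y A B X T s ^ 2.
Proof.
intros H. destruct (H s) as [_ [_ [_ [_ Hu]]]]. rewrite Cmod_sqr.
replace (Re (X s) ^ 2 + Im (X s) ^ 2) with
  ((Re (X s) ^ 2 + Im (X s) ^ 2) * (Re (T s) ^ 2 + Im (T s) ^ 2)) by (rewrite Hu; ring).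
unfold phase_x, phase_y. rewrite inner_eq, inner_normal_eq. ring.
Qed.

Lemma is_derive_zero_eq (f : R -> R) (s t : R) :
  s <= t -> (forall r, s <= r <= t -> is_derive f r 0) -> f t = f s.
Proof.
intros Hst H. destruct (mean_value f (fun _ => 0) s t Hst H) as [c [_ E]]. lra.
Qed.

Lemma is_derive_zero_const (f : R -> R) :
  (forall r, is_derive f r 0) -> forall s t, f s = f t.
Proof.
intros H s t. destruct (Rle_or_lt s t) as [h|h].
- symmetry. now apply is_derive_zero_eq.
- apply is_derive_zero_eq; [lra|easy].
Qed.

Lemma Cmod_derive (X T : R -> C) (k : R -> R) (s : R) :
  frame X T k -> X s <> 0%C ->
  is_derive (fun u => Cmod (X u)) s (inner (X s) (T s) / Cmod (X s)).
Proof.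
intros H Hn. destruct (H s) as [Ha [Hb _]].
assert (HN : is_derive (fun u => Re (X u) * Re (X u) + Im (X u) * Im (X u)) s
  (2 * inner (X s) (T s))).
{ rewrite inner_eq.
  replace (2 * (Re (X s) * Re (T s) + Im (X s) * Im (T s))) with
    (Re (T s) * Re (X s) + Re (X s) * Re (T s) + (Im (T s) * Im (X s) + Im (X s) * Im (T s)))
    by ring.
  apply (is_derive_plus (fun u => Re (X u) * Re (X u)) (fun u => Im (X u) * Im (X u)));
    now apply is_derive_product. }
assert (Hp : 0 < Cmod (X s)) by now apply Cmod_gt_0.
apply is_derive_ext with (fun u => sqrt (Re (X u) * Re (X u) + Im (X u) * Im (X u))).
{ intros u. unfold Cmod. f_equal. unfold Re, Im. ring. }
assert (E : sqrt (Re (X s) * Re (X s) + Im (X s) * Im (X s)) = Cmod (X s)).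
{ unfold Cmod. f_equal. unfold Re, Im. ring. }
replace (inner (X s) (T s) / Cmod (X s)) with
  (2 * inner (X s) (T s) / (2 * sqrt (Re (X s) * Re (X s) + Im (X s) * Im (X s))))
  by (rewrite E; field; lra).
apply (is_derive_sqrt (fun u => Re (X u) * Re (X u) + Im (X u) * Im (X u))); [easy|].
destruct (Rlt_or_le 0 (Re (X s) * Re (X s) + Im (X s) * Im (X s))) as [h|h]; [easy|].
rewrite sqrt_neg_0 in E by easy. lra.
Qed.

(** The angle is the integral of the angular speed [- <X,N> / |X|^2], expressed in phase coordinates
    by [(A^2 + B^2) <X,N> = B x + A y] and [(A^2 + B^2) |X|^2 = x^2 + y^2]. That it is a polar angle
    is checked afterwards. The bound [m] keeps the curve away from the origin. *)
Lemma polar_angle_exists (A B m s0 : R) (X T : R -> C) :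
  A <> 0 -> solves A B X T -> 0 < m -> (forall s, s0 <= s -> m <= Cmod (X s) ^ 2) ->
  exists th, polar_angle X th /\ forall s, s0 <= s -> is_derive th s
    (- (B * phase_x A B X T s + A * phase_y A B X T s)
     / (phase_x A B X T s ^ 2 + phase_y A B X T s ^ 2)).
Proof.
intros HA H Hm HX.
set (x := phase_x A B X T). set (y := phase_y A B X T).
set (L := A ^ 2 + B ^ 2). assert (HL : 0 < L) by now apply sqr_sum_pos.
assert (Hxy := solves_phase_flow A B X T H). fold x y in Hxy.
assert (HN : forall s, L * Cmod (X s) ^ 2 = x s ^ 2 + y s ^ 2)
  by (intros s; now apply phase_norm).
(* Equal to the angular speed on [s0, +oo), but continuous everywhere. *)
set (h := fun s => - (B * x s + A * y s) / (Rabs (x s ^ 2 + y s ^ 2 - L * m) + L * m)).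
assert (Hden : forall s, 0 < Rabs (x s ^ 2 + y s ^ 2 - L * m) + L * m).
{ intros s. assert (p := Rabs_pos (x s ^ 2 + y s ^ 2 - L * m)). nra. }
assert (Hhc : forall s, continuous h s).
{ intros s. destruct (Hxy s) as [Hx Hy].
  assert (D : is_derive (fun u => x u ^ 2 + y u ^ 2 - L * m) s
    (2 * x s * (A + x s * y s) + 2 * y s * (- B - x s ^ 2))).
  { auto_derive; [repeat split; eexists; eassumption|].
    rewrite_derive Hx. rewrite_derive Hy. ring. }
  assert (D' : is_derive (fun u => - (B * x u + A * y u)) s
    (- (B * (A + x s * y s) + A * (- B - x s ^ 2)))).
  { auto_derive; [repeat split; eexists; eassumption|].
    rewrite_derive Hx. rewrite_derive Hy. ring. }
  apply (@continuous_mult R_UniformSpace R_AbsRing).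
  - exact (is_derive_continuous _ _ _ D').
  - apply (@continuous_comp R_UniformSpace R_UniformSpace R_UniformSpace
      (fun s => Rabs (x s ^ 2 + y s ^ 2 - L * m) + L * m) Rinv).
    + apply (@continuous_plus R_UniformSpace R_AbsRing R_NormedModule);
        [|apply continuous_const].
      apply continuous_Rabs_comp. exact (is_derive_continuous _ _ _ D).
    + apply continuous_Rinv. specialize (Hden s). lra. }
assert (Hh : forall s, s0 <= s -> h s = - inner (X s) (Ci * T s)%C / Cmod (X s) ^ 2).
{ intros s Hs. specialize (HX s Hs). unfold h.
  rewrite Rabs_pos_eq by (rewrite <- HN; nra).
  replace (x s ^ 2 + y s ^ 2 - L * m + L * m) with (L * Cmod (X s) ^ 2) by (rewrite HN; ring).
  replace (B * x s + A * y s) with (L * inner (X s) (Ci * T s)%C)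
    by (unfold x, y, phase_x, phase_y, L; ring).
  field. split; [intros E; rewrite E in HX; simpl in HX|]; lra. }
destruct (polar_form (X s0)) as [th0 Hth0].
set (th := fun s => th0 + RInt h s0 s).
assert (Hth : forall s, is_derive th s (h s)).
{ intros s. unfold th. rewrite <- (Rplus_0_l (h s)).
  apply (is_derive_plus (fun _ => th0) (fun s => RInt h s0 s)).
  - apply (is_derive_const (V := R_NormedModule)).
  - now apply is_derive_RInt_continuous. }
assert (Hth0' : th s0 = th0).
{ unfold th. rewrite RInt_point. apply Rplus_0_r. }
exists th. split.
- exists s0. intros s Hs.
  assert (HXn : forall r, s0 <= r -> X r <> 0%C).
  { intros r Hr E. specialize (HX r Hr). rewrite E, Cmod_0 in HX. simpl in HX. lra. }
  split; [apply HXn; lra|]. split; [exact (is_derive_continuous _ _ _ (Hth s))|].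
  (* The components of [X e^(- i th) / |X|] are constant. *)
  set (q1 := fun r => (Re (X r) * cos (th r) + Im (X r) * sin (th r)) / Cmod (X r)).
  set (q2 := fun r => (Im (X r) * cos (th r) - Re (X r) * sin (th r)) / Cmod (X r)).
  assert (D : forall r, s0 <= r -> is_derive q1 r 0 /\ is_derive q2 r 0).
  { intros r Hr. destruct (H r) as [Ha [Hb [_ [_ Hu]]]].
    assert (HM := Cmod_derive X T _ r H (HXn r Hr)).
    assert (HMp : 0 < Cmod (X r)) by now apply Cmod_gt_0, HXn.
    assert (HM2 := Cmod_sqr (X r)).
    assert (Hr' := Hth r). rewrite Hh in Hr' by easy.
    set (t := inner (X r) (T r)) in *. set (n := inner (X r) (Ci * T r)%C) in *.
    assert (Et : t = Re (X r) * Re (T r) + Im (X r) * Im (T r)) by apply inner_eq.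
    assert (En : n = Im (X r) * Re (T r) - Re (X r) * Im (T r)) by apply inner_normal_eq.
    assert (Dc : is_derive (fun r => cos (th r)) r (- n / Cmod (X r) ^ 2 * - sin (th r))).
    { apply (is_derive_comp cos th); [apply is_derive_cos|exact Hr']. }
    assert (Ds : is_derive (fun r => sin (th r)) r (- n / Cmod (X r) ^ 2 * cos (th r))).
    { apply (is_derive_comp sin th); [apply is_derive_sin|exact Hr']. }
    assert (Q : forall (f : R -> R) (df : R), is_derive f r df -> df * Cmod (X r) ^ 2 = f r * t ->
      is_derive (fun u => f u / Cmod (X u)) r 0).
    { intros f df Hf E. replace 0 with ((df * Cmod (X r) - f r * (t / Cmod (X r))) / Cmod (X r) ^ 2).
      - apply (is_derive_div f (fun u => Cmod (X u))); [easy|easy|lra].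
      - replace (df * Cmod (X r) - f r * (t / Cmod (X r))) with
          ((df * Cmod (X r) ^ 2 - f r * t) / Cmod (X r)) by (field; lra).
        rewrite E. field. lra. }
    split.
    - apply (Q (fun r => Re (X r) * cos (th r) + Im (X r) * sin (th r))
        (Re (T r) * cos (th r) + Re (X r) * (- n / Cmod (X r) ^ 2 * - sin (th r))
         + (Im (T r) * sin (th r) + Im (X r) * (- n / Cmod (X r) ^ 2 * cos (th r))))).
      + apply (is_derive_plus (fun r => Re (X r) * cos (th r)) (fun r => Im (X r) * sin (th r))).
        * now apply (is_derive_product (fun r => Re (X r)) (fun r => cos (th r))).
        * now apply (is_derive_product (fun r => Im (X r)) (fun r => sin (th r))).
      + transitivity ((Re (T r) * cos (th r) + Im (T r) * sin (th r)) * Cmod (X r) ^ 2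
          - n * (Im (X r) * cos (th r) - Re (X r) * sin (th r))).
        * field. lra.
        * rewrite HM2, Et, En. ring.
    - apply (Q (fun r => Im (X r) * cos (th r) - Re (X r) * sin (th r))
        (Im (T r) * cos (th r) + Im (X r) * (- n / Cmod (X r) ^ 2 * - sin (th r))
         - (Re (T r) * sin (th r) + Re (X r) * (- n / Cmod (X r) ^ 2 * cos (th r))))).
      + apply (is_derive_minus (fun r => Im (X r) * cos (th r)) (fun r => Re (X r) * sin (th r))).
        * now apply (is_derive_product (fun r => Im (X r)) (fun r => cos (th r))).
        * now apply (is_derive_product (fun r => Re (X r)) (fun r => sin (th r))).
      + transitivity ((Im (T r) * cos (th r) - Re (T r) * sin (th r)) * Cmod (X r) ^ 2
          + n * (Re (X r) * cos (th r) + Im (X r) * sin (th r))).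
        * field. lra.
        * rewrite HM2, Et, En. ring. }
  assert (HM0 : 0 < Cmod (X s0)) by (apply Cmod_gt_0, HXn; lra).
  assert (HMs : 0 < Cmod (X s)) by (apply Cmod_gt_0, HXn; lra).
  assert (R0 : Re (X s0) = Cmod (X s0) * cos th0).
  { rewrite Hth0 at 1. simpl. ring. }
  assert (I0 : Im (X s0) = Cmod (X s0) * sin th0).
  { rewrite Hth0 at 1. simpl. ring. }
  assert (sc := sin2_cos2 th0). unfold Rsqr in sc.
  assert (E1 : q1 s = 1).
  { rewrite (is_derive_zero_eq q1 s0 s); [|lra|intros r Hr; apply D; lra].
    unfold q1. rewrite Hth0', R0, I0.
    replace (Cmod (X s0) * cos th0 * cos th0 + Cmod (X s0) * sin th0 * sin th0)
      with (Cmod (X s0) * (sin th0 * sin th0 + cos th0 * cos th0)) by ring.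
    rewrite sc. field. lra. }
  assert (E2 : q2 s = 0).
  { rewrite (is_derive_zero_eq q2 s0 s); [|lra|intros r Hr; apply D; lra].
    unfold q2. rewrite Hth0', R0, I0. field. lra. }
  assert (F1 : Re (X s) * cos (th s) + Im (X s) * sin (th s) = Cmod (X s)).
  { rewrite <- (Rmult_1_r (Cmod (X s))), <- E1. unfold q1. field. lra. }
  assert (F2 : Im (X s) * cos (th s) - Re (X s) * sin (th s) = 0).
  { rewrite <- (Rmult_0_r (Cmod (X s))), <- E2. unfold q2. field. lra. }
  assert (sc' := sin2_cos2 (th s)). unfold Rsqr in sc'.
  apply C_eq.
  + transitivity (Cmod (X s) * cos (th s)); [|simpl; ring].
    rewrite <- F1 at 1.
    transitivity (Re (X s) * (sin (th s) * sin (th s) + cos (th s) * cos (th s))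
      + sin (th s) * (Im (X s) * cos (th s) - Re (X s) * sin (th s))); [|ring].
    rewrite sc', F2. ring.
  + transitivity (Cmod (X s) * sin (th s)); [|simpl; ring].
    rewrite <- F1 at 1.
    transitivity (Im (X s) * (sin (th s) * sin (th s) + cos (th s) * cos (th s))
      - cos (th s) * (Im (X s) * cos (th s) - Re (X s) * sin (th s))); [|ring].
    rewrite sc', F2. ring.
- intros s Hs. assert (E := Hth s). unfold h in E. specialize (HX s Hs).
  rewrite Rabs_pos_eq in E by (rewrite <- HN; nra).
  replace (x s ^ 2 + y s ^ 2 - L * m + L * m) with (x s ^ 2 + y s ^ 2) in E by ring.
  exact E.
Qed.

(** * Behaviour of the ends *)

Lemma linear_divergence (f df : R -> R) (m s0 : R) :
  0 < m -> (forall s, s0 <= s -> is_derive f s (df s)) ->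
  (forall s, s0 <= s -> m <= df s) -> is_lim f p_infty p_infty.
Proof.
intros Hm Hf Hd. apply is_lim_p_p. intros M.
exists (Rmax s0 (s0 + (M - f s0) / m + 1)). intros s Hs.
assert (h1 : s0 <= s) by (eapply Rle_trans; [apply Rmax_l|apply Hs]).
assert (h2 : s0 + (M - f s0) / m + 1 <= s) by (eapply Rle_trans; [apply Rmax_r|apply Hs]).
assert (h3 : f s0 + m * (s - s0) <= f s).
{ apply (growth_ge f df); [easy| |]; intros r Hr; [apply Hf|apply Hd]; lra. }
assert ((M - f s0) / m * m = M - f s0) by (field; lra). nra.
Qed.

Lemma is_lim_opp_m (f : R -> R) :
  is_lim (fun s => - f s) p_infty p_infty -> is_lim f p_infty m_infty.
Proof.
intros H. apply is_lim_ext with (fun s => - - f s); [intros; ring|].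
now apply (is_lim_opp (fun s => - f s) p_infty p_infty).
Qed.

Lemma is_lim_lower (f : R -> R) (l m : R) :
  is_lim f p_infty l -> m < l -> exists S, forall s, S <= s -> m < f s.
Proof.
intros H Hm. destruct (proj2 (is_lim_p_R f l) H (l - m)) as [S HS]; [lra|].
exists S. intros s Hs. specialize (HS s Hs). apply Rabs_def2 in HS. lra.
Qed.

Lemma is_lim_mult_p (f g : R -> R) (l m : R) :
  is_lim f p_infty l -> is_lim g p_infty m -> is_lim (fun s => f s * g s) p_infty (l * m).
Proof. intros Hf Hg. now apply (is_lim_mult f g p_infty l m). Qed.

Lemma is_lim_sqr_p (f : R -> R) (l : R) :
  is_lim f p_infty l -> is_lim (fun s => f s ^ 2) p_infty (l ^ 2).
Proof.
intros H. apply is_lim_ext with (fun s => f s * f s); [intros; ring|].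
replace (l ^ 2) with (l * l) by ring.
now apply is_lim_mult_p.
Qed.

Lemma is_lim_scal_p (f : R -> R) (c l : R) :
  is_lim f p_infty l -> is_lim (fun s => c * f s) p_infty (c * l).
Proof. intros H. now apply (is_lim_scal_l f c p_infty (Finite l)). Qed.

(** [ep] is the sign of [A] as a number: passing to [ep x] turns [A] into [|A|] and treats both
    signs at once. *)
Definition orientation (A ep : R) : Prop := (ep = 1 \/ ep = -1) /\ 0 < ep * A.

Lemma orientation_exists (A : R) : A <> 0 -> exists ep, orientation A ep.
Proof.
intros H. destruct (Rlt_or_le 0 A) as [h|h].
- exists 1. split; [now left|lra].
- exists (-1). split; [now right|lra].
Qed.

Lemma orientation_sqr (A ep : R) : orientation A ep -> ep * ep = 1.
Proof. intros [[->| ->] _]; ring. Qed.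

Lemma wraps_of_polar_angle (A ep rho : R) (X : R -> C) (th : R -> R) :
  orientation A ep -> is_lim (fun s => Cmod (X s)) p_infty rho ->
  polar_angle X th -> is_lim (fun s => ep * th s) p_infty p_infty ->
  wraps A rho X.
Proof.
intros [[->| ->] HA] HX Hth Hl; split; intros h; try lra; split; try easy;
  exists th; split; try easy.
- apply is_lim_ext with (2 := Hl). intros; ring.
- apply is_lim_opp_m. apply is_lim_ext with (2 := Hl). intros; ring.
Qed.

(** At the equilibrium, with [c = sqrt (- B)] and [L = A^2 + B^2], one has [x^2 + y^2 = L / c^2],
    that is [|X| = 1 / c], and the angular speed is [ep c]. The angle therefore diverges linearly in
    the sense given by the sign of [A]. *)
Lemma wraps_of_limit (A B ep : R) (X T : R -> C) :
  orientation A ep -> B < 0 -> solves A B X T ->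
  is_lim (phase_x A B X T) p_infty (ep * sqrt (- B)) ->
  is_lim (phase_y A B X T) p_infty (- (ep * A) / sqrt (- B)) ->
  wraps A (1 / sqrt (- B)) X.
Proof.
intros Hep HB H Hx Hy.
assert (Hee := orientation_sqr A ep Hep).
assert (HA : A <> 0) by (intros ->; destruct Hep; lra).
set (c := sqrt (- B)) in *.
assert (Hc : 0 < c) by (apply sqrt_lt_R0; lra).
assert (Hcc : c * c = - B) by (apply sqrt_sqrt; lra).
set (L := A ^ 2 + B ^ 2). assert (HL : 0 < L) by now apply sqr_sum_pos.
set (x := phase_x A B X T) in *. set (y := phase_y A B X T) in *.
assert (HN : forall s, L * Cmod (X s) ^ 2 = x s ^ 2 + y s ^ 2)
  by (intros s; now apply phase_norm).
assert (Hxy : is_lim (fun s => x s ^ 2 + y s ^ 2) p_infty (L / c ^ 2)).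
{ replace (L / c ^ 2) with ((ep * c) ^ 2 + (- (ep * A) / c) ^ 2).
  - apply is_lim_plus'; now apply is_lim_sqr_p.
  - replace ((ep * c) ^ 2) with (ep * ep * c ^ 2) by ring.
    replace ((- (ep * A) / c) ^ 2) with (ep * ep * (A ^ 2 / c ^ 2)) by (field; lra).
    rewrite Hee. unfold L. replace B with (- (c * c)) by lra. field. lra. }
assert (HN' : is_lim (fun s => Cmod (X s) ^ 2) p_infty ((1 / c) ^ 2)).
{ replace ((1 / c) ^ 2) with (/ L * (L / c ^ 2)) by (field; lra).
  apply is_lim_ext with (fun s => / L * (x s ^ 2 + y s ^ 2)).
  - intros s. rewrite <- HN. field. lra.
  - now apply is_lim_scal_p. }
assert (Hr : 0 < 1 / c) by (apply Rdiv_lt_0_compat; lra).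
assert (Hr2 := pow_lt _ 2 Hr).
assert (HX : is_lim (fun s => Cmod (X s)) p_infty (1 / c)).
{ apply is_lim_ext with (fun s => sqrt (Cmod (X s) ^ 2)).
  - intros s. rewrite <- Rsqr_pow2. apply sqrt_Rsqr, Cmod_ge_0.
  - rewrite <- (sqrt_Rsqr (1 / c)) by lra. rewrite Rsqr_pow2.
    now apply (is_lim_comp_continuous (fun s => Cmod (X s) ^ 2) sqrt), continuous_sqrt. }
destruct (is_lim_lower _ _ ((1 / c) ^ 2 / 2) HN') as [s0 Hs0]; [lra|].
destruct (polar_angle_exists A B ((1 / c) ^ 2 / 2) s0 X T) as [th [Hth Hd]]; try easy.
{ lra. }
{ intros s Hs. left; now apply Hs0. }
fold x y in Hd.
set (v := fun s => - (B * x s + A * y s) / (x s ^ 2 + y s ^ 2)) in *.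
assert (Hv : is_lim (fun s => ep * v s) p_infty c).
{ apply is_lim_ext with (fun s => (- ep * B * x s + - ep * A * y s) * / (x s ^ 2 + y s ^ 2)).
  { intros s. unfold v, Rdiv. ring. }
  replace c with ((- ep * B * (ep * c) + - ep * A * (- (ep * A) / c)) * / (L / c ^ 2)).
  - apply is_lim_mult_p.
    + apply is_lim_plus'; now apply is_lim_scal_p.
    + apply (is_lim_inv _ p_infty (Finite (L / c ^ 2))); [easy|].
      intros E. apply (f_equal real) in E. unfold real in E.
      assert (0 < L / c ^ 2) by (apply Rdiv_lt_0_compat; [easy|now apply pow_lt]). lra.
  - replace (- ep * B * (ep * c) + - ep * A * (- (ep * A) / c))
      with (ep * ep * (- B * c + A ^ 2 / c)) by (field; lra).
    rewrite Hee. replace (- B * c + A ^ 2 / c) with (L / c).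
    + field. lra.
    + unfold L. replace B with (- (c * c)) by lra. field. lra. }
destruct (is_lim_lower _ _ (c / 2) Hv) as [s1 Hs1]; [lra|].
apply (wraps_of_polar_angle A ep (1 / c) X th); try easy.
apply (linear_divergence _ (fun s => ep * v s) (c / 2) (Rmax s0 s1)); [lra| |].
- intros s Hs. apply (is_derive_scal th), Hd. eapply Rle_trans; [apply Rmax_l|apply Hs].
- intros s Hs. left. apply Hs1. eapply Rle_trans; [apply Rmax_r|apply Hs].
Qed.

Lemma filterlim_C (f : R -> C) (z : C) :
  is_lim (fun s => Re (f s)) p_infty (Re z) -> is_lim (fun s => Im (f s)) p_infty (Im z) ->
  filterlim f (Rbar_locally p_infty) (locally z).
Proof.
intros H1 H2. apply filterlim_locally. intros e.
apply is_lim_spec in H1. apply is_lim_spec in H2.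
apply filter_imp with (2 := filter_and _ _ (H1 e) (H2 e)).
intros s [h1 h2]. split; assumption.
Qed.

(** [phase_position] gives [T / X = (A - i B) / (x + i y)], and [|X| = r / sqrt (A^2 + B^2)]; the
    inverse of [x + i y] is its conjugate over [r^2]. *)
Lemma growth_direction (A B : R) (X T : R -> C) (s : R) :
  A <> 0 -> solves A B X T ->
  let r := sqrt (phase_x A B X T s ^ 2 + phase_y A B X T s ^ 2) in
  0 < r ->
  (RtoC (Cmod (X s)) * tangent X s / X s)%C =
  ((RtoC A - Ci * RtoC B) * (phase_x A B X T s / r, - (phase_y A B X T s / r))%R
   / RtoC (sqrt (A ^ 2 + B ^ 2)))%C.
Proof.
intros HA H r Hr. rewrite (frame_tangent _ _ _ s H).
assert (HP := phase_position A B X T s H). assert (HN := phase_norm A B X T s H).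
set (x := phase_x A B X T s) in *. set (y := phase_y A B X T s) in *.
set (L := sqrt (A ^ 2 + B ^ 2)).
assert (HL : 0 < L) by (now apply sqrt_lt_R0, sqr_sum_pos).
assert (HLL : L * L = A ^ 2 + B ^ 2) by (apply sqrt_sqrt; left; now apply sqr_sum_pos).
assert (Hxy := sqr_sum_pos). assert (px := pow2_ge_0 x). assert (py := pow2_ge_0 y).
assert (Hrr : r * r = x ^ 2 + y ^ 2) by (apply sqrt_sqrt; lra).
assert (HC : L * Cmod (X s) = r).
{ apply Rsqr_inj; [apply Rmult_le_pos; [lra|apply Cmod_ge_0]|lra|].
  unfold Rsqr. rewrite Hrr, <- HN, <- HLL. ring. }
assert (HX : X s <> 0%C).
{ intros E. rewrite E, Cmod_0 in HC. lra. }
assert (HLC : RtoC L <> 0%C) by (intros E; injection E; lra).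
assert (HrC : RtoC r <> 0%C) by (intros E; injection E; lra).
assert (Hz : ((x / r, - (y / r))%R * (x, y) = RtoC r)%C).
{ apply C_eq; simpl.
  - transitivity ((x ^ 2 + y ^ 2) / r); [field; lra|]. rewrite <- Hrr. field. lra.
  - field. lra. }
assert (E : (RtoC (Cmod (X s)) * T s =
  (RtoC A - Ci * RtoC B) * (x / r, - (y / r))%R / RtoC L * X s)%C).
{ transitivity ((x / r, - (y / r))%R * ((RtoC A - Ci * RtoC B) * X s) / RtoC L)%C;
    [|field; easy].
  rewrite HP.
  transitivity ((x / r, - (y / r))%R * (x, y) * T s / RtoC L)%C; [|field; easy].
  rewrite Hz, <- HC, RtoC_mult. field. easy. }
rewrite E. field. easy.
Qed.

(** As [y' <= - B], [y] grows at most linearly, so the curvature, at least [al / (2 y)] in absolute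
    value, is bounded below by a multiple of [1 / (s + const)]. Since [w < 1 < y] eventually gives
    [w^2 + y^2 <= 2 y^2], the angular speed has the same lower bound. Both integrals then diverge
    logarithmically. *)
Lemma spirals_out_of_escape (A B ep : R) (X T : R -> C) :
  orientation A ep -> B < 0 -> solves A B X T ->
  (forall s, 0 < - ep * phase_x A B X T s) ->
  is_lim (phase_y A B X T) p_infty p_infty ->
  is_lim (fun s => - ep * phase_x A B X T s) p_infty 0 ->
  (exists S, forall s, S <= s ->
     ep * A / 2 <= - ep * phase_x A B X T s * phase_y A B X T s) ->
  spirals_out A B X.
Proof.
intros Hep HB H Hpos Hy Hw [S0 HS0].
assert (Hee := orientation_sqr A ep Hep).
assert (HA : A <> 0) by (intros ->; destruct Hep; lra).
set (L := A ^ 2 + B ^ 2). assert (HL : 0 < L) by now apply sqr_sum_pos.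
assert (Hxy := solves_phase_flow A B X T H).
assert (Hk : forall s, curvature X s = phase_x A B X T s)
  by (intros s; now apply solves_curvature).
set (x := phase_x A B X T) in *. set (y := phase_y A B X T) in *.
assert (HN : forall s, L * Cmod (X s) ^ 2 = x s ^ 2 + y s ^ 2)
  by (intros s; now apply phase_norm).
set (al := ep * A) in *. assert (Hal : 0 < al) by apply Hep.
set (w := fun s => - ep * x s) in *.
assert (Hxw : forall s, x s = - ep * w s).
{ intros s. unfold w. transitivity (ep * ep * x s); [rewrite Hee; ring|ring]. }
assert (Hx2 : forall s, x s ^ 2 = w s ^ 2).
{ intros s. unfold w. transitivity (ep * ep * x s ^ 2); [rewrite Hee; ring|ring]. }
assert (Hx0 : is_lim x p_infty 0).
{ apply is_lim_ext with (fun s => - ep * w s); [intros; now rewrite Hxw|].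
  replace (Finite 0) with (Finite (- ep * 0)) by (f_equal; ring).
  now apply is_lim_scal_p. }
assert (Hyb : forall s, 0 <= s -> y s <= y 0 + - B * s).
{ intros s Hs. assert (y s <= y 0 + - B * (s - 0)); [|lra].
  apply (growth_le y (fun r => - B - x r ^ 2)); [easy|intros r _; apply Hxy|].
  intros r _. assert (p := pow2_ge_0 (x r)). lra. }
destruct (proj2 (is_lim_p_p y) Hy 1) as [S1 HS1].
destruct (proj2 (is_lim_p_R _ 0) Hw 1) as [S2 HS2]; [lra|].
set (D := Rabs (y 0) + 1).
assert (HD : 0 < D /\ y 0 <= D).
{ unfold D. assert (p := Rabs_pos (y 0)). assert (p' := Rle_abs (y 0)). lra. }
set (S := Rmax 0 (Rmax S0 (Rmax S1 S2))).
assert (HS : forall s, S <= s -> 0 <= s /\ al / 2 <= w s * y s /\ 1 < y s /\ w s < 1 /\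
  al / (2 * - B) / (s + D / - B) <= al / 2 / y s).
{ intros s Hs. unfold S in Hs.
  assert (h0 : 0 <= s) by (eapply Rle_trans; [apply Rmax_l|exact Hs]).
  assert (Hs' : Rmax S0 (Rmax S1 S2) <= s) by (eapply Rle_trans; [apply Rmax_r|exact Hs]).
  assert (h1 : S0 <= s) by (eapply Rle_trans; [apply Rmax_l|exact Hs']).
  assert (Hs'' : Rmax S1 S2 <= s) by (eapply Rle_trans; [apply Rmax_r|exact Hs']).
  assert (h2 : S1 <= s) by (eapply Rle_trans; [apply Rmax_l|exact Hs'']).
  assert (h3 : S2 <= s) by (eapply Rle_trans; [apply Rmax_r|exact Hs'']).
  specialize (HS0 s h1). specialize (HS1 s h2). specialize (HS2 s h3).
  rewrite Rminus_0_r in HS2. apply Rabs_def2 in HS2. specialize (Hyb s h0).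
  repeat split; try lra; try easy.
  assert (0 <= - B * s) by (apply Rmult_le_pos; lra).
  replace (al / (2 * - B) / (s + D / - B)) with (al / 2 / (D + - B * s)) by (field; lra).
  apply Rmult_le_compat_l; [lra|]. apply Rinv_le_contravar; lra. }
assert (HS00 : 0 <= S) by apply Rmax_l.
assert (HD' : 0 < S + D / - B).
{ assert (0 < D / - B) by (apply Rdiv_lt_0_compat; lra). lra. }
assert (Hc : 0 < al / (2 * - B)) by (apply Rdiv_lt_0_compat; lra).
assert (HM : is_lim (fun s => Cmod (X s)) p_infty p_infty).
{ apply is_lim_p_p. intros M.
  destruct (proj2 (is_lim_p_p y) Hy (sqrt L * (Rabs M + 1))) as [S3 HS3].
  exists S3. intros s Hs. specialize (HS3 s Hs). specialize (HN s).
  assert (HLs : 0 < sqrt L) by now apply sqrt_lt_R0.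
  assert (HLL : sqrt L * sqrt L = L) by (apply sqrt_sqrt; lra).
  assert (p := Rabs_pos M). assert (p' := Rle_abs M). assert (p2 := pow2_ge_0 (x s)).
  assert (p3 := Cmod_ge_0 (X s)).
  assert (sqrt L * (Rabs M + 1) < sqrt L * Cmod (X s)).
  { apply Rsqr_incrst_0; [|apply Rmult_le_pos; lra|apply Rmult_le_pos; lra].
    unfold Rsqr. assert (0 <= sqrt L * (Rabs M + 1)) by (apply Rmult_le_pos; lra).
    replace (sqrt L * Cmod (X s) * (sqrt L * Cmod (X s))) with (x s ^ 2 + y s ^ 2)
      by (rewrite <- HN; transitivity (sqrt L * sqrt L * Cmod (X s) ^ 2);
          [rewrite HLL|]; ring). nra. }
  apply Rmult_lt_reg_l in H0; lra. }
split; [exact HM|]. split; [|split; [|split]].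
- destruct (polar_angle_exists A B (1 / L) S X T) as [th [Hth Hd]]; try easy.
  { apply Rdiv_lt_0_compat; lra. }
  { intros s Hs. destruct (HS s Hs) as [_ [_ [h _]]].
    replace (Cmod (X s) ^ 2) with ((x s ^ 2 + y s ^ 2) / L)
      by (rewrite <- HN; field; lra).
    apply Rmult_le_compat_r; [left; now apply Rinv_0_lt_compat|].
    assert (p := pow2_ge_0 (x s)). nra. }
  fold x y in Hd.
  assert (Hl : is_lim (fun s => - ep * th s) p_infty p_infty).
  { apply (log_divergence _ (fun s => - ep * (- (B * x s + A * y s) / (x s ^ 2 + y s ^ 2)))
      (al / (2 * - B)) (D / - B) S); [easy|easy| |].
    - intros s Hs. apply (is_derive_scal th), Hd, Hs.
    - intros s Hs. destruct (HS s Hs) as [_ [_ [h1 [h2 h3]]]].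
      eapply Rle_trans; [exact h3|].
      assert (h4 : 0 < w s) by apply Hpos.
      replace (- ep * (- (B * x s + A * y s) / (x s ^ 2 + y s ^ 2)))
        with ((al * y s + - B * w s) / (w s ^ 2 + y s ^ 2)).
      + apply Rle_trans with (al * y s / (2 * y s ^ 2)).
        * right. field. lra.
        * apply Rmult_le_compat.
          -- apply Rmult_le_pos; lra.
          -- left; apply Rinv_0_lt_compat; nra.
          -- assert (0 < - B * w s) by (apply Rmult_lt_0_compat; lra). lra.
          -- apply Rinv_le_contravar; nra.
      + rewrite Hx2. unfold w, al. field.
        assert (p := pow2_ge_0 (w s)). unfold w in p. nra. }
  destruct Hep as [[Ee|Ee] _]; rewrite Ee in Hl.
  + right. exists th. split; [easy|]. apply is_lim_opp_m.
    apply is_lim_ext with (2 := Hl). intros; ring.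
  + left. exists th. split; [easy|]. apply is_lim_ext with (2 := Hl). intros; ring.
- assert (Hkc : forall s, continuous (curvature X) s).
  { intros s. apply continuous_ext with x; [intros; now rewrite Hk|].
    exact (is_derive_continuous _ _ _ (proj1 (Hxy s))). }
  assert (Hl : is_lim (fun s => - ep * RInt (curvature X) 0 s) p_infty p_infty).
  { apply (log_divergence _ (fun s => - ep * curvature X s)
      (al / (2 * - B)) (D / - B) S); [easy|easy| |].
    - intros s Hs. apply (is_derive_scal (fun s => RInt (curvature X) 0 s)).
      now apply is_derive_RInt_continuous.
    - intros s Hs. destruct (HS s Hs) as [_ [h [h1 [h2 h3]]]].
      eapply Rle_trans; [exact h3|]. rewrite Hk. fold (w s).
      apply Rmult_le_reg_r with (y s); [lra|].
      replace (al / 2 / y s * y s) with (al / 2) by (field; lra). easy. }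
  destruct Hep as [[Ee|Ee] _]; rewrite Ee in Hl.
  + right. apply is_lim_opp_m. apply is_lim_ext with (2 := Hl). intros; ring.
  + left. apply is_lim_ext with (2 := Hl). intros; ring.
- apply is_lim_ext with x; [intros; now rewrite Hk|easy].
(* With [q = x / y] and [g = y / r], the unit vector [(x / r, y / r)] is [(q g, g)], which tends to
   [(0, 1)]. The growing direction thus tends to that of [(A - i B) (- i) = - B - i A]. *)
- set (q := fun s => x s * / y s).
  assert (Hq : is_lim q p_infty 0).
  { replace (Finite 0) with (Finite (0 * 0)) by (f_equal; ring).
    apply is_lim_mult_p; [easy|].
    now apply (is_lim_inv y p_infty p_infty). }
  set (g := fun s => / sqrt (1 + q s ^ 2)).
  assert (Hg : is_lim g p_infty 1).
  { replace 1 with (/ sqrt (1 + 0 ^ 2)) by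
      (replace (1 + 0 ^ 2) with 1 by ring; rewrite sqrt_1; field).
    apply (is_lim_inv (fun s => sqrt (1 + q s ^ 2)) p_infty (Finite (sqrt (1 + 0 ^ 2)))).
    - apply (is_lim_comp_continuous (fun s => 1 + q s ^ 2) sqrt); [|apply continuous_sqrt].
      apply is_lim_plus'; [apply is_lim_const|]. now apply is_lim_sqr_p.
    - replace (1 + 0 ^ 2) with 1 by ring. rewrite sqrt_1. intros E; injection E; lra. }
  assert (Hqg : is_lim (fun s => q s * g s) p_infty 0).
  { replace (Finite 0) with (Finite (0 * 1)) by (f_equal; ring). now apply is_lim_mult_p. }
  set (r := fun s => sqrt (x s ^ 2 + y s ^ 2)).
  assert (Hr : forall s, S <= s -> 0 < r s /\ y s / r s = g s /\ x s / r s = q s * g s).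
  { intros s Hs. destruct (HS s Hs) as [_ [_ [h _]]].
    assert (p := pow2_ge_0 (q s)).
    assert (Er : r s = y s * sqrt (1 + q s ^ 2)).
    { unfold r. rewrite <- (sqrt_Rsqr (y s)) at 2 by lra.
      rewrite <- sqrt_mult; [|apply Rle_0_sqr|lra]. f_equal. unfold q, Rsqr. field. lra. }
    assert (0 < sqrt (1 + q s ^ 2)) by (apply sqrt_lt_R0; lra).
    rewrite Er. split; [apply Rmult_lt_0_compat; lra|].
    change (g s) with (/ sqrt (1 + q s ^ 2)).
    set (Q := sqrt (1 + q s ^ 2)) in *. unfold q. split; field; lra. }
  set (Lq := sqrt (A ^ 2 + B ^ 2)).
  assert (HLq : 0 < Lq) by now apply sqrt_lt_R0.
  assert (HLC : RtoC Lq <> 0%C) by (intros E; injection E; lra).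
  assert (Hdir : forall u v, ((RtoC A - Ci * RtoC B) * (u, - v)%R / RtoC Lq)%C
    = (/ Lq * (A * u + - B * v), / Lq * (- B * u + - A * v))).
  { intros u v.
    replace (/ Lq * (A * u + - B * v), / Lq * (- B * u + - A * v))
      with ((A * u + - B * v, - B * u + - A * v)%R / RtoC Lq)%C.
    - f_equal. apply C_eq; simpl; ring.
    - apply C_eq; simpl; field; lra. }
  replace ((- RtoC B - Ci * RtoC A) / RtoC Lq)%C with
    ((RtoC A - Ci * RtoC B) * (0, - (1))%R / RtoC Lq)%C
    by (f_equal; apply C_eq; simpl; ring).
  rewrite Hdir.
  apply filterlim_ext_loc with (fun s =>
    (/ Lq * (A * (q s * g s) + - B * g s), / Lq * (- B * (q s * g s) + - A * g s))).
  { exists S. intros s Hs. destruct (Hr s) as [h1 [h2 h3]]; [lra|].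
    rewrite <- h3, <- h2, <- Hdir. symmetry. now apply growth_direction. }
  apply filterlim_C; simpl; apply is_lim_scal_p, is_lim_plus'; now apply is_lim_scal_p.
Qed.

(** * From the sign of the curvature to the type of the curve *)

Lemma expi_plus (u v : R) : expi (u + v) = (expi u * expi v)%C.
Proof.
apply C_eq; simpl; [rewrite cos_plus|rewrite sin_plus]; ring.
Qed.

Lemma Cmod_expi (u : R) : Cmod (expi u) = 1.
Proof.
apply Cmod_unit. simpl. assert (h := sin2_cos2 u). unfold Rsqr in h. lra.
Qed.

Lemma sub_Ci_neq_0 (A B : R) : A <> 0 -> (RtoC A - Ci * RtoC B)%C <> 0%C.
Proof. intros HA E. apply (f_equal Re) in E. simpl in E. lra. Qed.

Lemma phase_flow_orientation (A b ep : R) (x y : R -> R) :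
  orientation A ep -> phase_flow A b x y -> phase_flow (ep * A) b (fun s => ep * x s) y.
Proof.
intros [[->| ->] _] H s.
- destruct (H s) as [Hx Hy]. split.
  + replace (1 * A + 1 * x s * y s) with (1 * (A + x s * y s)) by ring.
    now apply is_derive_scal.
  + now replace (b - (1 * x s) ^ 2) with (b - x s ^ 2) by ring.
- destruct (H s) as [Hx Hy]. split.
  + replace (-1 * A + -1 * x s * y s) with (-1 * (A + x s * y s)) by ring.
    now apply is_derive_scal.
  + now replace (b - (-1 * x s) ^ 2) with (b - x s ^ 2) by ring.
Qed.

Lemma wraps_of_pos (A B ep s0 : R) (X T : R -> C) :
  orientation A ep -> B < 0 -> solves A B X T ->
  (forall s, s0 <= s -> 0 < ep * phase_x A B X T s) ->
  wraps A (1 / sqrt (- B)) X.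
Proof.
intros Hep HB H Hpos. assert (Hf := solves_phase_flow A B X T H).
destruct (phase_flow_forward (ep * A) (- B) s0 (fun s => ep * phase_x A B X T s)
  (phase_y A B X T)) as [Hx Hy]; [apply Hep|lra|now apply phase_flow_orientation|easy|].
apply (wraps_of_limit A B ep X T); try easy.
apply is_lim_ext with (fun s => ep * (ep * phase_x A B X T s)).
- intros s. transitivity (ep * ep * phase_x A B X T s); [ring|].
  rewrite (orientation_sqr A ep Hep). ring.
- now apply is_lim_scal_p.
Qed.

(** The point [s1] excludes the circle run through in the opposite sense, an equilibrium with
    [- ep x = sqrt (- B)]. *)
Lemma spirals_out_of_neg (A B ep s1 : R) (X T : R -> C) :
  orientation A ep -> B < 0 -> solves A B X T ->
  (forall s, 0 < - ep * phase_x A B X T s) -> phase_x A B X T s1 ^ 2 <> - B ->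
  spirals_out A B X.
Proof.
intros Hep HB H Hpos H1. assert (Hf := solves_phase_flow A B X T H).
destruct (phase_flow_escape (ep * A) (- B) s1 (fun s => - ep * phase_x A B X T s)
  (phase_y A B X T)) as [Hy [Hw [S HS]]]; [apply Hep|lra| |easy| |].
- intros s. apply (phase_flow_orientation A (- B) ep) in Hf; [|easy].
  apply phase_flow_flip in Hf. destruct (Hf s) as [h1 h2]. split.
  + replace (- (ep * A) + - ep * phase_x A B X T s * phase_y A B X T s)
      with (- (ep * A) + - (ep * phase_x A B X T s) * phase_y A B X T s) by ring.
    apply is_derive_ext with (2 := h1). intros; simpl; ring.
  + now replace ((- ep * phase_x A B X T s) ^ 2) with ((- (ep * phase_x A B X T s)) ^ 2) by ring.
- replace ((- ep * phase_x A B X T s1) ^ 2) with (ep * ep * phase_x A B X T s1 ^ 2) by ring.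
  rewrite (orientation_sqr A ep Hep). now rewrite Rmult_1_l.
- apply (spirals_out_of_escape A B ep X T); try easy. now exists S.
Qed.

Lemma constant_sign (f : R -> R) :
  (forall s, continuity_pt f s) -> (forall s, f s <> 0) ->
  (forall s, 0 < f s) \/ (forall s, f s < 0).
Proof.
intros Hc Hn.
assert (P : forall g : R -> R, (forall s, continuity_pt g s) -> (forall s, g s <> 0) ->
  forall s t, s <= t -> g s < 0 -> g t < 0).
{ clear. intros g Hc Hn s t Hst Hs. destruct (Rlt_or_le (g t) 0) as [h|h]; [easy|].
  destruct (first_hit g s t 0) as [r [_ [Er _]]]; try easy; [lra|]. now destruct (Hn r). }
assert (Q : forall g : R -> R, (forall s, continuity_pt g s) -> (forall s, g s <> 0) ->
  g 0 < 0 -> forall s, g s < 0).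
{ clear - P. intros g Hc Hn H0 s. destruct (Rle_or_lt 0 s) as [h|h].
  - now apply (P g Hc Hn 0 s).
  - destruct (Rlt_or_le (g s) 0) as [h'|h']; [easy|].
    assert (- g 0 < 0); [|lra]. apply (P (fun r => - g r)) with s.
    + intros r. now apply continuity_pt_opp.
    + intros r E. apply (Hn r). lra.
    + lra.
    + assert (n := Hn s). lra. }
destruct (Rlt_or_le (f 0) 0) as [h|h].
- right. now apply Q.
- left. intros s. assert (n := Hn 0).
  assert (- f s < 0); [|lra]. apply (Q (fun r => - f r)); [| |lra].
  + intros r. now apply continuity_pt_opp.
  + intros r E. apply (Hn r). lra.
Qed.

Lemma orientation_pos_after (A B ep s0 : R) (X T : R -> C) :
  orientation A ep -> solves A B X T -> phase_x A B X T s0 = 0 ->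
  forall s, s0 < s -> 0 < ep * phase_x A B X T s.
Proof.
intros Hep H E. assert (Hf := solves_phase_flow A B X T H).
apply (phase_flow_pos_after (ep * A) (- B) s0 (fun s => ep * phase_x A B X T s)
  (phase_y A B X T)); [apply Hep|now apply phase_flow_orientation|].
rewrite E. lra.
Qed.

Lemma type1_of_zero (A B s0 : R) (X T : R -> C) :
  A <> 0 -> B < 0 -> solves A B X T -> phase_x A B X T s0 = 0 -> type1 A B X.
Proof.
intros HA HB H E. destruct (orientation_exists A HA) as [ep Hep].
assert (P : forall X T s0, solves A B X T -> phase_x A B X T s0 = 0 ->
  wraps A (1 / sqrt (- B)) X).
{ clear - Hep HB. intros X T s0 H E.
  apply (wraps_of_pos A B ep (s0 + 1) X T); try easy.
  intros s Hs. apply (orientation_pos_after A B ep s0); try easy. lra. }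
split; [now apply (P X T s0)|].
apply (P _ _ (- s0) (solves_reverse A B X T H)).
rewrite phase_x_reverse, Ropp_involutive, E. ring.
Qed.

(** Reversal changes the sign of [phase_x], so exactly one of [X] and [reverse X] has [ep x > 0].
    That one wraps forward, and the other spirals out. *)
Lemma type2_cases (A B ep s1 : R) (X T : R -> C) :
  orientation A ep -> B < 0 -> solves A B X T ->
  (forall s, phase_x A B X T s <> 0) -> phase_x A B X T s1 ^ 2 <> - B ->
  ((forall s, 0 <= curvature X s) \/ (forall s, curvature X s <= 0)) /\
  ((wraps A (1 / sqrt (- B)) X /\ spirals_out A B (reverse X)) \/
   (wraps A (1 / sqrt (- B)) (reverse X) /\ spirals_out A B X)).
Proof.
intros Hep HB H Hn H1. assert (Hf := solves_phase_flow A B X T H).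
assert (Hc : forall s, continuity_pt (phase_x A B X T) s).
{ intros s. exact (is_derive_continuity_pt _ _ _ (proj1 (Hf s))). }
assert (Hs : (forall s, 0 < phase_x A B X T s) \/ (forall s, phase_x A B X T s < 0))
  by now apply constant_sign.
split.
- destruct Hs as [Hs|Hs]; [left|right]; intros s; specialize (Hs s);
    rewrite (solves_curvature A B X T s H); lra.
- assert (Hr := solves_reverse A B X T H).
  assert (Hs' : (forall s, 0 < ep * phase_x A B X T s) \/
    (forall s, 0 < - ep * phase_x A B X T s)).
  { destruct Hep as [[->| ->] _]; destruct Hs as [Hs|Hs];
      [left|right|right|left]; intros s; specialize (Hs s); lra. }
  destruct Hs' as [Hs'|Hs']; [left|right]; split.
  + now apply (wraps_of_pos A B ep 0 X T).
  + apply (spirals_out_of_neg A B ep (- s1) _ _ Hep HB Hr).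
    * intros s. rewrite phase_x_reverse. specialize (Hs' (- s)). lra.
    * rewrite phase_x_reverse, Ropp_involutive.
      now replace ((- phase_x A B X T s1) ^ 2) with (phase_x A B X T s1 ^ 2) by ring.
  + apply (wraps_of_pos A B ep 0 _ _ Hep HB Hr).
    intros s _. rewrite phase_x_reverse. specialize (Hs' (- s)). lra.
  + now apply (spirals_out_of_neg A B ep s1 X T).
Qed.

Lemma wraps_Cmod_lim (A rho : R) (X : R -> C) :
  A <> 0 -> wraps A rho X -> is_lim (fun s => Cmod (X s)) p_infty rho.
Proof.
intros HA [H1 H2]. destruct (Rlt_or_le A 0) as [h|h].
- now apply H1.
- apply H2. lra.
Qed.

Lemma wraps_not_spirals_out (A B rho : R) (X : R -> C) :
  A <> 0 -> wraps A rho X -> spirals_out A B X -> False.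
Proof.
intros HA H1 [H2 _]. apply wraps_Cmod_lim in H1; [|easy].
apply is_lim_unique in H1. apply is_lim_unique in H2. rewrite H1 in H2. discriminate.
Qed.

(** * Rotations and the circle *)

(** [p + i q] is [T2] times the conjugate of [T1]: constant because both fields rotate at the speed
    [k], and of modulus 1. *)
Lemma rotating_fields_congruent (T1 T2 : R -> C) (k : R -> R) :
  (forall s, is_derive (fun u => Re (T1 u)) s (- k s * Im (T1 s)) /\
    is_derive (fun u => Im (T1 u)) s (k s * Re (T1 s)) /\ Cmod (T1 s) = 1) ->
  (forall s, is_derive (fun u => Re (T2 u)) s (- k s * Im (T2 s)) /\
    is_derive (fun u => Im (T2 u)) s (k s * Re (T2 s)) /\ Cmod (T2 s) = 1) ->
  exists a, forall s, T2 s = (expi a * T1 s)%C.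
Proof.
intros H1 H2.
set (p := fun s => Re (T2 s) * Re (T1 s) + Im (T2 s) * Im (T1 s)).
set (q := fun s => Im (T2 s) * Re (T1 s) - Re (T2 s) * Im (T1 s)).
assert (Hp : forall s t, p s = p t).
{ apply is_derive_zero_const. intros s.
  destruct (H1 s) as [h1 [h2 _]]. destruct (H2 s) as [h3 [h4 _]].
  replace 0 with (- k s * Im (T2 s) * Re (T1 s) + Re (T2 s) * (- k s * Im (T1 s))
    + (k s * Re (T2 s) * Im (T1 s) + Im (T2 s) * (k s * Re (T1 s)))) by ring.
  apply (is_derive_plus (fun s => Re (T2 s) * Re (T1 s)) (fun s => Im (T2 s) * Im (T1 s))).
  - now apply (is_derive_product (fun s => Re (T2 s)) (fun s => Re (T1 s))).
  - now apply (is_derive_product (fun s => Im (T2 s)) (fun s => Im (T1 s))). }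
assert (Hq : forall s t, q s = q t).
{ apply is_derive_zero_const. intros s.
  destruct (H1 s) as [h1 [h2 _]]. destruct (H2 s) as [h3 [h4 _]].
  replace 0 with (k s * Re (T2 s) * Re (T1 s) + Im (T2 s) * (- k s * Im (T1 s))
    - (- k s * Im (T2 s) * Im (T1 s) + Re (T2 s) * (k s * Re (T1 s)))) by ring.
  apply (is_derive_minus (fun s => Im (T2 s) * Re (T1 s)) (fun s => Re (T2 s) * Im (T1 s))).
  - now apply (is_derive_product (fun s => Im (T2 s)) (fun s => Re (T1 s))).
  - now apply (is_derive_product (fun s => Re (T2 s)) (fun s => Im (T1 s))). }
assert (U1 : forall s, Re (T1 s) ^ 2 + Im (T1 s) ^ 2 = 1).
{ intros s. apply Cmod_unit, H1. }
assert (U2 : forall s, Re (T2 s) ^ 2 + Im (T2 s) ^ 2 = 1).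
{ intros s. apply Cmod_unit, H2. }
destruct (unit_angle (p 0) (q 0)) as [a [Ha Hb]].
{ transitivity ((Re (T2 0) ^ 2 + Im (T2 0) ^ 2) * (Re (T1 0) ^ 2 + Im (T1 0) ^ 2)).
  - unfold p, q. ring.
  - rewrite U1, U2. ring. }
exists a. intros s. unfold expi. rewrite Ha, Hb, (Hp 0 s), (Hq 0 s). unfold p, q.
apply C_eq; simpl.
- transitivity (Re (T2 s) * (Re (T1 s) ^ 2 + Im (T1 s) ^ 2)); [rewrite U1; ring|].
  unfold Re, Im. ring.
- transitivity (Im (T2 s) * (Re (T1 s) ^ 2 + Im (T1 s) ^ 2)); [rewrite U1; ring|].
  unfold Re, Im. ring.
Qed.

(** The planar orbits agree after a shift, hence so do the curvatures, and the tangents agree up to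
    a rotation. The positions follow from [(A - i B) X = (x + i y) T], so no translation enters. *)
Lemma solves_unique (A B s1 s2 : R) (X1 T1 X2 T2 : R -> C) :
  A <> 0 -> solves A B X1 T1 -> solves A B X2 T2 ->
  phase_x A B X1 T1 s1 = phase_x A B X2 T2 s2 ->
  phase_y A B X1 T1 s1 = phase_y A B X2 T2 s2 -> congruent X1 X2.
Proof.
intros HA H1 H2 Ex Ey.
set (c := s1 - s2).
assert (E : forall s, phase_x A B X1 T1 (s + c) = phase_x A B X2 T2 s /\
  phase_y A B X1 T1 (s + c) = phase_y A B X2 T2 s).
{ apply (phase_flow_unique A (- B) s2 (fun s => phase_x A B X1 T1 (s + c))
    (fun s => phase_y A B X1 T1 (s + c))).
  - now apply phase_flow_shift, solves_phase_flow.
  - now apply solves_phase_flow.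
  - now replace (s2 + c) with s1 by (unfold c; ring).
  - now replace (s2 + c) with s1 by (unfold c; ring). }
destruct (rotating_fields_congruent (fun s => T1 (s + c)) T2 (phase_x A B X2 T2)) as [a Ha].
- intros s. destruct (H1 (s + c)) as [_ [_ [h1 [h2 h3]]]].
  rewrite (proj1 (E s)) in h1, h2. split; [|split].
  + now apply (is_derive_comp_shift (fun u => Re (T1 u))).
  + now apply (is_derive_comp_shift (fun u => Im (T1 u))).
  + now apply Cmod_unit.
- intros s. destruct (H2 s) as [_ [_ [h1 [h2 h3]]]].
  split; [easy|]. split; [easy|]. now apply Cmod_unit.
- exists a, c. intros s. assert (HC := sub_Ci_neq_0 A B HA).
  assert (P1 := phase_position A B X1 T1 (s + c) H1).
  assert (P2 := phase_position A B X2 T2 s H2).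
  destruct (E s) as [E1 E2]. rewrite E1, E2 in P1. rewrite Ha in P2.
  set (z := (phase_x A B X2 T2 s, phase_y A B X2 T2 s) : C) in *.
  set (m := (RtoC A - Ci * RtoC B)%C) in *.
  assert (Q : (m * X2 s = m * (expi a * X1 (s + c)%R))%C).
  { rewrite P2. transitivity (expi a * (z * T1 (s + c)%R))%C; [ring|]. rewrite <- P1. ring. }
  transitivity (m * X2 s / m)%C; [field; easy|]. rewrite Q. field. easy.
Qed.

Lemma inner_rotate (a : R) (z w : C) : inner (expi a * z)%C (expi a * w)%C = inner z w.
Proof.
rewrite !inner_eq. unfold Re, Im. simpl. assert (h := sin2_cos2 a). unfold Rsqr in h.
transitivity ((sin a * sin a + cos a * cos a) * (fst z * fst w + snd z * snd w));
  [ring|]. rewrite h. ring.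
Qed.

Lemma solves_congruent (A B a c : R) (X T : R -> C) :
  solves A B X T ->
  solves A B (fun s => expi a * X (s + c)%R)%C (fun s => expi a * T (s + c)%R)%C /\
  forall s,
    phase_x A B (fun s => expi a * X (s + c)%R)%C (fun s => expi a * T (s + c)%R)%C s
      = phase_x A B X T (s + c) /\
    phase_y A B (fun s => expi a * X (s + c)%R)%C (fun s => expi a * T (s + c)%R)%C s
      = phase_y A B X T (s + c).
Proof.
intros H.
assert (E : forall s,
    phase_x A B (fun s => expi a * X (s + c)%R)%C (fun s => expi a * T (s + c)%R)%C s
      = phase_x A B X T (s + c) /\
    phase_y A B (fun s => expi a * X (s + c)%R)%C (fun s => expi a * T (s + c)%R)%C s
      = phase_y A B X T (s + c)).
{ intros s. unfold phase_x, phase_y.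
  replace (Ci * (expi a * T (s + c)%R))%C with (expi a * (Ci * T (s + c)%R))%C by ring.
  now rewrite !inner_rotate. }
split; [|exact E].
intros s. rewrite (proj1 (E s)). destruct (H (s + c)) as [Ha [Hb [Hc [Hd Hu]]]].
set (k := phase_x A B X T (s + c)) in *.
assert (L : forall (f g : R -> R) p q df dg, is_derive f (s + c) df -> is_derive g (s + c) dg ->
  is_derive (fun u => p * f (u + c) + q * g (u + c)) s (p * df + q * dg)).
{ intros f g p q df dg Hf Hg.
  apply (is_derive_plus (fun u => p * f (u + c)) (fun u => q * g (u + c))).
  - now apply (is_derive_scal (fun u => f (u + c))), is_derive_comp_shift.
  - now apply (is_derive_scal (fun u => g (u + c))), is_derive_comp_shift. }
split; [|split; [|split; [|split]]].
- replace (Re (expi a * T (s + c)%R)%C) with (cos a * Re (T (s + c)) + - sin a * Im (T (s + c)))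
    by (simpl; unfold Re, Im; ring).
  apply is_derive_ext with (2 := L _ _ (cos a) (- sin a) _ _ Ha Hb).
  intros u. simpl. unfold Re, Im. ring.
- replace (Im (expi a * T (s + c)%R)%C) with (sin a * Re (T (s + c)) + cos a * Im (T (s + c)))
    by (simpl; unfold Re, Im; ring).
  apply is_derive_ext with (2 := L _ _ (sin a) (cos a) _ _ Ha Hb).
  intros u. simpl. unfold Re, Im. ring.
- replace (- k * Im (expi a * T (s + c)%R)%C) with
    (cos a * (- k * Im (T (s + c))) + - sin a * (k * Re (T (s + c))))
    by (simpl; unfold Re, Im; ring).
  apply is_derive_ext with (2 := L _ _ (cos a) (- sin a) _ _ Hc Hd).
  intros u. simpl. unfold Re, Im. ring.
- replace (k * Re (expi a * T (s + c)%R)%C) with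
    (sin a * (- k * Im (T (s + c))) + cos a * (k * Re (T (s + c))))
    by (simpl; unfold Re, Im; ring).
  apply is_derive_ext with (2 := L _ _ (sin a) (cos a) _ _ Hc Hd).
  intros u. simpl. unfold Re, Im. ring.
- apply Cmod_unit. rewrite Cmod_mult, Cmod_expi, (proj1 (Cmod_unit _) Hu). ring.
Qed.

(** On the circle [x^2 + y^2] is constant. Its first derivative gives [A x - B y = 0], and the
    derivative of this relation, combined with it, gives [(A^2 + B^2) (- B - x^2) = 0]. *)
Lemma traces_circle_equilibrium (A B : R) (X T : R -> C) :
  A <> 0 -> B < 0 -> solves A B X T -> traces_circle (1 / sqrt (- B)) X ->
  forall s, phase_x A B X T s ^ 2 = - B.
Proof.
intros HA HB H Hc.
assert (Hf := solves_phase_flow A B X T H).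
assert (HN : forall s, phase_x A B X T s ^ 2 + phase_y A B X T s ^ 2
  = (A ^ 2 + B ^ 2) * (1 / sqrt (- B)) ^ 2).
{ intros s. rewrite <- (phase_norm A B X T s H). do 2 f_equal. apply Hc. now exists s. }
set (x := phase_x A B X T) in *. set (y := phase_y A B X T) in *.
assert (D : forall s, A * x s + - B * y s = 0).
{ intros s. destruct (Hf s) as [Hx Hy].
  assert (Hd : is_derive (fun u => x u ^ 2 + y u ^ 2) s (2 * (A * x s + - B * y s))).
  { auto_derive; [repeat split; eexists; eassumption|].
    rewrite_derive Hx. rewrite_derive Hy. ring. }
  apply is_derive_ext with (1 := HN) in Hd.
  apply is_derive_unique in Hd. rewrite Derive_const in Hd. lra. }
intros s. destruct (Hf s) as [Hx Hy].
assert (Hd : is_derive (fun u => A * x u + - B * y u) s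
  (A * (A + x s * y s) + - B * (- B - x s ^ 2))).
{ auto_derive; [repeat split; eexists; eassumption|].
  rewrite_derive Hx. rewrite_derive Hy. ring. }
apply is_derive_ext with (1 := D) in Hd.
apply is_derive_unique in Hd. rewrite Derive_const in Hd.
specialize (D s). assert (HL := sqr_sum_pos A B HA).
assert (E : (A ^ 2 + B ^ 2) * (- B - x s ^ 2) = 0).
{ transitivity (- B * (A * (A + x s * y s) + - B * (- B - x s ^ 2))
    - A * x s * (A * x s + - B * y s)); [ring|]. rewrite <- Hd, D. ring. }
apply Rmult_integral in E. lra.
Qed.

(** Differentiating [x^2] gives [x' = 0], so [T] rotates at a constant speed [ka] and
    [X s = X 0 * expi (ka s)]. As [ka] is nonzero, every polar angle is attained. *)
Lemma equilibrium_traces_circle (A B : R) (X T : R -> C) :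
  A <> 0 -> B < 0 -> solves A B X T -> (forall s, phase_x A B X T s ^ 2 = - B) ->
  traces_circle (1 / sqrt (- B)) X.
Proof.
intros HA HB H Hx2.
assert (Hf := solves_phase_flow A B X T H).
set (x := phase_x A B X T) in *. set (y := phase_y A B X T) in *.
assert (Hx0 : forall s, x s <> 0) by (intros s E; specialize (Hx2 s); rewrite E in Hx2; lra).
assert (D : forall s, A + x s * y s = 0).
{ intros s. destruct (Hf s) as [Hx _].
  assert (Hd : is_derive (fun u => x u ^ 2) s (2 * x s * (A + x s * y s))).
  { auto_derive; [repeat split; eexists; eassumption|]. rewrite_derive Hx. ring. }
  apply is_derive_ext with (1 := Hx2) in Hd.
  apply is_derive_unique in Hd. rewrite Derive_const in Hd. specialize (Hx0 s).
  symmetry in Hd. apply Rmult_integral in Hd. lra. }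
assert (Hxc : forall s, x s = x 0).
{ intros s. apply is_derive_zero_const. intros r. rewrite <- (D r). apply Hf. }
set (ka := x 0) in *.
assert (Hyc : forall s, y s = y 0).
{ intros s. assert (h1 := D s). assert (h2 := D 0). rewrite Hxc in h1. fold ka in h2.
  apply Rmult_eq_reg_l with ka; [lra|apply Hx0]. }
destruct (rotating_fields_congruent (fun s => expi (ka * s)) T x) as [a Ha].
{ intros s. rewrite Hxc. simpl. split; [|split; [|apply Cmod_expi]].
  - auto_derive; [easy|ring].
  - auto_derive; [easy|ring]. }
{ intros s. destruct (H s) as [_ [_ [h1 [h2 h3]]]].
  split; [easy|]. split; [easy|]. now apply Cmod_unit. }
assert (HC := sub_Ci_neq_0 A B HA).
assert (HX : forall s, X s = (X 0 * expi (ka * s))%C).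
{ intros s. assert (P1 := phase_position A B X T s H).
  assert (P0 := phase_position A B X T 0 H). fold x y in P1, P0.
  rewrite Hxc, Hyc, Ha in P1. rewrite Ha, Rmult_0_r in P0. fold ka in P0.
  set (m := (RtoC A - Ci * RtoC B)%C) in *. set (z := (ka, y 0) : C) in *.
  replace (expi 0) with (RtoC 1) in P0 by (unfold expi; now rewrite cos_0, sin_0).
  assert (Q : (m * X s = m * (X 0 * expi (ka * s)))%C).
  { rewrite P1. transitivity (z * (expi a * 1) * expi (ka * s))%C; [ring|].
    rewrite <- P0. ring. }
  transitivity (m * X s / m)%C; [field; easy|]. rewrite Q. field. easy. }
set (c := sqrt (- B)).
assert (Hc : 0 < c) by (apply sqrt_lt_R0; lra).
assert (Hcc : c * c = - B) by (apply sqrt_sqrt; lra).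
assert (Hr : Cmod (X 0) = 1 / c).
{ assert (HL := sqr_sum_pos A B HA).
  assert (N := phase_norm A B X T 0 H). fold x y in N.
  assert (p := Cmod_ge_0 (X 0)).
  assert (0 < 1 / c) by (apply Rdiv_lt_0_compat; lra).
  apply Rsqr_inj; [easy|lra|]. unfold Rsqr.
  apply Rmult_eq_reg_l with (A ^ 2 + B ^ 2); [|lra].
  transitivity ((A ^ 2 + B ^ 2) * Cmod (X 0) ^ 2); [ring|]. rewrite N, Hx2.
  assert (D0 := D 0). assert (Hx20 := Hx2 0).
  apply Rmult_eq_reg_l with (- B); [|lra].
  transitivity ((- B) ^ 2 + x 0 ^ 2 * y 0 ^ 2); [rewrite Hx20; ring|].
  replace (x 0 ^ 2 * y 0 ^ 2) with (A ^ 2)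
    by (transitivity ((- A) ^ 2); [ring|replace (- A) with (x 0 * y 0) by lra; ring]).
  rewrite <- Hcc at 2. replace ((- B) ^ 2) with (B ^ 2) by ring. field. lra. }
intros z. split.
- intros [s <-]. rewrite HX, Cmod_mult, Cmod_expi, Hr. ring.
- intros Hz. destruct (polar_form z) as [u Hu]. destruct (polar_form (X 0)) as [v Hv].
  exists ((u - v) / ka). rewrite HX, Hv, Hu, Hz, Hr.
  rewrite <- Cmult_assoc, <- expi_plus. do 2 f_equal. field. apply Hx0.
Qed.

(** * Curve shortening flow *)

Lemma is_derive_linear_comb (f g : R -> R) (p q s df dg : R) :
  is_derive f s df -> is_derive g s dg ->
  is_derive (fun u => p * f u + q * g u) s (p * df + q * dg).
Proof.
intros Hf Hg. apply (is_derive_plus (fun u => p * f u) (fun u => q * g u)).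
- now apply is_derive_scal.
- now apply is_derive_scal.
Qed.

Lemma curve_deriv_scaled (z : C) (X : R -> C) (s : R) (V : C) :
  is_derive (fun u => Re (X u)) s (Re V) -> is_derive (fun u => Im (X u)) s (Im V) ->
  curve_deriv (fun u => z * X u)%C s = (z * V)%C.
Proof.
intros Ha Hb. apply C_eq; simpl; apply is_derive_unique.
- replace (fst z * fst V - snd z * snd V) with (fst z * Re V + - snd z * Im V)
    by (unfold Re, Im; ring).
  apply is_derive_ext with (2 := is_derive_linear_comb _ _ (fst z) (- snd z) _ _ _ Ha Hb).
  intros u. simpl. unfold Re, Im. ring.
- replace (fst z * snd V + snd z * fst V) with (snd z * Re V + fst z * Im V)
    by (unfold Re, Im; ring).
  apply is_derive_ext with (2 := is_derive_linear_comb _ _ (snd z) (fst z) _ _ _ Ha Hb).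
  intros u. simpl. unfold Re, Im. ring.
Qed.

Lemma tangent_scaled (z : C) (X T : R -> C) (k : R -> R) (s : R) :
  z <> 0%C -> frame X T k ->
  tangent (fun u => z * X u)%C s = (z / RtoC (Cmod z) * T s)%C.
Proof.
intros Hz H. destruct (H s) as [Ha [Hb [_ [_ Hu]]]].
unfold tangent. rewrite (curve_deriv_scaled z X s (T s) Ha Hb), Cmod_mult.
rewrite (proj1 (Cmod_unit (T s)) Hu), Rmult_1_r.
assert (HM : RtoC (Cmod z) <> 0%C).
{ intros E. apply (f_equal Re) in E. simpl in E. apply Hz. now apply Cmod_eq_0. }
field. easy.
Qed.

Lemma curvature_scaled (z : C) (X T : R -> C) (k : R -> R) (s : R) :
  z <> 0%C -> frame X T k -> curvature (fun u => z * X u)%C s = k s / Cmod z.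
Proof.
intros Hz H. destruct (H s) as [Ha [Hb [Hc [Hd Hu]]]].
assert (HMp : 0 < Cmod z) by now apply Cmod_gt_0.
set (e := (z / RtoC (Cmod z))%C).
assert (He : Cmod e = 1).
{ unfold e. rewrite Cmod_div, Cmod_R, Rabs_pos_eq by
    (try (intros E; apply (f_equal Re) in E; simpl in E); lra). field. lra. }
unfold curvature, normal.
rewrite (curve_deriv_scaled z X s (T s) Ha Hb), Cmod_mult.
rewrite (proj1 (Cmod_unit (T s)) Hu), Rmult_1_r. f_equal.
replace (tangent (fun u => z * X u)%C) with (fun u => e * T u)%C
  by (apply functional_extensionality; intros u; symmetry; now apply tangent_scaled with k).
rewrite (curve_deriv_scaled e T s (- k s * Im (T s), k s * Re (T s))); [|exact Hc|exact Hd].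
clearbody e. apply Cmod_unit in He. rewrite inner_eq. unfold Re, Im in *. simpl in *.
transitivity (k s * ((fst e * (fst e * 1) + snd e * (snd e * 1))
  * (fst (T s) * (fst (T s) * 1) + snd (T s) * (snd (T s) * 1)))); [ring|].
rewrite He, Hu. ring.
Qed.

Lemma immersed_scaled (A B : R) (z : C) (X T : R -> C) :
  z <> 0%C -> solves A B X T -> immersed (fun u => z * X u)%C.
Proof.
intros Hz H. split.
- intros n s. split.
  + apply ex_derive_n_ext with (feval X T
      (FAdd (FMul (FCst (Re z)) FXre) (FMul (FCst (- Im z)) FXim))).
    * intros u. simpl. unfold Re, Im. ring.
    * now apply (feval_smooth A B).
  + apply ex_derive_n_ext with (feval X T
      (FAdd (FMul (FCst (Re z)) FXim) (FMul (FCst (Im z)) FXre))).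
    * intros u. simpl. unfold Re, Im. ring.
    * now apply (feval_smooth A B).
- intros s. destruct (H s) as [Ha [Hb [_ [_ Hu]]]].
  rewrite (curve_deriv_scaled z X s (T s) Ha Hb). apply Cmult_neq_0; [easy|].
  intros E. rewrite E in Hu. simpl in Hu. lra.
Qed.

(** The two-sided derivative exists even at time 0, the formula for the motion being valid for small
    negative times, and it restricts to the time window. The window filter is proper because it
    contains [t] itself. *)
Lemma time_derivative_of_components (tmax : R) (Xh : R -> R -> C) (u t : R) (v : C) :
  0 <= t < tmax ->
  is_derive (fun r => Re (Xh u r)) t (Re v) -> is_derive (fun r => Im (Xh u r)) t (Im v) ->
  time_derivative tmax Xh u t v.
Proof.
intros Ht Ha Hb. unfold time_derivative.
set (D := fun t' => 0 <= t' < tmax).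
assert (HP : ProperFilter (within D (locally t))).
{ split; [|apply within_filter, locally_filter].
  intros P HPt. exists t. apply (locally_singleton t _ HPt). exact Ht. }
apply (@filterdiff_locally R_AbsRing R_NormedModule C_R_NormedModule
  (within D (locally t)) HP (Xh u) t).
- intros P HPt. now apply filter_le_within.
- apply filterdiff_ext with (fun r => (Re (Xh u r), Im (Xh u r)) : C_R_NormedModule).
  { intros r. now destruct (Xh u r). }
  apply filterdiff_ext_lin with
    (fun h : R_NormedModule => (scal h (Re v), scal h (Im v)) : C_R_NormedModule).
  2: { intros h. now destruct v. }
  apply (filterdiff_comp'_2 (K := R_AbsRing) (T := R_NormedModule) (U := R_NormedModule)
    (V := R_NormedModule) (W := C_R_NormedModule)
    (fun r => Re (Xh u r)) (fun r => Im (Xh u r)) (fun p q => (p, q)) t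
    (fun h => scal h (Re v)) (fun h => scal h (Im v)) (fun p q => (p, q)) Ha Hb).
  apply filterdiff_ext with (fun w => w); [now intros []|].
  apply filterdiff_ext_lin with (fun w => w); [|now intros []].
  apply filterdiff_id.
Qed.

Lemma time_factor_pos (B t : R) : B < 0 -> t < - (1 / (2 * B)) -> 0 < 2 * B * t + 1.
Proof.
intros HB Ht. assert (2 * B * - (1 / (2 * B)) = -1) by (field; lra). nra.
Qed.

Definition motion_factor (A B t : R) : C :=
  (RtoC (scale_fun B t) * expi (rot_fun A B t))%C.

Lemma motion_factor_Cmod (A B t : R) : Cmod (motion_factor A B t) = scale_fun B t.
Proof.
unfold motion_factor. rewrite Cmod_mult, Cmod_expi, Cmod_R, Rabs_pos_eq; [ring|].
apply sqrt_pos.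
Qed.

Lemma motion_factor_neq_0 (A B t : R) :
  0 < 2 * B * t + 1 -> motion_factor A B t <> 0%C.
Proof.
intros H. apply Cmod_gt_0. rewrite motion_factor_Cmod. now apply sqrt_lt_R0.
Qed.

Lemma rotating_shrinking_curvature (A B t : R) (X T : R -> C) (u : R) :
  0 < 2 * B * t + 1 -> solves A B X T ->
  curvature (fun w => rotating_shrinking A B X w t) u
  = phase_x A B X T u / scale_fun B t.
Proof.
intros Ht H. rewrite <- (motion_factor_Cmod A B t).
apply (curvature_scaled (motion_factor A B t) X T); [now apply motion_factor_neq_0|easy].
Qed.

(** This is the origin of the scaling and angular functions: [g g' = B] and [g^2 f' = A] make the
    derivative of [g e^(i f)] equal to [(B + i A) / g * e^(i f)]. *)
Lemma motion_factor_derive (A B t : R) :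
  B <> 0 -> 0 < 2 * B * t + 1 ->
  is_derive (fun r => Re (motion_factor A B r)) t
    (Re ((RtoC B + Ci * RtoC A) / RtoC (scale_fun B t) * expi (rot_fun A B t))%C) /\
  is_derive (fun r => Im (motion_factor A B r)) t
    (Im ((RtoC B + Ci * RtoC A) / RtoC (scale_fun B t) * expi (rot_fun A B t))%C).
Proof.
intros HB Ht.
assert (Hg : 0 < scale_fun B t) by now apply sqrt_lt_R0.
assert (Hgg : scale_fun B t * scale_fun B t = 2 * B * t + 1) by (apply sqrt_sqrt; lra).
assert (Dg : is_derive (scale_fun B) t (B / scale_fun B t)).
{ unfold scale_fun. auto_derive; [easy|]. field.
  intros E. unfold scale_fun in Hg. lra. }
assert (Df : is_derive (rot_fun A B) t (A / (2 * B * t + 1))).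
{ unfold rot_fun. auto_derive; [easy|]. field. lra. }
rewrite <- Hgg in Df. set (g := scale_fun B t) in *.
assert (Dc : is_derive (fun r => cos (rot_fun A B r)) t
  (A / (g * g) * - sin (rot_fun A B t))).
{ apply (is_derive_comp cos (rot_fun A B)); [apply is_derive_cos|exact Df]. }
assert (Ds : is_derive (fun r => sin (rot_fun A B r)) t
  (A / (g * g) * cos (rot_fun A B t))).
{ apply (is_derive_comp sin (rot_fun A B)); [apply is_derive_sin|exact Df]. }
split.
- replace (Re ((RtoC B + Ci * RtoC A) / RtoC g * expi (rot_fun A B t))%C) with
    (B / g * cos (rot_fun A B t) + scale_fun B t * (A / (g * g) * - sin (rot_fun A B t)))
    by (fold g; simpl; field; lra).
  apply is_derive_ext with (2 := is_derive_product _ _ _ _ _ Dg Dc).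
  intros r. simpl. ring.
- replace (Im ((RtoC B + Ci * RtoC A) / RtoC g * expi (rot_fun A B t))%C) with
    (B / g * sin (rot_fun A B t) + scale_fun B t * (A / (g * g) * cos (rot_fun A B t)))
    by (fold g; simpl; field; lra).
  apply is_derive_ext with (2 := is_derive_product _ _ _ _ _ Dg Ds).
  intros r. simpl. ring.
Qed.

(** Up to the common rotation, the normal speed is [<(B + i A) X, N> / g]. Since
    [<i X, i T> = <X, T>], this is [(A <X,T> + B <X,N>) / g = k / g], the curvature of the curve
    enlarged by [g]. *)
Lemma rotating_shrinking_flow (A B : R) (X T : R -> C) :
  B < 0 -> solves A B X T ->
  curve_shortening_flow X (- (1 / (2 * B))) (rotating_shrinking A B X).
Proof.
intros HB H. split.
- intros u. unfold rotating_shrinking, scale_fun, rot_fun, expi.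
  rewrite Rmult_0_r, Rplus_0_l, sqrt_1, ln_1, Rmult_0_r, cos_0, sin_0.
  apply C_eq; simpl; unfold Re, Im; ring.
- intros t Ht. assert (Ht' := time_factor_pos B t HB (proj2 Ht)).
  assert (Hz := motion_factor_neq_0 A B t Ht').
  split; [now apply (immersed_scaled A B (motion_factor A B t) X T)|].
  intros u. set (g := scale_fun B t).
  assert (Hg : 0 < g) by now apply sqrt_lt_R0.
  destruct (motion_factor_derive A B t) as [D1 D2]; [lra|easy|].
  set (d := ((RtoC B + Ci * RtoC A) / RtoC (scale_fun B t) * expi (rot_fun A B t))%C) in *.
  exists (d * X u)%C. split.
  + apply time_derivative_of_components; [easy| |].
    * replace (Re (d * X u)%C) with (Re (X u) * Re d + - Im (X u) * Im d)
        by (unfold Re, Im; simpl; ring).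
      apply is_derive_ext with
        (2 := is_derive_linear_comb _ _ (Re (X u)) (- Im (X u)) _ _ _ D1 D2).
      intros r. unfold rotating_shrinking, motion_factor, Re, Im. simpl. ring.
    * replace (Im (d * X u)%C) with (Im (X u) * Re d + Re (X u) * Im d)
        by (unfold Re, Im; simpl; ring).
      apply is_derive_ext with
        (2 := is_derive_linear_comb _ _ (Im (X u)) (Re (X u)) _ _ _ D1 D2).
      intros r. unfold rotating_shrinking, motion_factor, Re, Im. simpl. ring.
  + rewrite (rotating_shrinking_curvature A B t X T u Ht' H). fold g.
    unfold normal.
    change (fun w => rotating_shrinking A B X w t)
      with (fun w => motion_factor A B t * X w)%C.
    rewrite (tangent_scaled (motion_factor A B t) X T (phase_x A B X T) u Hz H).
    rewrite motion_factor_Cmod. fold g.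
    set (e := expi (rot_fun A B t)) in *.
    assert (HgC : RtoC g <> 0%C) by (intros E; apply (f_equal Re) in E; simpl in E; lra).
    replace (Ci * (motion_factor A B t / RtoC g * T u))%C with (e * (Ci * T u))%C
      by (unfold motion_factor; fold g e; field; easy).
    replace (d * X u)%C with (e * ((RtoC B + Ci * RtoC A) / RtoC g * X u))%C
      by (unfold d; fold g; field; easy).
    unfold e. rewrite inner_rotate. unfold phase_x. rewrite !inner_eq.
    unfold Re, Im. simpl. field. lra.
Qed.

(** * Singularity formation and extinction *)

Lemma solves_curvature_nonzero (A B : R) (X T : R -> C) :
  A <> 0 -> solves A B X T -> exists s, phase_x A B X T s <> 0.
Proof.
intros HA H. apply NNPP. intros Hn.
assert (H0 : forall s, phase_x A B X T s = 0).
{ intros s. apply NNPP. intros h. apply Hn. now exists s. }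
destruct (solves_phase_flow A B X T H 0) as [Hx _].
apply is_derive_ext with (1 := H0) in Hx.
apply is_derive_unique in Hx. rewrite Derive_const, H0 in Hx. lra.
Qed.

Lemma rotating_shrinking_blow_up (A B : R) (X T : R -> C) :
  A <> 0 -> B < 0 -> solves A B X T ->
  curvature_blows_up (- (1 / (2 * B))) (rotating_shrinking A B X).
Proof.
intros HA HB H M. destruct (solves_curvature_nonzero A B X T HA H) as [u Hu].
set (ka := Rabs (phase_x A B X T u)).
assert (Hka : 0 < ka) by now apply Rabs_pos_lt.
(* At the fixed point [u] the curvature is [ka / g] in absolute value, which exceeds [|M|] once
   [g < q]. As [g^2] is [- 2 B] times the remaining time, this holds within [q^2 / (- 2 B)] of the
   final time. *)
set (q := ka / (Rabs M + 1)).
assert (HM : 0 < Rabs M + 1) by (assert (p := Rabs_pos M); lra).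
assert (Hq : 0 < q) by now apply Rdiv_lt_0_compat.
assert (Hd : 0 < q ^ 2 / (- 2 * B)).
{ apply Rdiv_lt_0_compat; [now apply pow_lt|lra]. }
exists (mkposreal _ Hd). intros t Hball Ht. exists u.
assert (Ht' := time_factor_pos B t HB Ht).
rewrite (rotating_shrinking_curvature A B t X T u Ht' H).
assert (Hg : 0 < scale_fun B t) by now apply sqrt_lt_R0.
assert (Hgg : scale_fun B t * scale_fun B t = 2 * B * t + 1) by (apply sqrt_sqrt; lra).
assert (Hgq : scale_fun B t < q).
{ change (Rabs (t - - (1 / (2 * B))) < q ^ 2 / (- 2 * B)) in Hball.
  rewrite Rabs_left in Hball by lra.
  assert (E : q ^ 2 / (- 2 * B) * (- 2 * B) = q ^ 2) by (field; lra).
  assert (E' : - (t - - (1 / (2 * B))) * (- 2 * B) = 2 * B * t + 1) by (field; lra).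
  assert (2 * B * t + 1 < q ^ 2) by (rewrite <- E, <- E'; apply Rmult_lt_compat_r; lra).
  nra. }
rewrite Rabs_div by lra. fold ka. rewrite (Rabs_pos_eq (scale_fun B t)) by lra.
apply Rle_lt_trans with (Rabs M); [apply Rle_abs|].
apply Rmult_lt_reg_r with (scale_fun B t); [easy|].
replace (ka / scale_fun B t * scale_fun B t) with ka by (field; lra).
assert (E : q * (Rabs M + 1) = ka) by (unfold q; field; lra).
assert (p := Rabs_pos M). nra.
Qed.

Lemma solves_bounded_between (A B s t : R) (X T : R -> C) :
  A <> 0 -> solves A B X T -> s <= t ->
  exists M, forall r, s <= r <= t -> Cmod (X r) <= M.
Proof.
intros HA H Hst.
destruct (continuity_ab_maj (fun r => phase_x A B X T r ^ 2 + phase_y A B X T r ^ 2) s t Hst)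
  as [m [Hm _]].
- intros r _. destruct (solves_phase_flow A B X T H r) as [Hx Hy].
  set (x := phase_x A B X T) in *. set (y := phase_y A B X T) in *.
  apply derivable_continuous_pt, ex_derive_Reals_0. clearbody x y.
  auto_derive. repeat split; eexists; eassumption.
- set (K := phase_x A B X T m ^ 2 + phase_y A B X T m ^ 2) in *.
  assert (HL := sqr_sum_pos A B HA).
  exists (K / (A ^ 2 + B ^ 2) + 1). intros r Hr. specialize (Hm r Hr). simpl in Hm.
  fold K in Hm.
  assert (N := phase_norm A B X T r H).
  assert (Cmod (X r) ^ 2 <= K / (A ^ 2 + B ^ 2)).
  { apply Rmult_le_reg_l with (A ^ 2 + B ^ 2); [easy|].
    replace ((A ^ 2 + B ^ 2) * (K / (A ^ 2 + B ^ 2))) with K by (field; lra).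
    rewrite N. simpl. exact Hm. }
  assert (p := pow2_ge_0 (Cmod (X r) - 1)). nra.
Qed.

Lemma type1_bounded (A B : R) (X T : R -> C) :
  A <> 0 -> solves A B X T -> type1 A B X -> bounded_curve X.
Proof.
intros HA H [H1 H2].
apply wraps_Cmod_lim in H1; [|easy]. apply wraps_Cmod_lim in H2; [|easy].
set (rho := 1 / sqrt (- B)) in *.
destruct (proj2 (is_lim_p_R _ _) H1 1 Rlt_0_1) as [S1 HS1].
destruct (proj2 (is_lim_p_R _ _) H2 1 Rlt_0_1) as [S2 HS2].
destruct (solves_bounded_between A B (Rmin 0 (- S2)) (Rmax 0 S1) X T HA H) as [M HM].
{ apply Rle_trans with 0; [apply Rmin_l|apply Rmax_l]. }
exists (Rmax M (rho + 1)). intros s.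
destruct (Rle_or_lt s (Rmax 0 S1)) as [h1|h1].
- destruct (Rle_or_lt (Rmin 0 (- S2)) s) as [h2|h2].
  + eapply Rle_trans; [apply HM; lra|apply Rmax_l].
  + assert (h3 : s < - S2) by (eapply Rlt_le_trans; [exact h2|apply Rmin_r]).
    specialize (HS2 (- s) ltac:(lra)). unfold reverse in HS2.
    rewrite Ropp_involutive in HS2. apply Rabs_def2 in HS2.
    eapply Rle_trans; [|apply Rmax_r]. lra.
- assert (h3 : S1 < s) by (eapply Rle_lt_trans; [apply Rmax_r|exact h1]).
  specialize (HS1 s ltac:(lra)). apply Rabs_def2 in HS1.
  eapply Rle_trans; [|apply Rmax_r]. lra.
Qed.

Lemma bounded_disappears (A B : R) (X : R -> C) :
  B < 0 -> bounded_curve X ->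
  disappears_into_origin (- (1 / (2 * B))) (rotating_shrinking A B X).
Proof.
intros HB [M HM].
destruct (completeness (fun r => exists u, r = Cmod (X u))) as [m [Hub Hlub]].
{ exists M. intros r [u ->]. apply HM. }
{ now exists (Cmod (X 0)), 0. }
(* All moduli are multiplied by [scale_fun B t], hence so is their supremum; this factor is
   continuous and vanishes at the final time. *)
exists (fun t => scale_fun B t * m).
assert (HC : forall u t, Cmod (rotating_shrinking A B X u t) = scale_fun B t * Cmod (X u)).
{ intros u t. unfold rotating_shrinking. rewrite Cmod_mult. f_equal.
  apply motion_factor_Cmod. }
split.
- intros t Ht. assert (Ht' := time_factor_pos B t HB (proj2 Ht)).
  assert (Hg : 0 < scale_fun B t) by now apply sqrt_lt_R0.
  split.
  + intros r [u ->]. rewrite HC. apply Rmult_le_compat_l; [lra|]. apply Hub. now exists u.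
  + intros b Hb. assert (m <= b / scale_fun B t).
    { apply Hlub. intros r [u ->]. apply Rmult_le_reg_l with (scale_fun B t); [easy|].
      replace (scale_fun B t * (b / scale_fun B t)) with b by (field; lra).
      apply Hb. exists u. now rewrite HC. }
    replace b with (scale_fun B t * (b / scale_fun B t)) by (field; lra).
    apply Rmult_le_compat_l; lra.
- eapply filterlim_filter_le_1; [apply filter_le_within|].
  assert (Hc : continuous (fun t => scale_fun B t * m) (- (1 / (2 * B)))).
  { apply (@continuous_mult R_UniformSpace R_AbsRing); [|apply continuous_const].
    apply (@continuous_comp R_UniformSpace R_UniformSpace R_UniformSpace
      (fun t => 2 * B * t + 1) sqrt); [|apply continuous_sqrt].
    apply (is_derive_continuous _ _ (2 * B)). auto_derive; [easy|ring]. }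
  unfold continuous in Hc.
  replace (scale_fun B (- (1 / (2 * B))) * m) with 0 in Hc; [exact Hc|].
  unfold scale_fun. replace (2 * B * - (1 / (2 * B)) + 1) with 0 by (field; lra).
  rewrite sqrt_0. ring.
Qed.

(** * The dichotomy and the zero of the curvature *)

Lemma self_similar_not_equilibrium (A B : R) (X : R -> C) :
  A <> 0 -> B < 0 -> self_similar_curve A B X ->
  exists s, phase_x A B X (tangent X) s ^ 2 <> - B.
Proof.
intros HA HB HX. assert (H := self_similar_solves A B X HX).
apply NNPP. intros Hn. apply HX. apply (equilibrium_traces_circle A B X (tangent X)); try easy.
intros s. apply NNPP. intros h. apply Hn. now exists s.
Qed.

Lemma type1_or_type2 (A B : R) (X : R -> C) :
  A <> 0 -> B < 0 -> self_similar_curve A B X -> type1 A B X \/ type2 A B X.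
Proof.
intros HA HB HX. assert (H := self_similar_solves A B X HX).
destruct (classic (exists s, phase_x A B X (tangent X) s = 0)) as [[s Hs]|Hn].
- left. now apply (type1_of_zero A B s X (tangent X)).
- right. destruct (self_similar_not_equilibrium A B X HA HB HX) as [s1 Hs1].
  destruct (orientation_exists A HA) as [ep Hep].
  apply (type2_cases A B ep s1 X (tangent X)); try easy.
  intros s E. apply Hn. now exists s.
Qed.

(** Without a zero, [type2_cases] would make one end spiral out, whereas both ends of a curve of
    type 1 approach the circle. *)
Lemma type1_has_zero (A B : R) (X : R -> C) :
  A <> 0 -> B < 0 -> self_similar_curve A B X -> type1 A B X ->
  exists s, curvature X s = 0.
Proof.
intros HA HB HX [W1 W2]. assert (H := self_similar_solves A B X HX).
apply NNPP. intros Hn. destruct (self_similar_not_equilibrium A B X HA HB HX) as [s1 Hs1].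
destruct (orientation_exists A HA) as [ep Hep].
destruct (type2_cases A B ep s1 X (tangent X)) as [_ [[_ h]|[_ h]]]; try easy.
- intros s E. apply Hn. exists s. now rewrite (solves_curvature A B X (tangent X) s H).
- now apply (wraps_not_spirals_out A B _ _ HA W2).
- now apply (wraps_not_spirals_out A B _ _ HA W1).
Qed.

Lemma curvature_zero_unique (A B s t : R) (X T : R -> C) :
  A <> 0 -> solves A B X T -> curvature X s = 0 -> curvature X t = 0 -> s = t.
Proof.
intros HA H Hs Ht. rewrite (solves_curvature A B X T s H) in Hs.
rewrite (solves_curvature A B X T t H) in Ht.
destruct (orientation_exists A HA) as [ep Hep].
assert (P : forall s t, phase_x A B X T s = 0 -> phase_x A B X T t = 0 -> ~ s < t).
{ clear s t Hs Ht. intros s t Hs Ht Hlt.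
  assert (h := orientation_pos_after A B ep s X T Hep H Hs t Hlt). rewrite Ht in h. lra. }
destruct (Rtotal_order s t) as [h|[h|h]]; [|easy|].
- now destruct (P s t).
- now destruct (P t s).
Qed.

Theorem theorem4p1 (A B : R) (hA : A <> 0) (hB : B < 0) :
  (forall X : R -> C, self_similar_curve A B X -> type1 A B X \/ type2 A B X) /\
  ((forall X : R -> C, self_similar_curve A B X -> type1 A B X ->
      exists! s : R, curvature X s = 0) /\
   (forall y0 : R, exists X : R -> C,
      self_similar_curve A B X /\ type1 A B X /\
      exists s : R, curvature X s = 0 /\ yfun A B X s = y0) /\
   (forall (X1 X2 : R -> C) (s1 s2 : R),
      self_similar_curve A B X1 -> type1 A B X1 ->
      self_similar_curve A B X2 -> type1 A B X2 ->
      curvature X1 s1 = 0 -> curvature X2 s2 = 0 ->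
      (yfun A B X1 s1 = yfun A B X2 s2 <-> congruent X1 X2))) /\
  (exists X : R -> C, self_similar_curve A B X /\ type2 A B X) /\
  (forall X : R -> C, self_similar_curve A B X ->
     curve_shortening_flow X (- (1 / (2 * B))) (rotating_shrinking A B X) /\
     curvature_blows_up (- (1 / (2 * B))) (rotating_shrinking A B X) /\
     (type1 A B X ->
        bounded_curve X /\
        disappears_into_origin (- (1 / (2 * B))) (rotating_shrinking A B X))).
Proof.
assert (HL : A ^ 2 + B ^ 2 <> 0) by (assert (h := sqr_sum_pos A B hA); lra).
split; [now intros X HX; apply type1_or_type2|].
split; [split; [|split]|split].
- intros X HX H1. assert (H := self_similar_solves A B X HX).
  destruct (type1_has_zero A B X hA hB HX H1) as [s Hs].
  exists s. split; [easy|]. intros t Ht.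
  now apply (curvature_zero_unique A B s t X (tangent X)).
(* Starting on the line [x = 0] at the ordinate [y0]. The curve is not the circle, along which
   [x^2 = - B] is positive. *)
- intros y0. destruct (solves_exists A B 0 y0 HL) as [X [T [H [Hx Hy]]]].
  exists X. split; [|split].
  + apply (solves_self_similar A B X T H). intros Hc.
    assert (E := traces_circle_equilibrium A B X T hA hB H Hc 0). rewrite Hx in E. lra.
  + now apply (type1_of_zero A B 0 X T).
  + exists 0. rewrite (solves_curvature A B X T _ H), (solves_yfun A B X T _ H). easy.
- intros X1 X2 s1 s2 HX1 _ HX2 _ Hs1 Hs2.
  assert (H1 := self_similar_solves A B X1 HX1).
  assert (H2 := self_similar_solves A B X2 HX2). split.
  + intros Ey.
    rewrite (solves_curvature A B _ _ _ H1) in Hs1.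
    rewrite (solves_curvature A B _ _ _ H2) in Hs2.
    rewrite (solves_yfun A B _ _ _ H1), (solves_yfun A B _ _ _ H2) in Ey.
    apply (solves_unique A B s1 s2 X1 (tangent X1) X2 (tangent X2));
      [easy|easy|easy|congruence|easy].
  + intros [a [c Hc]].
    destruct (solves_congruent A B a c X1 (tangent X1) H1) as [H2' E].
    (* As an equality of functions, the congruence makes [X2] the moved curve itself. Its only zero
       of the curvature is then that of [X1] shifted by [c], which matches the two labels. *)
    apply functional_extensionality in Hc. rewrite <- Hc in H2', E.
    destruct (E s2) as [Ex Ey].
    rewrite (solves_curvature A B _ _ _ H2'), Ex in Hs2.
    assert (Es : s1 = s2 + c).
    { apply (curvature_zero_unique A B s1 (s2 + c) X1 (tangent X1)); try easy.
      now rewrite (solves_curvature A B _ _ _ H1). }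
    now rewrite (solves_yfun A B _ _ _ H1), (solves_yfun A B _ _ _ H2'), Ey, Es.
- destruct (orientation_exists A hA) as [ep Hep].
  destruct (phase_flow_shooting (ep * A) (- B)) as [w [y [Hf [Hw H0]]]];
    [apply Hep|lra|].
  (* Shooting gives an orbit of the system with parameter [- |A|]; [x = - ep w] turns it into one
     with parameter [A]. A curve with the same initial phase point follows this orbit by uniqueness,
     so its curvature never vanishes. *)
  destruct (solves_exists A B (- ep * w 0) (y 0) HL) as [X [T [H [Hx Hy]]]].
  assert (Hee := orientation_sqr A ep Hep).
  assert (Hf' : phase_flow A (- B) (fun s => - ep * w s) y).
  { intros s. destruct (Hf s) as [h1 h2]. split.
    - replace (A + - ep * w s * y s) with (- ep * (- (ep * A) + w s * y s))
        by (transitivity (ep * ep * A + - ep * w s * y s); [ring|rewrite Hee; ring]).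
      now apply is_derive_scal.
    - replace ((- ep * w s) ^ 2) with (w s ^ 2); [easy|].
      transitivity (ep * ep * w s ^ 2); [rewrite Hee|]; ring. }
  assert (E : forall s, phase_x A B X T s = - ep * w s).
  { intros s. apply (phase_flow_unique A (- B) 0 _ (phase_y A B X T) _ y
      (solves_phase_flow A B X T H) Hf' Hx Hy s). }
  assert (H0' : phase_x A B X T 0 ^ 2 <> - B).
  { rewrite E. replace ((- ep * w 0) ^ 2) with (w 0 ^ 2); [easy|].
    transitivity (ep * ep * w 0 ^ 2); [rewrite Hee|]; ring. }
  exists X. split.
  + apply (solves_self_similar A B X T H). intros Hc. apply H0'.
    now apply traces_circle_equilibrium.
  + apply (type2_cases A B ep 0 X T); try easy.
    intros s. rewrite E. specialize (Hw s). destruct Hep as [[->| ->] _]; lra.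
- intros X HX. assert (H := self_similar_solves A B X HX). split; [|split].
  + now apply (rotating_shrinking_flow A B X (tangent X)).
  + now apply (rotating_shrinking_blow_up A B X (tangent X)).
  + intros H1. assert (HbX := type1_bounded A B X (tangent X) hA H H1).
    split; [easy|]. now apply bounded_disappears.
Qed.
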